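(* Let $d\ge 2$, let $2\leq p<d$ and let $B$ be a smooth and closed magnetic field on $\mathbb{R}^d$ with $B\neq 0$ (i.e. $B$ is not identically zero). Then there exists a constant $C_{B,p,d}>0$ (not depending on the choice of $A$) such that for every vector field (magnetic potential) $A$ with $dA=B$ we have $$\int_{\mathbb{R}^d}|\nabla_A u|^p\,dx-\mu_{p,d}\int_{\mathbb{R}^d}\frac{|u|^p}{|x|^p}\,dx\;\geq\; C_{B,p,d}\int_{\mathbb{R}^d}\rho(x)\,|u|^p\,dx,\qquad\forall u\in\mathcal{D}(h_{A,p}),$$ where $$\rho(x):=\frac{1}{|x|^p\left(1+\left|\log|x|\right|^p\right)}.$$
   Context: A magnetic field is a smooth function $B:\mathbb{R}^d\to\mathbb{R}^{d\times d}$ with skew-symmetric values, identified with a differential 2-form on $\mathbb{R}^d$; it is closed if its exterior derivative vanishes, $dB=0$. A magnetic potential for $B$ is a smooth vector field $A=(A_1,\dots,A_d):\mathbb{R}^d\to\mathbb{R}^d$, identified with a 1-form, such that $dA=B$, i.e. $B_{ij}=\partial A_j/\partial x^i-\partial A_i/\partial x^j$. The functions $u$ are complex-valued, and the magnetic gradient is $\nabla_A u:=\nabla u+iA(x)u$. The quadratic form is $h_{A,p}[u]:=\int_{\mathbb{R}^d}|\nabla_A u|^p\,dx$, and its domain $\mathcal{D}(h_{A,p})$ is the closure of $C_c^\infty(\mathbb{R}^d)$ with respect to the norm $\|u\|:=\left(h_{A,p}[u]+\|u\|_{L^p(\mathbb{R}^d)}^p\right)^{1/p}$. Moreover, $\mu_{p,d}:=\left(\frac{d-p}{p}\right)^p$.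 *)

(* Defs.v *)
From HB Require Import structures.
From mathcomp Require Import all_boot all_order all_algebra.
From mathcomp Require Import all_classical all_reals all_analysis.
From mathcomp Require Import complex.

Set Implicit Arguments.
Unset Strict Implicit.
Unset Printing Implicit Defensive.

Import Order.TTheory GRing.Theory Num.Theory.
Import numFieldNormedType.Exports.

Local Open Scope classical_set_scope.
Local Open Scope ring_scope.

(* Borel sigma-algebra of R^n: the one generated by the coordinate maps. *)
Definition rV_display : measure_display -> measure_display.
Proof. exact. Qed.

Section measurable_rV.
Context {disp : measure_display} {T : measurableType disp}.
Variable n : nat.

Definition rV_coord (i : 'I_n) (x : 'rV[T]_n) : T := x ord0 i.

Let rV_set0 : g_sigma_preimage rV_coord set0.
Proof. exact: sigma_algebra0. Qed.

Let rV_setC A : g_sigma_preimage rV_coord A ->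
  g_sigma_preimage rV_coord (~` A).
Proof. exact: sigma_algebraC. Qed.

Let rV_bigcup (F : (set 'rV[T]_n)^nat) :
  (forall i, g_sigma_preimage rV_coord (F i)) ->
  g_sigma_preimage rV_coord (\bigcup_i F i).
Proof. exact: sigma_algebra_bigcup. Qed.

HB.instance Definition _ := @isMeasurable.Build (rV_display disp)
  'rV[T]_n (g_sigma_preimage rV_coord) rV_set0 rV_setC rV_bigcup.

Lemma measurable_rV_coord (i : 'I_n) :
  measurable_fun [set: 'rV[T]_n] (fun x : 'rV[T]_n => x ord0 i).
Proof.
move=> _ Y mY; rewrite setTI; apply: sub_sigma_algebra => /=.
rewrite -bigcup_seq/=; exists i => /=; first by rewrite mem_index_enum.
by exists Y => //; rewrite setTI.
Qed.

Lemma measurable_fun_rVP d1 (T1 : measurableType d1) (f : T1 -> 'rV[T]_n) :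
  (forall i, measurable_fun [set: T1] (fun x => f x ord0 i)) ->
  measurable_fun [set: T1] f.
Proof.
move=> mf.
have S : g_sigma_preimage (fun i => @rV_coord i \o f) `<=` measurable.
  apply: smallest_sub; first exact: sigma_algebra_measurable.
  rewrite -bigcup_seq; apply: bigcup_sub => i _.
  by move=> A [B mB <-]; exact: mf.
move: S; rewrite g_sigma_preimage_comp => S _ A mA.
by apply: S; exists A.
Qed.

End measurable_rV.

Section lebesgue_rV_step.
Variables (R : realType) (n : nat).
Variable mu : {sigma_finite_measure set 'rV[R]_n -> \bar R}.

Definition rV_cons (p : measurableTypeR R * 'rV[R]_n) : 'rV[R]_n.+1 :=
  \row_i oapp (fun j => p.2 ord0 j) p.1 (unlift ord0 i).

Definition rV_uncons (x : 'rV[R]_n.+1) : measurableTypeR R * 'rV[R]_n :=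
  (x ord0 ord0, \row_j x ord0 (lift ord0 j)).

Lemma rV_consK : cancel rV_cons rV_uncons.
Proof.
case=> a v; congr (_, _); first by rewrite mxE unlift_none.
by apply/rowP => j; rewrite !mxE liftK.
Qed.

Lemma measurable_rV_cons : measurable_fun [set: _] rV_cons.
Proof.
apply: measurable_fun_rVP => i; case: (unliftP ord0 i) => [j|] ->.
- have -> : (fun p => rV_cons p ord0 (lift ord0 j)) =
      (fun x : 'rV[R]_n => x ord0 j) \o snd.
    by apply: funext => p; rewrite mxE liftK.
  exact: (measurableT_comp (measurable_rV_coord j)).
- have -> : (fun p => rV_cons p ord0 ord0) = fst.
    by apply: funext => p; rewrite mxE unlift_none.
  exact: measurable_fst.
Qed.

Lemma measurable_rV_uncons : measurable_fun [set: _] rV_uncons.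
Proof.
apply: measurable_fun_pair; first exact: measurable_rV_coord.
apply: measurable_fun_rVP => j.
have -> : (fun x : 'rV[R]_n.+1 =>
    (\row_k x ord0 (lift ord0 k) : 'rV[R]_n) ord0 j) =
    (fun x => x ord0 (lift ord0 j)).
  by apply: funext => x; rewrite mxE.
exact: measurable_rV_coord.
Qed.

Definition lebesgue_rV_step : set 'rV[R]_n.+1 -> \bar R :=
  pushforward (@lebesgue_measure R \x mu)%E rV_cons.

Let mf := measurable_rV_cons.

Let lebesgue_rV_step0 : lebesgue_rV_step set0 = 0%E.
Proof. exact: measure0. Qed.

Let lebesgue_rV_step_ge0 A : (0 <= lebesgue_rV_step A)%E.
Proof. exact: measure_ge0. Qed.

Let lebesgue_rV_step_sigma_additive : semi_sigma_additive lebesgue_rV_step.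
Proof. exact: measure_semi_sigma_additive. Qed.

HB.instance Definition _ := isMeasure.Build _ _ _ lebesgue_rV_step
  lebesgue_rV_step0 lebesgue_rV_step_ge0 lebesgue_rV_step_sigma_additive.

Let lebesgue_rV_step_sigma_finite : sigma_finite setT lebesgue_rV_step.
Proof.
have /sigma_finiteP[F [TF ndF Foo]] := sigma_finiteT (@lebesgue_measure R).
have /sigma_finiteP[G [TG ndG Goo]] := sigma_finiteT mu.
exists (fun k => rV_uncons @^-1` (F k `*` G k)).
  rewrite -preimage_bigcup (_ : \bigcup_k _ = setT) ?preimage_setT//.
  rewrite -subTset => -[a v] _.
  have [k _ Fka] : (\bigcup_k F k) a by rewrite -TF.
  have [l _ Glv] : (\bigcup_k G k) v by rewrite -TG.
  exists (maxn k l) => //; split => /=.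
  - by move: a Fka; exact/subsetPset/ndF/leq_maxl.
  - by move: v Glv; exact/subsetPset/ndG/leq_maxr.
move=> k; have [[mFk Fkoo] [mGk Gkoo]] := (Foo k, Goo k); split.
  rewrite -[X in measurable X]setTI.
  by apply: measurable_rV_uncons => //; exact: measurableX.
rewrite /lebesgue_rV_step /pushforward -comp_preimage.
have -> : rV_uncons \o rV_cons = id by apply: funext => p; exact: rV_consK.
by rewrite preimage_id product_measure1E// lte_mul_pinfty// ge0_fin_numE.
Qed.

HB.instance Definition _ := Measure_isSigmaFinite.Build _ _ _
  lebesgue_rV_step lebesgue_rV_step_sigma_finite.

End lebesgue_rV_step.

(* lebesgue_rV R n is the n-fold product of the Lebesgue measure on R; the case
   n = 0 is the unit mass on the one-point space 'rV[R]_0. The lemma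
   lebesgue_rV_box below characterizes it. *)
Fixpoint lebesgue_rV (R : realType) (n : nat) :
    {sigma_finite_measure set 'rV[R]_n -> \bar R} :=
  if n is m.+1 then lebesgue_rV_step (lebesgue_rV R m)
  else \d_(0 : 'rV[R]_0).

Lemma measurable_rV_box (R : realType) (n : nat) (A : 'I_n -> set R) :
  (forall i, measurable (A i)) ->
  measurable [set x : 'rV[R]_n | forall i, A i (x ord0 i)].
Proof.
move=> mA; rewrite (_ : mkset _ = \bigcap_(i in [set: 'I_n])
    ((fun x : 'rV[R]_n => x ord0 i) @^-1` A i)).
  apply: fin_bigcap_measurable => // i _.
  by rewrite -[X in measurable X]setTI; exact: (measurable_rV_coord i measurableT (mA i)).
by apply/seteqP; split=> x /= Ax i => [_|]; exact: Ax.
Qed.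

Lemma lebesgue_rV_box (R : realType) (n : nat) (A : 'I_n -> set R) :
  (forall i, measurable (A i)) ->
  lebesgue_rV R n [set x | forall i, A i (x ord0 i)] =
  (\prod_(i < n) @lebesgue_measure R (A i))%E.
Proof.
elim: n A => [|n ih] A mA /=.
  by rewrite big_ord0 /= diracE mem_set// => -[].
rewrite big_ord_recl -(ih (fun i => A (lift ord0 i)))//.
rewrite -product_measure1E; first last.
- exact: (measurable_rV_box (fun i => mA (lift ord0 i))).
- exact: mA.
rewrite /lebesgue_rV_step/= /pushforward; congr product_measure1.
apply/seteqP; split=> -[a v] /=.
  move=> Av; split=> [|i].
    by have := Av ord0; rewrite mxE unlift_none.
  by have := Av (lift ord0 i); rewrite mxE liftK.
move=> [A0 Av] i; case: (unliftP ord0 i) => [j|] ->; rewrite mxE.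
  by rewrite liftK; exact: Av.
by rewrite unlift_none.
Qed.

Section euclidean_calculus.
Variables (R : realType) (d : nat).
Local Notation E := 'rV[R]_d.

(* The library norm of 'rV[R]_d is the max norm, hence these Euclidean ones. *)
Definition enorm (x : E) : R := Num.sqrt (\sum_(i < d) x ord0 i ^+ 2).

Definition cenorm (z : 'rV[R[i]]_d) : R :=
  Num.sqrt (\sum_(i < d) Normc.normc (z ord0 i) ^+ 2).

Definition partial (i : 'I_d) (f : E -> R) : E -> R :=
  fun x => 'D_(delta_mx ord0 i) f x.

Definition iter_partial (s : seq 'I_d) (f : E -> R) : E -> R :=
  foldr partial f s.

(* C^infinity: all iterated partial derivatives exist and are continuous. *)
Definition smooth (f : E -> R) : Prop :=
  forall s : seq 'I_d, continuous (iter_partial s f) /\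
    forall x i, derivable (iter_partial s f) x (delta_mx ord0 i).

Definition Re_fun (u : E -> R[i]) : E -> R := fun x => complex.Re (u x).
Definition Im_fun (u : E -> R[i]) : E -> R := fun x => complex.Im (u x).

Definition test_function (phi : E -> R) : Prop :=
  smooth phi /\ compact (closure [set x | phi x != 0]).

Definition ctest_function (phi : E -> R[i]) : Prop :=
  [/\ smooth (Re_fun phi), smooth (Im_fun phi) &
      compact (closure [set x | phi x != 0])].

Definition gradient (phi : E -> R[i]) : E -> 'rV[R[i]]_d :=
  fun x => \row_i (partial i (Re_fun phi) x +i* partial i (Im_fun phi) x)%C.

Definition loc_integrable (f : E -> R) : Prop :=
  measurable_fun [set: E] f /\
  forall K : set E, compact K -> (lebesgue_rV R d).-integrable K (EFin \o f).

Definition weak_partial (i : 'I_d) (f g : E -> R) : Prop :=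
  [/\ loc_integrable f, loc_integrable g & forall phi, test_function phi ->
    \int[lebesgue_rV R d]_x (f x * partial i phi x) =
    - \int[lebesgue_rV R d]_x (g x * phi x)].

Definition weak_gradient (u : E -> R[i]) (Du : E -> 'rV[R[i]]_d) : Prop :=
  forall i, weak_partial i (Re_fun u) (Re_fun (fun x => Du x ord0 i)) /\
            weak_partial i (Im_fun u) (Im_fun (fun x => Du x ord0 i)).

End euclidean_calculus.

Section magnetic.
Variables (R : realType) (d : nat).
Local Notation E := 'rV[R]_d.

Definition magnetic_field (B : E -> 'M[R]_d) : Prop :=
  (forall i j, smooth (fun x => B x i j)) /\ forall x, (B x)^T = - B x.

(* (dB)_ijk for the 2-form B = \sum_(i < j) B_ij dx^i /\ dx^j *)
Definition ext_deriv2 (B : E -> 'M[R]_d) (i j k : 'I_d) (x : E) : R :=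
  partial i (fun y => B y j k) x + partial j (fun y => B y k i) x +
  partial k (fun y => B y i j) x.

Definition closed_field (B : E -> 'M[R]_d) : Prop :=
  forall i j k x, ext_deriv2 B i j k x = 0.

Definition ext_deriv1 (A : E -> 'rV[R]_d) : E -> 'M[R]_d :=
  fun x => \matrix_(i, j) (partial i (fun y => A y ord0 j) x -
                           partial j (fun y => A y ord0 i) x).

Definition magnetic_potential (B : E -> 'M[R]_d) (A : E -> 'rV[R]_d) : Prop :=
  (forall j, smooth (fun x => A x ord0 j)) /\ ext_deriv1 A = B.

(* nabla_A u, where Du is the (weak) gradient of u *)
Definition magnetic_gradient (A : E -> 'rV[R]_d) (u : E -> R[i])
    (Du : E -> 'rV[R[i]]_d) : E -> 'rV[R[i]]_d :=
  fun x => Du x + \row_j ('i%C * (A x ord0 j)%:C%C * u x).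

Definition magnetic_form (A : E -> 'rV[R]_d) (p : R) (u : E -> R[i])
    (Du : E -> 'rV[R[i]]_d) : \bar R :=
  (\int[lebesgue_rV R d]_x (cenorm (magnetic_gradient A u Du x) `^ p)%:E)%E.

Definition form_norm (A : E -> 'rV[R]_d) (p : R) (u : E -> R[i])
    (Du : E -> 'rV[R[i]]_d) : \bar R :=
  ((magnetic_form A p u Du +
    \int[lebesgue_rV R d]_x (Normc.normc (u x) `^ p)%:E) `^ p^-1)%E.

(* The closure of C_c^infinity for form_norm. An element of the domain is given
   together with its weak gradient Du, which u determines almost everywhere;
   L^p bounds on u and nabla_A u follow from the approximation property. *)
Definition form_domain (A : E -> 'rV[R]_d) (p : R) (u : E -> R[i])
    (Du : E -> 'rV[R[i]]_d) : Prop :=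
  weak_gradient u Du /\
  forall e : R, 0 < e -> exists2 phi, ctest_function phi &
    (form_norm A p (u \- phi)%R (Du \- gradient phi)%R < e%:E)%E.

Definition hardy_constant (p : R) : R := ((d%:R - p) / p) `^ p.

Definition log_weight (p : R) (x : E) : R :=
  (enorm x `^ p * (1 + `|ln (enorm x)| `^ p))^-1.

End magnetic.

(* Main.v *)
(* Let lambda = (d - p) / p, mu = lambda^p and tau = nabla_A u + lambda x u / |x|^2.
   Strong convexity of |.|^p gives pointwise
     |nabla_A u|^p >= mu |u|^p / |x|^p + c |tau|^p - div (lambda^(p-1) x |u|^p / |x|^p),
   and the remainder |tau|^p is traded for a weight by two more divergences.
   The first is that of eta G |u|^p, where G is the sum of a radial field
   x |x|^(-p) h(log |x| - log |x0|), h(s) = - s (sg^2 + s^2)^(-p/2), whose divergence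
   dominates the logarithmic weight away from the sphere through x0, and of a field
   tangent to the spheres that is a source on the shell around this sphere except in
   a ball around x0. The sink left in the ball is paid for by the magnetic field: if
   B_ij >= b0 > 0 there, the current J_k = Im (conj u (nabla_A u)_k) satisfies
     d_i J_j - d_j J_i = 2 Im (conj (nabla_A u)_i (nabla_A u)_j) + B_ij |u|^2,
   and, lambda x / |x|^2 being real, J and the terms produced by localizing this
   identity can be expressed through tau, so that the integral of |u|^p over the
   ball is controlled by that of |tau|^p. A small eta closes the argument.
   Near the origin the fields are multiplied by a nondecreasing function of |x|,
   whose derivative has the favourable sign; it is removed by Fatou after the
   inequality, with a then bounded weight, has been extended to the form domain. *)

(* Without a magnetic field [mu] is critical: [|x|^(-lambda)] is a generalized ground state, and no
   nontrivial nonnegative weight can be added. Since [tau] equals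
   [|x|^(-lambda) nabla_A (|x|^lambda u)], it measures the distance to that ground state, and only
   [B] keeps it from being small. A gain is thus available in one ball only, and the fields
   transport it to the rest of the space. A radial field alone would leave its sink on a whole
   sphere, where [B] may vanish outside the ball; the tangential field gathers this sink in the
   ball. The potential enters only through [tau] and [dA = B], which is why the constants do not see
   the gauge. The power of the logarithm comes from Young's inequality: the cross term
   [|G| |u|^(p-1) |tau|] is absorbed if [|G|^(p/(p-1))] is bounded by the weight, and [h] of order
   [s^(1-p)] with [h'] of order [s^(-p)] is exactly balanced. With [u = a + i b], all profiles are
   functions of [y = |x|^2] and [z = <x, x0>], so that sums over components reduce to identities in
   a few real variables. *)
Require Import Defs.
From mathcomp Require Import all_boot all_order all_algebra.
From mathcomp Require Import all_classical all_reals all_analysis.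
From mathcomp Require Import complex.
From mathcomp Require Import measurable_realfun.
From mathcomp Require Import ring lra.

Set Implicit Arguments.
Unset Strict Implicit.
Unset Printing Implicit Defensive.

Import Order.TTheory GRing.Theory Num.Theory.
Import numFieldNormedType.Exports.

Local Open Scope classical_set_scope.
Local Open Scope ring_scope.

(** * Borel sets and integrability on the product space *)

Section measure_on_rV.
Variable R : realType.

(** The sigma-algebra comes from the coordinates, the topology from the max norm. The boxes with
    rational corners contained in [U] are countably many and cover it, which reconciles the two. *)
Lemma open_measurable_rV n (U : set 'rV[R]_n) : open U -> measurable U.
Proof.
move=> oU.
pose box (c : {ffun 'I_n -> rat} * {ffun 'I_n -> rat}) : set 'rV[R]_n :=
  [set x | forall i, `]ratr (c.1 i), ratr (c.2 i)[%classic (x ord0 i)].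
pose F c := if `[< box c `<=` U >] then box c else set0.
rewrite (_ : U = \bigcup_c F c); first last.
  apply/seteqP; split=> [x Ux|x [c _]]; last first.
    by rewrite /F; case: asboolP => [h /h|_ []].
  have /nbhs_ballP[e /= e0 xeU] : nbhs x U by apply: open_nbhs_nbhs; split.
  have lox i : exists q : rat, ratr q \in `]x ord0 i - e, x ord0 i[.
    by apply: rat_in_itvoo; rewrite ltrBlDr ltrDl.
  have hix i : exists q : rat, ratr q \in `]x ord0 i, x ord0 i + e[.
    by apply: rat_in_itvoo; rewrite ltrDl.
  have [lo loP] := choice lox; have [hi hiP] := choice hix.
  pose c := (finfun lo, finfun hi); exists c => //.
  have xc : box c x.
    move=> i /=; rewrite !ffunE in_itv/=.
    by move: (loP i) (hiP i); rewrite !in_itv/= => /andP[_ ->] /andP[->].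
  rewrite /F; case: asboolP => // -[] y yc; apply: xeU.
  rewrite /ball/= /mx_ball; split => // i j; rewrite ord1.
  move: (yc j) (loP j) (hiP j); rewrite /= !ffunE !in_itv/=.
  move=> /andP[ly yh] /andP[l1 l2] /andP[h1 h2].
  rewrite /ball/= ltr_distlC; apply/andP; split; first exact: lt_trans ly.
  exact: lt_trans h2.
apply: countable_bigcupT_measurable; first exact: countableP.
move=> c; rewrite /F; case: asboolP => // _.
apply: (@measurable_rV_box R n (fun i => `]ratr (c.1 i), ratr (c.2 i)[%classic)).
by move=> i; exact: measurable_itv.
Qed.

Lemma continuous_measurable_fun_rV n (f : 'rV[R]_n -> R) :
  continuous f -> measurable_fun setT f.
Proof.
move=> /continuousP cf; apply: (measurability _ (RGenOpens.measurableE R)).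
move=> _ [_ [a [b ->] <-]]; rewrite setTI; apply: open_measurable_rV.
exact/cf/interval_open.
Qed.

Lemma compact_measurable_rV n (K : set 'rV[R]_n) : compact K -> measurable K.
Proof.
move=> cK; rewrite -(setCK K); apply: measurableC.
by apply: open_measurable_rV; rewrite openC; exact: compact_closed.
Qed.

(** A cube rather than a compact support: the condition passes to coordinate slices and to partial
    derivatives with the same [M]. *)
Definition supp_in n (M : R) (f : 'rV[R]_n -> R) : Prop :=
  forall x, f x != 0 -> forall i, `|x ord0 i| <= M.

Lemma compact_supp_in n (f : 'rV[R]_n -> R) :
  compact (closure [set x | f x != 0]) -> exists M, supp_in M f.
Proof.
move=> /compact_bounded[M [_ Mb]]; exists (M + 1) => x fx i.
have : `|x| <= M + 1 by apply: Mb; rewrite ?ltrDl//; exact: subset_closure.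
by apply: le_trans; rewrite [leRHS]mx_normrE (le_bigmax _ _ (ord0, i)).
Qed.

Lemma compact_cube n (M : R) :
  compact [set x : 'rV[R]_n | forall i, `[- M, M]%classic (x ord0 i)].
Proof.
apply: (@rV_compact R n (fun=> `[- M, M]%classic)) => _; exact: segment_compact.
Qed.

Lemma continuous_bounded_on_cube n (M : R) (f : 'rV[R]_n -> R) :
  continuous f -> exists C, forall x : 'rV[R]_n, (forall i, `|x ord0 i| <= M) -> `|f x| <= C.
Proof.
move=> cf.
have cN : continuous (fun x => `|f x|).
  by move=> x; apply: continuous_comp; [exact: cf|exact: norm_continuous].
have := continuous_compact (continuous_subspaceT cN) (@compact_cube n M).
move=> /compact_bounded[C [_ Cb]]; exists (C + 1) => x xM.
rewrite -[leLHS]normr_id; apply: Cb; rewrite ?ltrDl//.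
by exists x => // i; move: (xM i); rewrite ler_norml /= in_itv.
Qed.

Lemma continuous_supp_integrable n (M : R) (f : 'rV[R]_n -> R) :
  continuous f -> supp_in M f -> (lebesgue_rV R n).-integrable setT (EFin \o f).
Proof.
move=> cf sf.
pose K := [set x : 'rV[R]_n | forall i, `[- M, M]%classic (x ord0 i)].
have mK : measurable K by apply: compact_measurable_rV; exact: compact_cube.
have -> : EFin \o f = (EFin \o f) \_ K.
  apply/funext => x; rewrite /patch; case: ifPn => // /negP xK /=.
  have [->//|/sf fx] := eqVneq (f x) 0; exfalso; apply: xK; rewrite inE => i.
  by move: (fx i); rewrite ler_norml /= in_itv.
apply/(integrable_mkcond (EFin \o f) mK).
apply: measurable_bounded_integrable => //.
- rewrite [ltLHS](@lebesgue_rV_box R n (fun=> `[- M, M]%classic)); last first.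
    by move=> i; exact: measurable_itv.
  suff : (\prod_(i < n) (@lebesgue_measure R `[(- M)%R, M]%classic))%E \is a fin_num.
    by rewrite fin_numE ltey => /andP[].
  elim/big_ind : _ => // [x y|i _]; first exact: fin_numM.
  by rewrite lebesgue_measure_itv/=; case: ifP.
- by apply: measurable_funTS; exact: continuous_measurable_fun_rV.
- have [C Cb] := @continuous_bounded_on_cube n M f cf.
  exists C; split; first exact: num_real.
  move=> y Cy x xK; apply/(le_trans _ (ltW Cy))/Cb => i.
  by move: (xK i); rewrite ler_norml /= in_itv.
Qed.

End measure_on_rV.

(** * Integrals of partial derivatives vanish *)

Section divergence_theorem.
Variable R : realType.

(** A directional derivative sees only the restriction to a line; this transports it between spaces,
    in particular to coordinate slices. *)
Lemma is_derive_line (V1 V2 : normedModType R) (f : V1 -> R) (k : V2 -> R)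
    (x v : V1) (y w : V2) (df : R) :
  (forall h : R, f (h *: v + x) = k (h *: w + y)) ->
  is_derive x v f df -> is_derive y w k df.
Proof.
move=> fk.
have fxky : f x = k y by have := fk 0; rewrite !scale0r !add0r.
have E : (fun h : R => h^-1 *: ((f \o shift x) (h *: v) - f x)) =
         (fun h : R => h^-1 *: ((k \o shift y) (h *: w) - k y)).
  by apply/funext => h /=; rewrite fk fxky.
by case=> dfx <-; split; rewrite /derivable /derive -?E// E.
Qed.

Lemma continuous_rV (T : topologicalType) n (F : T -> 'rV[R]_n) :
  (forall i, continuous (fun t => F t ord0 i)) -> continuous F.
Proof.
move=> cF t A [P FP sPA]; apply: (@filterS _ _ _
  [set s | forall ij : 'I_1 * 'I_n, P ij.1 ij.2 (F s ij.1 ij.2)]).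
  by move=> s Ps; apply: sPA => i j; exact: (Ps (i, j)).
apply: filter_forall => -[i j] /=; rewrite ord1.
by apply: cF; have := FP ord0 j.
Qed.

(** The derivative is a parameter, so that explicit formulas for it can be carried through sums,
    products and compositions. *)
Definition pder n (i : 'I_n) (f g : 'rV[R]_n -> R) : Prop :=
  forall x, is_derive x (delta_mx ord0 i) f (g x).

Lemma near0_coord n (f : 'rV[R]_n -> R) M (x : 'rV[R]_n) i :
  supp_in M f -> M < `|x ord0 i| -> \forall y \near x, f y = 0.
Proof.
move=> sf Mx; have cx : continuous (fun y : 'rV[R]_n => `|y ord0 i|).
  move=> z; apply: (@continuous_comp _ _ _ (fun y : 'rV[R]_n => y ord0 i)).
    exact: coord_continuous.
  exact: norm_continuous.
near=> y; have My : M < `|y ord0 i| by near: y; exact: cvgr_gt (cx x) _ Mx.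
by have [//|/sf/(_ i)] := eqVneq (f y) 0; rewrite leNgt My.
Unshelve. all: by end_near. Qed.

Lemma supp_in_pder n (i : 'I_n) (f g : 'rV[R]_n -> R) M :
  pder i f g -> supp_in M f -> supp_in M g.
Proof.
move=> fg sf x gx k; rewrite leNgt; apply/negP => Mx; move/eqP: gx; apply.
have := near_eq_is_derive (near0_coord sf Mx) (fg x).
by case=> _ <-; exact: derive_cst.
Qed.

Lemma integral_derive_line (f g : R -> R) M :
  (forall x : R, is_derive x 1 f (g x)) -> continuous g ->
  (forall x, f x != 0 -> `|x| <= M) -> (forall x, g x != 0 -> `|x| <= M) ->
  (\int[@lebesgue_measure R]_x (g x)%:E = 0)%E.
Proof.
move=> fg cg sf sg.
(* [M] may be negative. At distance [N] and beyond both functions vanish, endpoints included. *)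
pose N := `|M| + 1.
have N0 : 0 < N by rewrite ltr_wpDl.
have MN x : N <= `|x| -> ~ (`|x| <= M).
  move=> Nx xM; have := le_trans Nx xM; rewrite /N leNgt => /negP; apply.
  by rewrite (le_lt_trans (ler_norm _))// ltrDl.
have -> : (fun x => (g x)%:E) = (EFin \o g) \_ `[- N, N].
  apply/funext => x; rewrite /patch; case: ifPn => // /negP xK /=.
  have [->//|/sg gx] := eqVneq (g x) 0; exfalso; apply: xK.
  rewrite inE /= in_itv /= -ler_norml leNgt; apply/negP => /ltW/MN; exact.
rewrite -integral_mkcond (@continuous_FTC2 _ g f).
- have f0 x : N <= `|x| -> f x = 0.
    by move=> /MN xM; apply/eqP; apply: contra_notT xM => /sf.
  by rewrite !f0 ?normrN ?ler_norm// subee.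
- by rewrite gtrN.
- exact: continuous_subspaceT.
- have cf : continuous f.
    move=> x; apply: differentiable_continuous; apply/derivable1_diffP.
    by have [] := fg x.
  split; first by move=> x _; have [] := fg x.
  + exact/cvg_at_right_filter/cf.
  + exact/cvg_at_left_filter/cf.
- by move=> x _; rewrite derive1E; have [] := fg x.
Qed.

Lemma integral_rV_cons n (g : 'rV[R]_n.+1 -> \bar R) :
  (lebesgue_rV R n.+1).-integrable setT g ->
  (@lebesgue_measure R \x lebesgue_rV R n)%E.-integrable setT
    (g \o @rV_cons R n) /\
  (\int[lebesgue_rV R n.+1]_x g x =
   \int[(@lebesgue_measure R \x lebesgue_rV R n)%E]_z (g \o @rV_cons R n) z)%E.
Proof.
move=> ig; have [mg goo] := integrableP _ _ _ ig.
have mphi := @measurable_rV_cons R n.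
have ic : (@lebesgue_measure R \x lebesgue_rV R n)%E.-integrable setT
    (g \o @rV_cons R n).
  apply/integrableP; split; first exact: (measurableT_comp mg mphi).
  move: goo; rewrite [X in (X < _)%E -> _](_ : _ =
    \int[pushforward (@lebesgue_measure R \x lebesgue_rV R n)%E (@rV_cons R n)]_x
       `|g x|)%E//.
  rewrite ge0_integral_pushforward//.
  exact: measurableT_comp.
split=> //.
transitivity (\int[pushforward (@lebesgue_measure R \x lebesgue_rV R n)%E
  (@rV_cons R n)]_x g x)%E => //.
by rewrite integral_pushforward.
Qed.

Lemma rV_cons_lift n (a h : R) (v w : 'rV[R]_n) (j : 'I_n) :
  rV_cons (a, h *: delta_mx ord0 j + v) =
  h *: delta_mx ord0 (lift ord0 j) + rV_cons (a, v).
Proof.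
apply/rowP => k; rewrite !mxE; case: (unliftP ord0 k) => [l|] -> /=.
  by rewrite !mxE !eqxx /= (inj_eq lift_inj).
by rewrite mulr0 add0r.
Qed.

Lemma rV_cons0 n (a h : R) (v : 'rV[R]_n) :
  rV_cons (h *: 1 + a, v) = h *: delta_mx ord0 ord0 + rV_cons (a, v).
Proof.
apply/rowP => k; rewrite !mxE; case: (unliftP ord0 k) => [l|] -> /=.
  by rewrite mulr0 add0r.
by [].
Qed.

(** Induction on the dimension by splitting off coordinate 0. Fubini is applied in the order that
    puts the variable of differentiation innermost: slices fall under the induction hypothesis if
    [i] is a later coordinate, under the fundamental theorem of calculus if [i] is 0. *)
Lemma integral_pder n (i : 'I_n) (f g : 'rV[R]_n -> R) M :
  pder i f g -> continuous g -> supp_in M f ->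
  (\int[lebesgue_rV R n]_x (g x)%:E = 0)%E.
Proof.
elim: n i f g => [[]//|n ih] i f g fg cg sf.
have sg := supp_in_pder fg sf.
have [ic ->] := integral_rV_cons (continuous_supp_integrable cg sg).
have cons_coord0 a v : rV_cons (a, v) ord0 ord0 = a :> R.
  by rewrite mxE unlift_none.
have cons_lift a (v : 'rV[R]_n) k : rV_cons (a, v) ord0 (lift ord0 k) = v ord0 k.
  by rewrite mxE liftK.
have c1 a : continuous (fun v : 'rV[R]_n => g (rV_cons (a, v))).
  move=> v; apply: (@continuous_comp _ _ _ (fun v => rV_cons (a, v))); last exact: cg.
  apply: continuous_rV => k; have [l|] := unliftP ord0 k => ->.
    under eq_fun do rewrite cons_lift.
    exact: coord_continuous.
  by under eq_fun do rewrite cons_coord0; exact: cst_continuous.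
have c2 v : continuous (fun a : R => g (rV_cons (a, v) : 'rV[R]_n.+1)).
  move=> a; apply: (@continuous_comp _ _ _ (fun a => rV_cons (a, v))); last exact: cg.
  apply: continuous_rV => k; have [l|] := unliftP ord0 k => ->.
    by under eq_fun do rewrite cons_lift; exact: cst_continuous.
  by under eq_fun do rewrite cons_coord0.
have [j ij|i0] := unliftP ord0 i.
  rewrite -integral12_prod_meas1//; apply: integral0_eq => a _.
  apply: (ih j (fun v => f (rV_cons (a, v))) (fun v => g (rV_cons (a, v)))) => //.
  - move=> v; apply: is_derive_line (fg (rV_cons (a, v))) => h.
    by rewrite ij rV_cons_lift.
  - by move=> v /sf fv k; have := fv (lift ord0 k); rewrite cons_lift.
rewrite -integral21_prod_meas1//; apply: integral0_eq => v _.
apply: (@integral_derive_line (fun a => f (rV_cons (a, v))) (fun a => g (rV_cons (a, v))) M) => //.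
- move=> a; apply: is_derive_line (fg (rV_cons (a, v))) => h.
  by rewrite i0 rV_cons0.
- by move=> a /sf/(_ ord0); rewrite cons_coord0.
- by move=> a /sg/(_ ord0); rewrite cons_coord0.
Qed.

End divergence_theorem.

(** * Elementary inequalities for real powers *)

Section power_inequalities.
Variable R : realType.
Implicit Types q p X Y Z a b y s w : R.

Lemma powR_tangent q X y : 1 <= q -> 0 <= X -> 0 <= y ->
  X `^ q + q * X `^ (q - 1) * (y - X) <= y `^ q.
Proof.
move=> q1 X0 y0; move: q1; rewrite le_eqVlt => /predU1P[<-|q1].
  by rewrite subrr powRr0 !powRr1//; lra.
have q0 : 0 < q by lra.
have qN0 : q != 0 by rewrite gt_eqF.
have q1N0 : q - 1 != 0 by rewrite gt_eqF// subr_gt0.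
have e1 : (q / (q - 1))^-1 + q^-1 = 1 by rewrite invf_div; field.
have := @conjugate_powR R (X `^ (q - 1)) y (q / (q - 1)) q
  (powR_ge0 _ _) y0 (divr_gt0 q0 _) q0 e1.
rewrite subr_gt0 => /(_ q1).
rewrite -powRrM (_ : (q - 1) * (q / (q - 1)) = q); last by field.
rewrite invf_div -(ler_pM2l q0) => h.
have e2 : X `^ (q - 1) * X = X `^ q by rewrite mulrC mulr_powRB1.
rewrite mulrBr -!mulrA e2.
have : q * (X `^ q * ((q - 1) / q) + y `^ q / q) = (q - 1) * X `^ q + y `^ q.
  by field.
lra.
Qed.

Lemma powR_midpoint q a b : 1 <= q -> 0 <= a -> 0 <= b ->
  ((a + b) / 2) `^ q <= (a `^ q + b `^ q) / 2.
Proof.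
move=> q1 a0 b0; have m0 : 0 <= (a + b) / 2 by lra.
have := powR_tangent q1 m0 a0; have := powR_tangent q1 m0 b0.
set m := (a + b) / 2; have e : b - m = - (a - m) by rewrite /m; lra.
by rewrite e mulrN; lra.
Qed.

Lemma powR_superadditive q a b : 1 <= q -> 0 <= a -> 0 <= b ->
  a `^ q + b `^ q <= (a + b) `^ q.
Proof.
move=> q1 a0 b0; have q0 : 0 < q by lra.
rewrite -(mulr_powRB1 a0 q0) -(mulr_powRB1 b0 q0).
rewrite -(mulr_powRB1 (addr_ge0 a0 b0) q0) mulrDl lerD// ler_wpM2l//;
  rewrite ge0_ler_powR ?nnegrE//; lra.
Qed.

(* With [X = |v|^2], [Y = |w|^2] and [Z = <v, w>] this is
   [|v + w|^p >= |v|^p + p |v|^(p-2) <v, w> + 2^(1-p) |w|^p], [p = 2 q]: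
   Clarkson's inequality for [v + w] and [v], then the tangent at [v]. *)
Lemma powR_quadratic_remainder q X Y Z : 1 <= q -> 0 <= X -> 0 <= Y ->
  0 <= X + 2 * Z + Y -> 0 <= X + Z + Y / 4 ->
  X `^ q + 2 * q * X `^ (q - 1) * Z + 2 * (Y / 4) `^ q <= (X + 2 * Z + Y) `^ q.
Proof.
move=> q1 X0 Y0 m0 h0; have Y40 : 0 <= Y / 4 by lra.
have := powR_midpoint q1 m0 X0.
rewrite (_ : (X + 2 * Z + Y + X) / 2 = (X + Z + Y / 4) + Y / 4); last by lra.
have := powR_superadditive q1 h0 Y40; have := powR_tangent q1 X0 h0.
have : 0 <= q * X `^ (q - 1) * (Y / 4).
  by rewrite mulr_ge0// mulr_ge0 ?powR_ge0//; lra.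
rewrite (_ : X + Z + Y / 4 - X = Z + Y / 4) ?mulrDr; lra.
Qed.

(** On either side of the threshold [Y = w X] one of the two terms on the right suffices alone. The
    explicit [w] lets the first one be made small. *)
Lemma powR_young1 p w X Y : 1 < p -> 0 < w -> 0 <= X -> 0 <= Y ->
  X `^ (p - 1) * Y <= w * X `^ p + w `^ (1 - p) * Y `^ p.
Proof.
move=> p1 w0 X0 Y0; have p0 : 0 < p by lra.
have [YX|XY] := leP Y (w * X).
  rewrite (@le_trans _ _ (w * X `^ p))//.
    rewrite -(mulr_powRB1 X0 p0) mulrA mulrC ler_wpM2r ?powR_ge0//.
  by rewrite lerDl mulr_ge0 ?powR_ge0.
rewrite (@le_trans _ _ (w `^ (1 - p) * Y `^ p))//; last first.
  by rewrite lerDr mulr_ge0 ?powR_ge0// ltW.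
rewrite -(mulr_powRB1 Y0 p0) mulrCA mulrC ler_wpM2l// -(opprB p 1) powRN.
rewrite ler_pdivlMl ?powR_gt0// -powRM//; last exact: ltW.
by rewrite ge0_ler_powR ?nnegrE //; nra.
Qed.

Lemma powR_young2 p w X Y : 2 <= p -> 0 < w -> 0 <= X -> 0 <= Y ->
  X `^ (p - 2) * Y ^+ 2 <= w ^+ 2 * X `^ p + w `^ (2 - p) * Y `^ p.
Proof.
move=> p2 w0 X0 Y0.
have split2 Z : 0 <= Z -> Z `^ p = Z `^ (p - 2) * Z ^+ 2.
  move=> Z0; rewrite -powR_mulrn// -powRD ?subrK//.
  by apply/implyP => /eqP p0; exfalso; lra.
have [YX|XY] := leP Y (w * X).
  rewrite (@le_trans _ _ (w ^+ 2 * X `^ p))//.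
    rewrite (split2 X X0) (mulrCA (w ^+ 2)) ler_wpM2l ?powR_ge0// -exprMn.
    by rewrite lerXn2r ?nnegrE ?mulr_ge0// ltW.
  by rewrite lerDl mulr_ge0 ?powR_ge0.
rewrite (@le_trans _ _ (w `^ (2 - p) * Y `^ p))//; last first.
  by rewrite lerDr mulr_ge0 ?powR_ge0// exprn_ge0// ltW.
rewrite (split2 Y)// mulrA ler_wpM2r ?exprn_ge0// -(opprB p 2) powRN.
rewrite ler_pdivlMl ?powR_gt0// -powRM//; last exact: ltW.
by rewrite ge0_ler_powR ?nnegrE //; nra.
Qed.

(** The same dichotomy, at [b = s a]. As [s] tends to 0 the factor of a^q tends to 1, so that this
    replaces Minkowski's inequality in the closure argument. *)
Lemma powR_add_le q s a b : 0 <= q -> 0 < s -> 0 <= a -> 0 <= b ->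
  (a + b) `^ q <= (1 + s) `^ q * a `^ q + (1 + s^-1) `^ q * b `^ q.
Proof.
move=> q0 s0 a0 b0; have s'0 : 0 < s^-1 by rewrite invr_gt0.
rewrite -!powRM//; [|lra..].
have [ba|ab] := leP b (s * a).
  apply: (@le_trans _ _ (((1 + s) * a) `^ q)); last by rewrite lerDl powR_ge0.
  by rewrite ge0_ler_powR ?nnegrE//; nra.
apply: (@le_trans _ _ (((1 + s^-1) * b) `^ q)); last by rewrite lerDr powR_ge0.
have : a <= s^-1 * b by rewrite ler_pdivlMl// ltW.
by move=> h; rewrite ge0_ler_powR ?nnegrE//; nra.
Qed.

Lemma powR_sqr p X : 0 <= X -> (X ^+ 2) `^ (p / 2) = X `^ p.
Proof.
by move=> X0; rewrite -powR_mulrn// -powRrM mulrC divfK// pnatr_eq0.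
Qed.

Lemma powR_sqrt p X : 0 <= X -> Num.sqrt X `^ p = X `^ (p / 2).
Proof. by move=> X0; rewrite -{2}(sqr_sqrtr X0) powR_sqr// sqrtr_ge0. Qed.

End power_inequalities.

(** * Functions with a continuous partial derivative *)

Section C1_calculus.
Variable R : realType.

Lemma continuous_powR_ge0 (T : topologicalType) (N : T -> R) r :
  continuous N -> (forall x, 0 <= N x) -> 0 <= r ->
  continuous (fun x => N x `^ r).
Proof.
move=> cN N0 r0 x; move: r0; rewrite le_eqVlt => /predU1P[<-|r0].
  by under eq_fun do rewrite powRr0; exact: cst_continuous.
have := N0 x; rewrite le_eqVlt => /predU1P[Nx0|Nx0].
  rewrite /continuous_at -Nx0 powR0 ?gt_eqF//.
  apply/cvgrPdist_lt => e e0; near=> t.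
  rewrite sub0r normrN ger0_norm ?powR_ge0//.
  have -> : e = (e `^ r^-1) `^ r by rewrite -powRrM mulVf ?gt_eqF// powRr1// ltW.
  rewrite gt0_ltr_powR ?nnegrE ?powR_ge0//.
  near: t; apply: cvgr_lt (cN x) _ _; rewrite -Nx0; exact: powR_gt0.
apply: (@continuous_comp _ _ _ N (fun y => y `^ r)); first exact: cN.
apply: differentiable_continuous; apply/derivable1_diffP.
by have [] := is_derive1_powR r Nx0.
Unshelve. all: by end_near. Qed.

Lemma is_derive_cvg (V : normedModType R) (f : V -> R) (x v : V) (d : R) :
  is_derive x v f d <->
  (fun h : R => h^-1 *: ((f \o shift x) (h *: v) - f x)) @ 0^' --> d.
Proof.
split=> [[fx <-]|fd]; first exact: fx.
by split; [apply/cvg_ex; exists d|exact/cvg_lim].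
Qed.

Lemma cvg_line (V : normedModType R) (k : V -> R) (x v : V) :
  {for x, continuous k} ->
  (fun h : R => k (h *: v + x)) @ 0^' --> k x.
Proof.
move=> ck; pose L := fun h : R => k (h *: v + x).
have L0 : L 0 = k x by rewrite /L scale0r add0r.
have /continuous_withinNx : {for 0, continuous L}.
  apply: (@continuous_comp _ _ _ (fun h : R => h *: v + x) k).
    apply: continuousD; last exact: cst_continuous.
    exact: scalel_continuous.
  by rewrite scale0r add0r.
by rewrite L0.
Qed.

(** At a zero of [f] the difference quotient of the product is that of [f] times a value of [k], so
    that continuity of [k] suffices. This handles powers and truncated squares at their zeros. *)
Lemma is_derive_mul_at0 (V : normedModType R) (f k : V -> R) (x v : V) (d : R) :
  is_derive x v f d -> f x = 0 -> {for x, continuous k} ->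
  is_derive x v (fun y => f y * k y) (d * k x).
Proof.
move=> /is_derive_cvg fd fx ck; apply/is_derive_cvg.
apply: (cvg_trans _ (cvgM fd (cvg_line v ck))).
apply: near_eq_cvg; near=> h => /=.
by rewrite fx mul0r !subr0 /= -scalerAl.
Unshelve. all: by end_near. Qed.

(** Only the derivative of [f] along [v] is available, so the chain rule is applied to the
    restriction of [f] to that line. *)
Lemma is_derive_comp1 (V : normedModType R) (f : V -> R) (phi : R -> R)
    (x v : V) (d e : R) :
  is_derive x v f d -> is_derive (f x) 1 phi e ->
  is_derive x v (phi \o f) (e * d).
Proof.
move=> fd pe.
pose l := fun h : R => f (h *: v + x).
have l0 : l 0 = f x by rewrite /l scale0r add0r.
have ld : is_derive (0 : R) 1 l d.
  apply: is_derive_line fd => h.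
  by rewrite /l addr0 [_%:A]mulr1.
apply: (@is_derive_line _ _ _ (phi \o l) (phi \o f) (0 : R) 1 x v).
  by move=> h; rewrite /= /l addr0 [_%:A]mulr1.
have [dl lE] := ld; rewrite -l0 in pe; have [dp pE] := pe.
split.
  have ddl : differentiable l 0 by apply/derivable1_diffP; exact: dl.
  have ddp : differentiable phi (l 0) by apply/derivable1_diffP; exact: dp.
  by apply/derivable1_diffP; exact: differentiable_comp ddl ddp.
by rewrite -derive1E (derive1_comp dl dp) !derive1E lE pE.
Qed.

Definition C1 n (i : 'I_n) (f g : 'rV[R]_n -> R) : Prop :=
  [/\ continuous f, continuous g & pder i f g].

Definition C1_line (phi phi' : R -> R) : Prop :=
  continuous phi' /\ forall x : R, is_derive x 1 phi (phi' x).

Lemma is_derive1_continuous (phi : R -> R) (x d : R) :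
  is_derive x 1 phi d -> {for x, continuous phi}.
Proof.
by case=> dp _; apply: differentiable_continuous; apply/derivable1_diffP.
Qed.

Section closure.
Variables (n : nat) (i : 'I_n).
Implicit Types f g : 'rV[R]_n -> R.

Lemma C1_ext f g f' g' : f =1 f' -> g =1 g' -> C1 i f g -> C1 i f' g'.
Proof. by move=> /funext <- /funext <-. Qed.

Lemma C1_cst c : C1 i (fun=> c) (fun=> 0).
Proof. by split=> [||x]; [exact: cst_continuous..|exact: is_derive_cst]. Qed.

Lemma C1_coord k : C1 i (fun x => x ord0 k) (fun=> (k == i)%:R).
Proof.
split=> [||x]; [exact: coord_continuous|exact: cst_continuous|].
apply: (@is_derive_line _ _ _ (fun h : R => h * (k == i)%:R + x ord0 k) _ 0 1).
  by move=> h; rewrite addr0 [_%:A]mulr1 !mxE eqxx.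
have -> : (fun h : R => h * (k == i)%:R + x ord0 k) =
    (k == i)%:R \*: id + cst (x ord0 k).
  by apply/funext => h; rewrite mulrC.
by apply: is_derive_eq; rewrite addr0 scaler1.
Qed.

Lemma C1_add f g f' g' : C1 i f g -> C1 i f' g' ->
  C1 i (fun x => f x + f' x) (fun x => g x + g' x).
Proof.
move=> [cf cg fg] [cf' cg' fg']; split=> [x|x|x].
- exact: cvgD (cf x) (cf' x).
- exact: cvgD (cg x) (cg' x).
- by apply: is_deriveD.
Qed.

Lemma C1_mul f g f' g' : C1 i f g -> C1 i f' g' ->
  C1 i (fun x => f x * f' x) (fun x => g x * f' x + f x * g' x).
Proof.
move=> [cf cg fg] [cf' cg' fg']; split=> [x|x|x].
- exact: cvgM (cf x) (cf' x).
- exact: cvgD (cvgM (cg x) (cf' x)) (cvgM (cf x) (cg' x)).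
- apply: (is_derive_eq (is_deriveM (fg x) (fg' x))).
  by rewrite addrC [X in X + _]mulrC.
Qed.

Lemma C1_opp f g : C1 i f g -> C1 i (fun x => - f x) (fun x => - g x).
Proof.
move=> fg; apply: C1_ext (C1_mul (C1_cst (-1)) fg) => x.
  by rewrite mulN1r.
by rewrite mul0r add0r mulN1r.
Qed.

Lemma C1_sub f g f' g' : C1 i f g -> C1 i f' g' ->
  C1 i (fun x => f x - f' x) (fun x => g x - g' x).
Proof. by move=> fg /C1_opp; exact: C1_add. Qed.

Lemma C1_sum (I : Type) (r : seq I) (F G : I -> 'rV[R]_n -> R) :
  (forall j, C1 i (F j) (G j)) ->
  C1 i (fun x => \sum_(j <- r) F j x) (fun x => \sum_(j <- r) G j x).
Proof.
move=> FG; elim: r => [|j r ih].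
  by apply: C1_ext (C1_cst 0) => x; rewrite big_nil.
by apply: C1_ext (C1_add (FG j) ih) => x; rewrite big_cons.
Qed.

Lemma C1_comp phi phi' f g : C1_line phi phi' -> C1 i f g ->
  C1 i (fun x => phi (f x)) (fun x => phi' (f x) * g x).
Proof.
move=> [cp pp] [cf cg fg]; split=> [x|x|x].
- apply: continuous_comp; first exact: cf.
  exact: is_derive1_continuous (pp _).
- exact: cvgM (continuous_comp (cf x) (cp (f x))) (cg x).
- exact: is_derive_comp1.
Qed.

Lemma C1_powR_gt0 q f g : C1 i f g -> (forall x, 0 < f x) ->
  C1 i (fun x => f x `^ q) (fun x => q * f x `^ (q - 1) * g x).
Proof.
move=> [cf cg fg] f0.
have cp r : continuous (fun x => f x `^ r).
  move=> x; apply: (@continuous_comp _ _ _ f (fun y => y `^ r)); first exact: cf.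
  exact: is_derive1_continuous (is_derive1_powR r (f0 x)).
split=> [|x|x]; first exact: cp.
- exact: cvgM (cvgM (cvg_cst q) (cp _ x)) (cg x).
- exact: (is_derive_comp1 (phi := fun y => y `^ q) (fg x) (is_derive1_powR q (f0 x))).
Qed.

(** At a zero, f^q is written as f f^(q - 1), whose second factor is only known to be continuous.
    This differentiates |u|^p and the powers of the bump across their zero sets. *)
Lemma C1_powR q f g : 1 <= q -> C1 i f g -> (forall x, 0 <= f x) ->
  (forall x, f x = 0 -> g x = 0) ->
  C1 i (fun x => f x `^ q) (fun x => q * f x `^ (q - 1) * g x).
Proof.
move=> q1 [cf cg fg] f0 fg0.
have q0 : 0 <= q - 1 by rewrite subr_ge0.
split=> [|x|x].
- by apply: continuous_powR_ge0 => //; rewrite (le_trans ler01).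
- have cp := continuous_powR_ge0 cf f0 q0.
  exact: cvgM (cvgM (cvg_cst q) (cp x)) (cg x).
- have := f0 x; rewrite le_eqVlt => /predU1P[fx0|fx0]; last first.
    exact: (is_derive_comp1 (phi := fun y => y `^ q) (fg x) (is_derive1_powR q fx0)).
  have -> : (fun x => f x `^ q) = (fun y => f y * f y `^ (q - 1)).
    by apply/funext => y; rewrite mulr_powRB1// (lt_le_trans ltr01).
  have e : g x * f x `^ (q - 1) = q * f x `^ (q - 1) * g x.
    by rewrite (fg0 x)// mul0r mulr0.
  rewrite -e; apply: is_derive_mul_at0 => //.
  exact: continuous_powR_ge0.
Qed.

End closure.
End C1_calculus.

(** * Symmetry of second partial derivatives *)

Section mixed_partials.
Variable R : realType.

Lemma pder_line n (i : 'I_n) (f g : 'rV[R]_n -> R) (y : 'rV[R]_n) (s : R) :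
  pder i f g ->
  is_derive s 1 (fun s => f (s *: delta_mx ord0 i + y))
    (g (s *: delta_mx ord0 i + y)).
Proof.
move=> fg; apply: is_derive_line (fg (s *: delta_mx ord0 i + y)) => h.
by rewrite addrA -scalerDl [_%:A]mulr1.
Qed.

Lemma mean_value0 (phi dphi : R -> R) (h : R) : 0 < h ->
  (forall s : R, is_derive s 1 phi (dphi s)) ->
  exists s, [/\ 0 < s, s < h & phi h - phi 0 = dphi s * h].
Proof.
move=> h0 dp; have [|s] := MVT h0 (fun s _ => dp s).
  by apply: continuous_subspaceT => s; exact: is_derive1_continuous (dp s).
by rewrite in_itv/= subr0 => /andP[s0 sh] e; exists s.
Qed.

(** The mean value theorem twice: in direction [i] for the difference of [a] across a step in
    direction [j], then in direction [j] for [ai]. *)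
Lemma mixed_difference n (i j : 'I_n) (a ai aij : 'rV[R]_n -> R) x h :
  0 < h -> pder i a ai -> pder j ai aij ->
  let e k := delta_mx ord0 k : 'rV[R]_n in
  exists s t, [/\ 0 < s < h, 0 < t < h &
    a (h *: e i + (h *: e j + x)) - a (h *: e i + x) - a (h *: e j + x) + a x =
    aij (t *: e j + (s *: e i + x)) * h * h].
Proof.
move=> h0 aai aiaij e.
have [s [s0 sh es]] := mean_value0 h0 (fun s =>
  is_deriveB (pder_line (h *: e j + x) s aai) (pder_line x s aai)).
have [t [t0 th et]] := mean_value0 h0 (fun t =>
  pder_line (s *: e i + x) t aiaij).
exists s, t; rewrite s0 sh t0 th; split=> //.
have {}es : a (h *: e i + (h *: e j + x)) - a (h *: e i + x)
    - (a (0 *: e i + (h *: e j + x)) - a (0 *: e i + x)) =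
    (ai (s *: e i + (h *: e j + x)) - ai (s *: e i + x)) * h := es.
have {}et : ai (h *: e j + (s *: e i + x)) - ai (0 *: e j + (s *: e i + x)) =
    aij (t *: e j + (s *: e i + x)) * h := et.
move: et es; rewrite !scale0r !add0r => et es.
rewrite -et (_ : h *: e j + (s *: e i + x) = s *: e i + (h *: e j + x)).
  by rewrite -es; ring.
by rewrite addrCA.
Qed.

(** The second difference is symmetric in [i] and [j], hence equals [aij] and [aji] at two points
    close to [x]; a gap between them at [x] would contradict continuity. This removes the second
    derivatives from the divergence of the current. *)
Lemma mixed_partials n (i j : 'I_n) (a ai aj aij aji : 'rV[R]_n -> R) :
  pder i a ai -> pder j ai aij -> pder j a aj -> pder i aj aji ->
  continuous aij -> continuous aji -> aij =1 aji.
Proof.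
move=> aai aiaij aaj ajaji cij cji x; apply/eqP; rewrite -subr_eq0.
apply/negPn/negP => d0; set d := aij x - aji x in d0.
have e0 : 0 < `|d| / 2 by rewrite divr_gt0// normr_gt0.
have /cvgrPdist_lt/(_ _ e0) nij := cij x.
have /cvgrPdist_lt/(_ _ e0) nji := cji x.
have /nbhs_ballP[r /= r0 rP] : \forall y \near x,
    `|aij x - aij y| < `|d| / 2 /\ `|aji x - aji y| < `|d| / 2.
  by near=> y; split; near: y.
pose h := r / 2; have h0 : 0 < h by rewrite divr_gt0.
have hr : h + h = r by rewrite /h; field.
have near_x (s t : R) k l : 0 < s < h -> 0 < t < h ->
    ball x r (t *: delta_mx ord0 k + (s *: delta_mx ord0 l + x)).
  move=> /andP[s0 sh] /andP[t0 th]; rewrite -ball_normE /=.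
  rewrite addrA opprD addrCA subrr addr0 normrN.
  apply: (le_lt_trans (ler_normD _ _)); rewrite -hr.
  have nd (c : R) m : 0 < c -> `|c *: delta_mx ord0 m : 'rV[R]_n| <= c.
    move=> c0; rewrite [leLHS]mx_normrE; apply: bigmax_le; first exact: ltW.
    move=> [p q] _ /=; rewrite !mxE; case: (_ && _); last by rewrite mulr0 normr0 ltW.
    by rewrite mulr1 gtr0_norm.
  by rewrite (le_lt_trans (lerD (nd _ _ t0) (nd _ _ s0)))// ltrD.
have [s [t [sh th E1]]] := mixed_difference x h0 aai aiaij.
have [s' [t' [sh' th' E2]]] := mixed_difference x h0 aaj ajaji.
have /rP[P1 _] := near_x s t j i sh th.
have /rP[_ P2] := near_x s' t' i j sh' th'.
have E : aij (t *: delta_mx ord0 j + (s *: delta_mx ord0 i + x)) =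
    aji (t' *: delta_mx ord0 i + (s' *: delta_mx ord0 j + x)).
  apply: (mulIf (lt0r_neq0 h0)); apply: (mulIf (lt0r_neq0 h0)).
  by rewrite -E1 -E2 [h *: delta_mx ord0 j + (_ + x)]addrCA; ring.
rewrite E in P1; set z := aji (t' *: _ + _) in P1 P2.
have : `|d| < `|d|; last by rewrite ltxx.
rewrite {1}/d (_ : aij x - aji x = (aij x - z) - (aji x - z)); last by ring.
by rewrite (le_lt_trans (ler_normB _ _))// [ltRHS]splitr ltrD.
Unshelve. all: by end_near. Qed.

End mixed_partials.

(** * C^1 functions on parts of the line, truncation and gluing *)

Section C1_on_subsets_of_the_line.
Variable R : realType.
Implicit Types (D : set R) (f g phi psi : R -> R).

Definition C1_on D f f' : Prop := forall y, D y ->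
  is_derive y (1 : R) f (f' y) /\ {for y, continuous f'}.

Lemma C1_onT f f' : C1_on setT f f' -> C1_line f f'.
Proof. by move=> h; split=> y; have [] := h y I. Qed.

Lemma C1_on_continuous D f f' y : C1_on D f f' -> D y -> {for y, continuous f}.
Proof. by move=> h /h[d _]; exact: is_derive1_continuous d. Qed.

Lemma C1_on_ext D f f' g g' : f =1 g -> f' =1 g' -> C1_on D f f' -> C1_on D g g'.
Proof. by move=> /funext <- /funext <-. Qed.

Lemma C1_on_sub D D' f f' : D' `<=` D -> C1_on D f f' -> C1_on D' f f'.
Proof. by move=> DD' h y /DD'/h. Qed.

Lemma C1_on_cst D c : C1_on D (fun=> c) (fun=> 0).
Proof. by move=> y _; split; [exact: is_derive_cst|exact: cst_continuous]. Qed.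

Lemma C1_on_id D : C1_on D id (fun=> 1).
Proof. by move=> y _; split; [exact: is_derive_id|exact: cst_continuous]. Qed.

Lemma C1_on_add D f f' g g' : C1_on D f f' -> C1_on D g g' ->
  C1_on D (fun y => f y + g y) (fun y => f' y + g' y).
Proof.
move=> ff gg y Dy; have [df cf] := ff y Dy; have [dg cg] := gg y Dy.
by split; [exact: is_deriveD|exact: cvgD cf cg].
Qed.

Lemma C1_on_mul D f f' g g' : C1_on D f f' -> C1_on D g g' ->
  C1_on D (fun y => f y * g y) (fun y => f' y * g y + f y * g' y).
Proof.
move=> ff gg y Dy; have [df cf'] := ff y Dy; have [dg cg'] := gg y Dy.
have cf := C1_on_continuous ff Dy; have cg := C1_on_continuous gg Dy.
split; last exact: cvgD (cvgM cf' cg) (cvgM cf cg').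
by apply: (is_derive_eq (is_deriveM df dg)); rewrite addrC [X in X + _]mulrC.
Qed.

Lemma C1_on_comp D D' phi phi' f f' : (forall y, D y -> D' (f y)) ->
  C1_on D' phi phi' -> C1_on D f f' ->
  C1_on D (fun y => phi (f y)) (fun y => phi' (f y) * f' y).
Proof.
move=> DD' pp ff y Dy; have [df cf'] := ff y Dy.
have [dp cp'] := pp _ (DD' _ Dy); have cf := C1_on_continuous ff Dy.
split; first exact: is_derive_comp1.
exact: cvgM (continuous_comp cf cp') cf'.
Qed.

Lemma C1_on_powR r :
  C1_on [set y | 0 < y] (fun y => y `^ r) (fun y => r * y `^ (r - 1)).
Proof.
move=> y /= y0; split; first exact: is_derive1_powR.
exact: cvgM (cvg_cst r) (is_derive1_continuous (is_derive1_powR (r - 1) y0)).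
Qed.

Lemma C1_on_ln : C1_on [set y | 0 < y] (@ln R) (fun y => y^-1).
Proof.
move=> y /= y0; split; first exact: is_derive1_ln.
by apply: cvgV; rewrite ?gt_eqF.
Qed.

Lemma C1_on_expR : C1_on setT (@expR R) expR.
Proof. by move=> y _; split; [exact: is_derive_expR|exact: continuous_expR]. Qed.

Definition pos_part (y : R) : R := Num.max 0 y.

(** The square of the positive part, which is C^1. In product form its derivative at 0 comes from
    the zero of the factor [y]. *)
Definition sqr_pos_part (y : R) : R := y * pos_part y.

Lemma pos_part_ge0 y : 0 <= pos_part y.
Proof. by rewrite le_max lexx. Qed.

Lemma pos_part_pos y : 0 <= y -> pos_part y = y.
Proof. by move=> y0; apply/max_idPr. Qed.

Lemma pos_part_neg y : y <= 0 -> pos_part y = 0.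
Proof. by move=> y0; apply/max_idPl. Qed.

Lemma sqr_pos_partE y : sqr_pos_part y = pos_part y ^+ 2.
Proof.
rewrite /sqr_pos_part; have [y0|/ltW y0] := leP 0 y.
  by rewrite pos_part_pos// expr2.
by rewrite pos_part_neg// mulr0 expr0n.
Qed.

Lemma sqr_pos_part_ge0 y : 0 <= sqr_pos_part y.
Proof. by rewrite sqr_pos_partE sqr_ge0. Qed.

Lemma continuous_pos_part : continuous pos_part.
Proof.
by move=> y; apply: (@continuous_max _ _ (fun=> 0) id);
  [exact: cst_continuous|exact: cvg_id].
Qed.

Lemma C1_on_sqr_pos_part : C1_on setT sqr_pos_part (fun y => 2 * pos_part y).
Proof.
move=> y _; split; last exact: cvgM (cvg_cst _) (@continuous_pos_part y).
have [y0|y0|y0] := ltgtP y 0.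
- rewrite pos_part_neg ?mulr0 ?ltW//.
  apply: near_eq_is_derive (is_derive_cst 0 y 1).
  near=> t; rewrite /sqr_pos_part pos_part_neg ?mulr0// ltW//.
  by near: t; exact: lt_nbhsl.
- rewrite pos_part_pos ?ltW//.
  have h : is_derive y (1 : R) (id * id) (2 * y).
    apply: (is_derive_eq (is_deriveM (is_derive_id y 1) (is_derive_id y 1))).
    by rewrite /= ![_ *: _]mulr1; ring.
  apply: near_eq_is_derive h.
  near=> t; rewrite /sqr_pos_part pos_part_pos// ltW//.
  by near: t; exact: lt_nbhsr.
- rewrite y0 pos_part_pos// mulr0.
  have := is_derive_mul_at0 (is_derive_id (0 : R) 1) erefl (@continuous_pos_part 0).
  by rewrite pos_part_pos// mulr0.
Unshelve. all: by end_near. Qed.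

(** Powers and logarithms of |x|^2 are C^1 on the positive half-line only; a factor vanishing up to
    some [c > 0] makes the product C^1 on the whole line. *)
Lemma C1_on_cut c f f' psi psi' : 0 < c ->
  C1_on setT f f' -> (forall y, y <= c -> f y = 0) ->
  C1_on [set y | 0 < y] psi psi' ->
  C1_on setT (fun y => f y * psi y) (fun y => f' y * psi y + f y * psi' y).
Proof.
move=> c0 ff fc pp y _; have [y0|y0] := ltP 0 y.
  by apply: (C1_on_mul (C1_on_sub _ ff) pp).
have yc : y < c by exact: le_lt_trans c0.
have f'0 t : t < c -> f' t = 0.
  move=> tc; have [df _] := ff t I.
  have : is_derive t (1:R) (fun=> 0 : R) (f' t).
    apply: near_eq_is_derive df; near=> s; apply: fc; apply: ltW.
    by near: s; exact: lt_nbhsl.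
  by case=> _ <-; rewrite derive_cst.
have near0 : \forall t \near y, 0 = f' t * psi t + f t * psi' t.
  near=> t; have tc : t < c by near: t; exact: lt_nbhsl.
  by rewrite f'0// fc ?(ltW tc)// !mul0r addr0.
have e0 : f' y * psi y + f y * psi' y = 0 by rewrite -(nbhs_singleton near0).
split.
  rewrite e0; apply: near_eq_is_derive (is_derive_cst 0 y 1).
  near=> t; rewrite fc ?mul0r// ltW//.
  by near: t; exact: lt_nbhsl.
rewrite /continuous_at /prop_for /= e0; apply: cvg_near_cst.
by apply: filterS near0 => t <-.
Unshelve. all: by end_near. Qed.

End C1_on_subsets_of_the_line.

(** * The scalar inequality behind the localized current *)

Section magnetic_scalar_inequality.
Variable R : realType.

Lemma eq_ler (x y : R) : x = y -> x <= y.
Proof. by move=> ->. Qed.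

Lemma normM_le (x y X Y : R) : `|x| <= X -> `|y| <= Y -> `|x * y| <= X * Y.
Proof. by move=> xX yY; rewrite normrM ler_pM. Qed.

Lemma normD_le (x y X Y : R) : `|x| <= X -> `|y| <= Y -> `|x + y| <= X + Y.
Proof. by move=> xX yY; rewrite (le_trans (ler_normD _ _))// lerD. Qed.

Lemma normB_le (x y X Y : R) : `|x| <= X -> `|y| <= Y -> `|x - y| <= X + Y.
Proof. by move=> xX yY; rewrite (le_trans (ler_normB _ _))// lerD. Qed.

(* Here [u = a + i b], [s + i t] stands for the components of [tau], [J] for the
   current and [dm] for the derivatives of the localizing weight
   [ze^p (|u|^2 + ep^2)^(p/2-1)], which [ep] keeps of class C^1. *)
Lemma magnetic_scalar (p al0 C0 Z0 b0 : R) :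
  2 <= p -> 0 <= al0 -> 0 <= C0 -> 0 <= Z0 -> 0 < b0 ->
  exists2 C, 0 < C & forall ze ep a b sj tj sk tk kj kk cj ck B T : R,
    0 < ze <= Z0 -> 0 < ep -> b0 <= B ->
    `|sj| <= T -> `|tj| <= T -> `|sk| <= T -> `|tk| <= T ->
    `|kj| <= al0 -> `|kk| <= al0 -> `|cj| <= C0 -> `|ck| <= C0 ->
    let N := a ^+ 2 + b ^+ 2 in
    let M := N + ep ^+ 2 in
    let J (s t : R) := a * t - b * s in
    let dm (c s t k : R) := ze `^ (p - 1) * c * M `^ (p / 2 - 1) +
      ze `^ p * ((p - 2) * M `^ (p / 2 - 2) * (a * s + b * t - k * N)) in
    is_true (b0 / 2 * (ze `^ p * N `^ (p / 2)) <=
      ze `^ p * M `^ (p / 2 - 1) *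
        (2 * ((sj - kj * a) * (tk - kk * b) - (tj - kj * b) * (sk - kk * a)) +
         B * N) +
      (dm cj sj tj kj * J sk tk - dm ck sk tk kk * J sj tj) +
      C * T `^ p + C * ep `^ p * ze `^ p).
Proof.
move=> p2 al00 C00 Z00 b00.
(* With X = ze (N + ep^2)^(1/2), [c1] collects the coefficients of X^(p - 2) T^2 and [c2] those of
   X^(p - 1) T, coming from the products of gradient components and from the derivatives of the
   weight. The Young parameters [w1] and [w2] make each cost at most (b0 / 8) X^p; the summand [b0]
   in the denominator of [w1] gives w1 <= 1, hence w1^2 <= w1. *)
pose c1 := Z0 ^+ 2 * (4 + 8 * (p - 2)).
pose c2 := Z0 * (8 * al0 + 4 * (p - 2) * al0) + 4 * C0.
have c10 : 0 <= c1 by rewrite mulr_ge0 ?sqr_ge0//; lra.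
have c20 : 0 <= c2.
  by rewrite addr_ge0// ?mulr_ge0// addr_ge0// ?mulr_ge0//; lra.
pose w1 := b0 / (8 * (c1 + 1) + b0); pose w2 := b0 / (8 * (c2 + 1)).
have w10 : 0 < w1 by rewrite divr_gt0//; lra.
have w20 : 0 < w2 by rewrite divr_gt0//; lra.
have hw1 : c1 * w1 ^+ 2 <= b0 / 8.
  have w1e : w1 * (8 * (c1 + 1) + b0) = b0 by rewrite divfK// gt_eqF//; lra.
  have w11 : w1 <= 1 by nra.
  have : w1 ^+ 2 <= w1 by rewrite expr2 ler_piMr// ltW.
  nra.
have hw2 : c2 * w2 <= b0 / 8.
  have : w2 * (8 * (c2 + 1)) = b0 by rewrite divfK// gt_eqF//; lra.
  nra.
pose CT := c1 * w1 `^ (2 - p) + c2 * w2 `^ (1 - p).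
have CT0 : 0 <= CT by rewrite addr_ge0// mulr_ge0 ?powR_ge0.
(* The price of replacing [N] by V^2 = N + ep^2: Young's inequality with parameter 1/2 turns V^(p -
   2) ep^2 into V^p / 4 plus a multiple of ep^p. *)
pose Ce := b0 * 2^-1 `^ (2 - p).
have Ce0 : 0 <= Ce by rewrite mulr_ge0 ?powR_ge0// ltW.
exists (CT + Ce + 1); first lra.
move=> ze ep a b sj tj sk tk kj kk cj ck B T /andP[ze0 zeZ] ep0 b0B
  sjT tjT skT tkT kja kka cjC ckC N M J dm.
have T0 : 0 <= T by exact: le_trans sjT.
have N0 : 0 <= N by rewrite addr_ge0 ?sqr_ge0.
have M0 : 0 < M by rewrite ltr_wpDl// exprn_gt0.
pose V := Num.sqrt M.
have V0 : 0 < V by rewrite sqrtr_gt0.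
have VM : V ^+ 2 = M by rewrite sqr_sqrtr// ltW.
have aV : `|a| <= V.
  rewrite -sqrtr_sqr ler_wsqrtr// /M /N.
  by have h1 := sqr_ge0 b; have h2 := sqr_ge0 ep; clear -h1 h2; lra.
have bV : `|b| <= V.
  rewrite -sqrtr_sqr ler_wsqrtr// /M /N.
  by have h1 := sqr_ge0 a; have h2 := sqr_ge0 ep; clear -h1 h2; lra.
have NV : `|N| <= V ^+ 2 by rewrite ger0_norm// VM lerDl sqr_ge0.
pose k := V `^ (p - 2); pose k' := V `^ (p - 4).
have kE : M `^ (p / 2 - 1) = k.
  by rewrite /k -(powR_sqr (p - 2) (ltW V0)) VM; congr (_ `^ _); field.
have k'E : M `^ (p / 2 - 2) = k'.
  by rewrite /k' -(powR_sqr (p - 4) (ltW V0)) VM; congr (_ `^ _); field.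
have V2 : V ^+ 2 = V `^ 2 by rewrite -powR_mulrn ?ltW.
have kk' : k' * V ^+ 2 = k.
  rewrite V2 /k /k' -powRD; first by congr (_ `^ _); ring.
  by rewrite (gt_eqF V0) implybT.
have k0 : 0 <= k by exact: powR_ge0.
have k'0 : 0 <= k' by exact: powR_ge0.
pose e1 := ze `^ (p - 1).
have e10 : 0 <= e1 by exact: powR_ge0.
have eE : ze `^ p = ze * e1 by rewrite mulr_powRB1 ?ltW//; clear -p2; lra.
pose X := ze * V.
have X0 : 0 <= X by rewrite mulr_ge0 ?ltW.
have XpE : X `^ p = ze `^ p * (k * V ^+ 2).
  rewrite powRM ?ltW//; congr (_ * _); rewrite V2 /k -powRD.
    by congr (_ `^ _); ring.
  by rewrite (gt_eqF V0) implybT.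
have X1E : X `^ (p - 1) = e1 * (k * V).
  rewrite powRM ?ltW//; congr (_ * _).
  rewrite -[in X in _ * X](powRr1 (ltW V0)) /k -powRD.
    by congr (_ `^ _); ring.
  by rewrite (gt_eqF V0) implybT.
have X2E : ze ^+ 2 * X `^ (p - 2) = ze `^ p * k.
  rewrite powRM ?ltW// mulrA; congr (_ * _).
  rewrite -powR_mulrn ?ltW// -powRD; first by congr (_ `^ _); ring.
  by rewrite (gt_eqF ze0) implybT.
have JV s t : `|s| <= T -> `|t| <= T -> `|J s t| <= 2 * (V * T).
  move=> sT tT; have := normB_le (normM_le aV tT) (normM_le bV sT).
  by rewrite /J => h; clear -h; lra.
have PV s t l : `|s| <= T -> `|t| <= T -> `|l| <= al0 ->
    `|a * s + b * t - l * N| <= 2 * (V * T) + al0 * V ^+ 2.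
  move=> sT tT la.
  have := normB_le (normD_le (normM_le aV sT) (normM_le bV tT)) (normM_le la NV).
  by move=> h; clear -h; lra.
have dmJ c s t l s' t' : `|c| <= C0 -> `|s| <= T -> `|t| <= T -> `|l| <= al0 ->
    `|s'| <= T -> `|t'| <= T ->
    `|dm c s t l * J s' t'| <= 2 * C0 * (X `^ (p - 1) * T) +
      (p - 2) * (ze `^ p * k) * (4 * T ^+ 2 + 2 * al0 * (V * T)).
  move=> cC sT tT la s'T t'T.
  have ep0' : 0 <= ze `^ p by exact: powR_ge0.
  have h1 : `|e1 * c * k| <= e1 * C0 * k.
    by rewrite !normM_le// ger0_norm.
  have h2 : `|ze `^ p * ((p - 2) * k' * (a * s + b * t - l * N))| <=
      ze `^ p * ((p - 2) * k' * (2 * (V * T) + al0 * V ^+ 2)).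
    by rewrite !normM_le ?PV//; rewrite ger0_norm//; clear -p2; lra.
  have := normM_le (normD_le h1 h2) (JV _ _ s'T t'T).
  rewrite /dm kE k'E => /le_trans; apply; rewrite X1E -kk'.
  by apply: eq_ler; ring.
have E1 : `|(sj - kj * a) * (tk - kk * b) - (tj - kj * b) * (sk - kk * a)| <=
    2 * T ^+ 2 + 4 * al0 * (V * T).
  have -> : (sj - kj * a) * (tk - kk * b) - (tj - kj * b) * (sk - kk * a) =
    sj * tk - tj * sk + (kk * (a * tj) - kk * (b * sj)) +
    (kj * (b * sk) - kj * (a * tk)) by ring.
  have := normD_le (normD_le (normB_le (normM_le sjT tkT) (normM_le tjT skT))
    (normB_le (normM_le kka (normM_le aV tjT)) (normM_le kka (normM_le bV sjT))))
    (normB_le (normM_le kja (normM_le bV skT)) (normM_le kja (normM_le aV tkT))).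
  by move=> /le_trans; apply; apply: eq_ler; ring.
have D1 := dmJ cj sj tj kj sk tk cjC sjT tjT kja skT tkT.
have D2 := dmJ ck sk tk kk sj tj ckC skT tkT kka sjT tjT.
have p0 : 0 <= ze `^ p by exact: powR_ge0.
have pk0 : 0 <= ze `^ p * k by rewrite mulr_ge0.
have Y1 := @powR_young1 R p w2 X T _ w20 X0 T0.
have {}Y1 := Y1 (lt_le_trans (ltr1n _ 2) p2).
have Y2 := powR_young2 p2 w10 X0 T0.
have Y3 := @powR_young2 R p 2^-1 V ep p2 _ (ltW V0) (ltW ep0).
have {}Y3 : ze `^ p * (k * ep ^+ 2) <=
    4^-1 * X `^ p + 2^-1 `^ (2 - p) * ep `^ p * ze `^ p.
  have := ler_wpM2l p0 (Y3 _); rewrite invr_gt0 => /(_ (ltr0n _ 2)).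
  rewrite -/k => /le_trans; apply; rewrite XpE.
  have -> : V `^ p = k * V ^+ 2.
    rewrite V2 /k -powRD; first by congr (_ `^ _); ring.
    by rewrite (gt_eqF V0) implybT.
  by apply: eq_ler; field.
have XT0 : 0 <= X `^ (p - 1) * T by rewrite mulr_ge0 ?powR_ge0.
have XT20 : 0 <= X `^ (p - 2) * T ^+ 2 by rewrite mulr_ge0 ?powR_ge0 ?sqr_ge0.
have ekT : ze `^ p * k * T ^+ 2 <= Z0 ^+ 2 * (X `^ (p - 2) * T ^+ 2).
  rewrite -X2E -mulrA ler_wpM2r// lerXn2r ?nnegrE//; exact: ltW.
have ekVT : ze `^ p * k * (V * T) <= Z0 * (X `^ (p - 1) * T).
  rewrite X1E eE (_ : ze * e1 * k * (V * T) = ze * (e1 * (k * V) * T)); last by ring.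
  by rewrite ler_wpM2r// -X1E.
have BN : b0 * (X `^ p - ze `^ p * (k * ep ^+ 2)) <= ze `^ p * k * (B * N).
  rewrite XpE VM /M.
  rewrite (_ : _ - _ = ze `^ p * k * N); last by ring.
  by rewrite mulrCA ler_wpM2l// ler_wpM2r.
have XN : ze `^ p * N `^ (p / 2) <= X `^ p.
  rewrite powRM ?(ltW V0) ?(ltW ze0)// ler_wpM2l//.
  rewrite -(powR_sqr p (ltW V0)) VM.
  by rewrite ge0_ler_powR ?nnegrE ?(ltW M0)// ?lerDl ?sqr_ge0//; clear -p2; lra.
rewrite kE.
move: D1 D2; set d1 := dm cj _ _ _ * _; set d2 := dm ck _ _ _ * _.
move=> D1 D2.
have E1' : - (ze `^ p * k * (4 * T ^+ 2 + 8 * al0 * (V * T))) <=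
    ze `^ p * k * (2 * ((sj - kj * a) * (tk - kk * b) - (tj - kj * b) * (sk - kk * a))).
  rewrite -mulrN ler_wpM2l//; move: E1; rewrite ler_norml => /andP[h _].
  by clear -h; lra.
have D1' : - (2 * C0 * (X `^ (p - 1) * T) +
      (p - 2) * (ze `^ p * k) * (4 * T ^+ 2 + 2 * al0 * (V * T))) <= d1.
  by move: D1; rewrite ler_norml => /andP[].
have D2' : d2 <= 2 * C0 * (X `^ (p - 1) * T) +
      (p - 2) * (ze `^ p * k) * (4 * T ^+ 2 + 2 * al0 * (V * T)).
  by move: D2; rewrite ler_norml => /andP[].
have K1 : (4 + 8 * (p - 2)) * (ze `^ p * k * T ^+ 2) <= c1 * (X `^ (p - 2) * T ^+ 2).
  by rewrite /c1 (mulrC (Z0 ^+ 2)) -[leRHS]mulrA ler_wpM2l//; clear -p2; lra.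
have K2 : (8 * al0 + 4 * (p - 2) * al0) * (ze `^ p * k * (V * T)) +
    4 * C0 * (X `^ (p - 1) * T) <= c2 * (X `^ (p - 1) * T).
  rewrite /c2 [leRHS]mulrDl lerD2r (mulrC Z0) -[leRHS]mulrA ler_wpM2l//.
  by rewrite addr_ge0// ?mulr_ge0//; clear -p2; lra.
have L1 := ler_wpM2l c10 Y2; have L2 := ler_wpM2l c20 Y1.
have L3 := ler_wpM2l (ltW b00) Y3.
have L4 : c1 * (w1 ^+ 2 * X `^ p) <= b0 / 8 * X `^ p.
  by rewrite mulrA ler_wpM2r ?powR_ge0.
have L5 : c2 * (w2 * X `^ p) <= b0 / 8 * X `^ p.
  by rewrite mulrA ler_wpM2r ?powR_ge0.
have L6 := ler_wpM2l (ltW b00) XN.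
have Tp0 : 0 <= T `^ p by exact: powR_ge0.
have Ep0 : 0 <= ep `^ p * ze `^ p by rewrite mulr_ge0 ?powR_ge0.
have L7 : (c1 * w1 `^ (2 - p) + c2 * w2 `^ (1 - p)) * T `^ p <=
    (CT + Ce + 1) * T `^ p.
  by rewrite ler_wpM2r// -/CT; clear -Ce0; lra.
have L8 : b0 * 2^-1 `^ (2 - p) * (ep `^ p * ze `^ p) <=
    (CT + Ce + 1) * (ep `^ p * ze `^ p).
  by rewrite ler_wpM2r// -/Ce; clear -CT0; lra.
rewrite [X in _ <= X + _ + _ + _]mulrDr.
set Q := ze `^ p * k * (2 * _) in E1' *.
(* Balance in units of X^p: the field provides 3 b0 / 4, the Young terms cost b0 / 4, and b0 / 2
   remains. *)
have S1 : - (c1 * (X `^ (p - 2) * T ^+ 2) + c2 * (X `^ (p - 1) * T)) <= Q + (d1 - d2).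
  by clear -E1' D1' D2' K1 K2; lra.
have S2 : c1 * (X `^ (p - 2) * T ^+ 2) + c2 * (X `^ (p - 1) * T) <=
    b0 / 4 * X `^ p + (CT + Ce + 1) * T `^ p.
  by clear -L1 L2 L4 L5 L7; lra.
have S3 : b0 * (3 / 4 * X `^ p) - (CT + Ce + 1) * (ep `^ p * ze `^ p) <=
    ze `^ p * k * (B * N).
  by clear -BN L3 L8; lra.
by clear -S1 S2 S3 L6; lra.
Qed.

End magnetic_scalar_inequality.

(** * Profiles of the comparison field *)

Section radial_profiles.
Variable R : realType.

Lemma powRB1_mul (a r : R) : 0 < a -> a `^ (r - 1) * a = a `^ r.
Proof.
move=> a0; rewrite -[X in _ `^ _ * X](powRr1 (ltW a0)) -powRD ?subrK//.
by rewrite (gt_eqF a0) implybT.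
Qed.

Variables (p sg y0 om : R).

(** Here [y] stands for |x|^2 and [y0] for |x0|^2, hence the division by 2: this is log |x| - log
    |x0|. Likewise [sharp_weight] is |x|^(-p) (sg^2 + s^2)^(-p/2). *)
Definition log_radius (y : R) : R := (ln y - ln y0) / 2.

Definition log_denom (s : R) : R := sg ^+ 2 + s ^+ 2.

Definition log_profile (s : R) : R := - s * log_denom s `^ (- (p / 2)).

Definition dlog_profile (s : R) : R :=
  - log_denom s `^ (- (p / 2)) +
  p * s ^+ 2 * log_denom s `^ (- (p / 2) - 1).

Definition log_den (y : R) : R := y * log_denom (log_radius y).

Definition sharp_weight (y : R) : R := log_den y `^ (- (p / 2)).

Definition shell_cutoff (y : R) : R := sqr_pos_part (om ^+ 2 - (y - y0) ^+ 2).

Hypotheses (p2 : 2 <= p) (sg0 : 0 < sg) (y00 : 0 < y0).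

Lemma log_denom_gt0 s : 0 < log_denom s.
Proof. by rewrite ltr_wpDr ?sqr_ge0// exprn_gt0. Qed.

Lemma log_den_gt0 y : 0 < y -> 0 < log_den y.
Proof. by move=> ?; rewrite mulr_gt0// log_denom_gt0. Qed.

Lemma sharp_weight_gt0 y : 0 < y -> 0 < sharp_weight y.
Proof. by move=> ?; rewrite powR_gt0// log_den_gt0. Qed.

Lemma sharp_weightE y : 0 < y -> sharp_weight y =
  y `^ (- (p / 2)) * log_denom (log_radius y) `^ (- (p / 2)).
Proof. by move=> y_gt0; rewrite -powRM// ltW// log_denom_gt0. Qed.

Lemma dlog_profileE s : dlog_profile s =
  log_denom s `^ (- (p / 2) - 1) * (p * s ^+ 2 - log_denom s).
Proof.
have Q0 := log_denom_gt0 s.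
rewrite /dlog_profile.
by rewrite -(powRB1_mul _ Q0); ring.
Qed.

Lemma dlog_profile_geN s : - log_denom s `^ (- (p / 2)) <= dlog_profile s.
Proof.
rewrite lerDl mulr_ge0 ?powR_ge0// mulr_ge0 ?sqr_ge0//. exact: le_trans p2.
Qed.

(** After factoring out a power of the denominator, what is needed is p s^2 - (sg^2 + s^2) >= (sg^2
    + s^2) / 3; for p = 2 this is precisely the threshold s^2 >= 2 sg^2. *)
Lemma dlog_profile_ge s : 2 * sg ^+ 2 <= s ^+ 2 ->
  log_denom s `^ (- (p / 2)) / 3 <= dlog_profile s.
Proof.
move=> ss; have Q0 := log_denom_gt0 s; rewrite dlog_profileE.
rewrite -(powRB1_mul _ Q0) -mulrA ler_wpM2l ?powR_ge0// /log_denom.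
have : 2 * s ^+ 2 <= p * s ^+ 2 by rewrite ler_wpM2r ?sqr_ge0.
by have := sqr_ge0 s; lra.
Qed.

(** [a] stands for a coordinate of [x]. The exponent (p - 1) / 2 is (p - 1) / p times that of
    [sharp_weight]: the size that Young's inequality allows for the field. *)
Lemma log_profile_bound a y : 0 < y -> a ^+ 2 <= y ->
  `|a * (y `^ (- (p / 2)) * log_profile (log_radius y))| <=
  log_den y `^ (- ((p - 1) / 2)).
Proof.
move=> y_gt0 ay; set s := log_radius y; have Q0 := log_denom_gt0 s.
have half (u v : R) : 0 < v -> u ^+ 2 <= v -> `|u| <= v `^ 2^-1.
  by move=> v0 uv; rewrite powR12_sqrt ?(ltW v0)// -sqrtr_sqr ler_wsqrtr.
have pow (v : R) : 0 < v -> v `^ 2^-1 * v `^ (- (p / 2)) = v `^ (- ((p - 1) / 2)).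
  move=> v0; rewrite -powRD ?(gt_eqF v0) ?implybT//.
  by congr (_ `^ _); field.
rewrite /log_den powRM ?(ltW y_gt0) ?(ltW Q0)// -!pow//.
rewrite !normrM normrN !(ger0_norm (powR_ge0 _ _)).
rewrite (_ : _ * (_ * _) = (`|a| * y `^ (- (p / 2))) *
  (`|s| * log_denom s `^ (- (p / 2)))); last by rewrite mulrA.
rewrite ler_pM ?mulr_ge0 ?powR_ge0// ler_wpM2r ?powR_ge0// half//.
by rewrite lerDr sqr_ge0.
Qed.

(* [R0 / 2] bounds the variation of the radius over the shell. *)
Lemma tangential_source (D R0 r r0 z : R) : 1 <= D -> 0 < R0 -> 0 <= r -> 0 < r0 ->
  2 * R0 <= r0 -> z ^+ 2 <= r ^+ 2 * r0 ^+ 2 ->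
  `|r ^+ 2 - r0 ^+ 2| <= R0 * r0 / 2 ->
  R0 ^+ 2 / 2 <= r ^+ 2 + r0 ^+ 2 - 2 * z ->
  r0 ^+ 2 / 4 <= 32 * D / R0 ^+ 2 * (r ^+ 2 * r0 ^+ 2 - z ^+ 2) - D * z.
Proof.
move=> D1 R00 r_ge0 r00 Rr zrr yy vv.
have rr0 : `|r - r0| <= R0 / 2.
  have e : `|r - r0| * (r + r0) = `|r ^+ 2 - r0 ^+ 2|.
    by rewrite subr_sqr normrM (@ger0_norm _ (r + r0))//; lra.
  rewrite -(ler_pM2r r00); apply: le_trans (_ : `|r - r0| * (r + r0) <= _).
    by rewrite ler_wpM2l//; lra.
  by rewrite e; lra.
have r2 : r0 / 2 <= r by move: rr0; rewrite ler_norml => /andP[]; lra.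
have rr2 : (r - r0) ^+ 2 <= (R0 / 2) ^+ 2.
  by rewrite -[leLHS]real_normK ?num_real// lerXn2r ?nnegrE//; lra.
have gap : R0 ^+ 2 / 8 <= r * r0 - z by nra.
have rr0_ge0 : 0 <= r * r0 by rewrite mulr_ge0// ltW.
have zle : z <= r * r0 by have := sqr_ge0 R0; lra.
have zge : - (r * r0) <= z.

  have : `|z| <= r * r0.
    rewrite -(ger0_norm rr0_ge0) -sqrtr_sqr -[leRHS]sqrtr_sqr ler_wsqrtr//.
    by rewrite exprMn.
  by rewrite ler_norml => /andP[].
have rr0_ge : r0 ^+ 2 / 2 <= r * r0 by rewrite expr2; nra.
have R2 : 0 < R0 ^+ 2 by rewrite exprn_gt0.
have K0 : 0 <= 32 * D / R0 ^+ 2 by rewrite divr_ge0 ?ltW//; lra.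
have e : r ^+ 2 * r0 ^+ 2 - z ^+ 2 = (r * r0 - z) * (r * r0 + z) by ring.
(* Near the antipode of [x0] the tangential field vanishes, but - D z is itself a large source.
   Elsewhere r r0 + z is bounded below, and the factor 32 D / R0^2 raises the first term to 2 D r
   r0, which beats D z. *)
have [zn|zp] := leP z (- (r * r0) / 2).
  have : 0 <= 32 * D / R0 ^+ 2 * (r ^+ 2 * r0 ^+ 2 - z ^+ 2).
    by rewrite mulr_ge0// subr_ge0.
  have : r * r0 / 2 <= D * (- z) by nra.
  lra.
have : 32 * D / R0 ^+ 2 * (R0 ^+ 2 / 8 * (r * r0 / 2)) <=
    32 * D / R0 ^+ 2 * (r ^+ 2 * r0 ^+ 2 - z ^+ 2).
  rewrite e ler_wpM2l// ler_pM//; lra.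
have -> : 32 * D / R0 ^+ 2 * (R0 ^+ 2 / 8 * (r * r0 / 2)) = 2 * D * (r * r0).
  by field; rewrite gt_eqF.
have : D * z <= D * (r * r0) by rewrite ler_wpM2l//; lra.
have : r * r0 <= D * (r * r0) by rewrite ler_peMl.
have := sqr_ge0 r0; lra.
Qed.

(** Where the radial profile may fail to be a source, |2 s| <= 4 sg, so y / y0 = exp (2 s) is within
    8 sg of 1. The value sg = om / (16 y0) turns this into om / 2, the inner part of the shell, on
    which the cutoff is bounded below. *)
Lemma shell_near_y0 y : 0 < y -> om <= y0 / 4 -> sg * (16 * y0) = om ->
  log_radius y ^+ 2 < 2 * sg ^+ 2 -> `|y - y0| <= om / 2.
Proof.
move=> y_gt0 omy sgE ss; set s := log_radius y in ss.
have sg_gt0 := sg0; have y0_gt0 := y00.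
have sN : `|2 * s| <= 4 * sg.
  have : `|s| <= 2 * sg.
    rewrite -(ger0_norm (ltW (mulr_gt0 (ltr0n _ 2) sg0))) -sqrtr_sqr -[leRHS]sqrtr_sqr.
    by rewrite ler_wsqrtr//; have := sqr_ge0 sg; lra.
  by move=> h; rewrite normrM (@ger0_norm _ 2)//; lra.
have yE : y = y0 * expR (2 * s).
  have -> : 2 * s = ln y - ln y0 by rewrite /s /log_radius; field.
  by rewrite expRD expRN !lnK ?posrE// mulrC divfK// gt_eqF.
move: sN; rewrite ler_norml => /andP[sl su].
have sg16 : sg <= 1 / 16 by rewrite -(ler_pM2r y00); lra.
have lo : 1 + 2 * s <= expR (2 * s) by exact: expR_ge1Dx.
have hi : expR (2 * s) * (1 - 2 * s) <= 1.
  have := expR_ge1Dx (- (2 * s)); rewrite expRN => h.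
  have E0 := expR_gt0 (2 * s).
  by rewrite -ler_pdivlMl// mulr1.
have hi2 : expR (2 * s) <= 1 + 8 * sg.
  have E0 := expR_gt0 (2 * s).
  have : expR (2 * s) * (1 - 4 * sg) <= 1.
    by apply: le_trans hi; rewrite ler_pM2l//; lra.
  have : 1 <= (1 + 8 * sg) * (1 - 4 * sg) by nra.
  move=> h1 h2; have : expR (2 * s) * (1 - 4 * sg) <= (1 + 8 * sg) * (1 - 4 * sg).
    exact: le_trans h1.
  by rewrite ler_pM2r//; lra.
have lo' : y0 * (1 - 4 * sg) <= y0 * expR (2 * s) by rewrite ler_pM2l//; lra.
have hi' : y0 * expR (2 * s) <= y0 * (1 + 8 * sg) by rewrite ler_pM2l.
have := mulr_gt0 sg0 y00.
by rewrite ler_norml yE => ?; apply/andP; split; lra.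
Qed.

End radial_profiles.

(** * Choice of the shell and sign of the divergence *)

Section geometry_of_the_weight.
Variable R : realType.

Lemma powR_le_neg (a b r : R) : 0 < a -> a <= b -> 0 <= r ->
  b `^ (- r) <= a `^ (- r).
Proof.
move=> a0 ab r0; have b0 : 0 < b by exact: lt_le_trans ab.
by rewrite !powRN lef_pV2 ?posrE ?powR_gt0// ge0_ler_powR ?nnegrE// ltW.
Qed.

Lemma norm_le_of_sqr (a b : R) : 0 <= b -> a ^+ 2 <= b ^+ 2 -> `|a| <= b.
Proof.
by move=> b0 ab; rewrite -(ger0_norm b0) -sqrtr_sqr -[leRHS]sqrtr_sqr ler_wsqrtr.
Qed.

Lemma log_radius_le1 (y0 y : R) : 0 < y0 -> 0 < y -> `|y - y0| <= y0 / 4 ->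
  log_radius y0 y ^+ 2 <= 1.
Proof.
move=> y00 y_gt0; rewrite ler_norml => /andP[yl yu]; set s := log_radius y0 y.
have e : 2 * s = ln y - ln y0 by rewrite /s /log_radius; field.
have h1 : y0 * expR (2 * s) = y.
  by rewrite e expRD expRN !lnK ?posrE// mulrC divfK// gt_eqF.
have h2 : y * expR (- (2 * s)) = y0.
  by rewrite expRN -h1 mulfK// gt_eqF// expR_gt0.
have k1 := ler_wpM2l (ltW y00) (expR_ge1Dx (2 * s)).
have k2 := ler_wpM2l (ltW y_gt0) (expR_ge1Dx (- (2 * s))).
rewrite h1 in k1; rewrite h2 in k2.
have s1 : s <= 1 by rewrite -(ler_pM2r y00); lra.
have s2 : - 1 <= s by rewrite -(ler_pM2r y_gt0); lra.
by rewrite -[leLHS]real_normK ?num_real// expr_le1// ler_norml s1 s2.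
Qed.

Lemma shell_cutoff_ge0 (y0 om y : R) : 0 <= shell_cutoff y0 om y.
Proof. exact: sqr_pos_part_ge0. Qed.

Lemma shell_cutoff_le (y0 om y : R) : shell_cutoff y0 om y <= om ^+ 4.
Proof.
rewrite /shell_cutoff; set t := _ - _.
have t1 : t <= om ^+ 2 by rewrite lerBlDr lerDl sqr_ge0.
have [t0|/ltW t0] := leP 0 t; last first.
  by rewrite /sqr_pos_part pos_part_neg// mulr0 (exprM _ 2 2) sqr_ge0.
by rewrite sqr_pos_partE pos_part_pos// (exprM _ 2 2) lerXn2r ?nnegrE ?sqr_ge0.
Qed.

Lemma shell_cutoff_eq0 (y0 om y : R) : 0 <= om -> om <= `|y - y0| ->
  shell_cutoff y0 om y = 0.
Proof.
move=> om0 h; rewrite /shell_cutoff /sqr_pos_part pos_part_neg ?mulr0//.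
rewrite subr_le0 -[leRHS]real_normK ?num_real// lerXn2r ?nnegrE//.
Qed.

Lemma shell_cutoff_ge (y0 om y : R) : `|y - y0| <= om / 2 ->
  9 / 16 * om ^+ 4 <= shell_cutoff y0 om y.
Proof.
move=> h; have om0 : 0 <= om by have := le_trans (normr_ge0 _) h; lra.
have h2 : (y - y0) ^+ 2 <= (om / 2) ^+ 2.
  by rewrite -[leLHS]real_normK ?num_real// lerXn2r ?nnegrE//; lra.
have t0 : 3 / 4 * om ^+ 2 <= om ^+ 2 - (y - y0) ^+ 2 by lra.
have o2 : 0 <= 3 / 4 * om ^+ 2 by rewrite mulr_ge0 ?sqr_ge0//; lra.
rewrite /shell_cutoff sqr_pos_partE pos_part_pos; last exact: le_trans t0.
rewrite (_ : 9 / 16 * om ^+ 4 = (3 / 4 * om ^+ 2) ^+ 2); last by field.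
by rewrite lerXn2r ?nnegrE// (le_trans _ t0).
Qed.

(** The triangle inequality |x| >= |x0| - R0 >= |x0| / 2, in terms of squares and of the scalar
    product [z]. *)
Lemma ball_away_from_origin (y y0 z R0 : R) : 0 <= y -> 0 < y0 ->
  4 * R0 ^+ 2 <= y0 -> z ^+ 2 <= y * y0 -> y + y0 - 2 * z <= R0 ^+ 2 ->
  y0 / 4 <= y.
Proof.
move=> y_ge0 y00 R0y zy v; rewrite leNgt; apply/negP => yy.
have h1 : y + 3 / 4 * y0 <= 2 * z by lra.
have h2 : (y + 3 / 4 * y0) ^+ 2 <= (2 * z) ^+ 2.
  by rewrite lerXn2r ?nnegrE//; lra.
have h3 : 0 < (y0 / 4 - y) * (9 / 4 * y0 - y) by rewrite mulr_gt0; lra.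
rewrite exprMn in h2; nra.
Qed.

(** Two sources complement each other: the radial one dominates the weight off a thin shell and may
    be as low as - w inside it; the tangential one lives around that shell and is scaled to exceed
    the deficit. The exceptional ball has squared radius R0^2 / 2 instead of R0^2, so that the bump
    localizing the current is bounded below on it. *)
Lemma weight_geometry (p D y0 R0 : R) :
  2 <= p -> 1 <= D -> 0 < y0 -> 0 < R0 -> 4 * R0 ^+ 2 <= y0 ->
  exists sg om Nn M C : R, [/\ 0 < sg, 0 < C & forall y z, 0 < y ->
    z ^+ 2 <= y * y0 ->
    let tw := M * shell_cutoff y0 om y * expR (Nn * z) in
    let src := y `^ (- (p / 2)) * dlog_profile p sg (log_radius y0 y) +
      tw * (Nn * (y * y0 - z ^+ 2) - D * z) in
    let w := sharp_weight p sg y0 y in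
    [/\ R0 ^+ 2 / 2 <= y + y0 - 2 * z -> w / 3 <= src,
        - (C * w) <= src,
        y + y0 - 2 * z <= R0 ^+ 2 / 2 -> w <= C &
        forall a b, a ^+ 2 <= y -> b ^+ 2 <= y0 ->
          `|tw * (y * b - z * a)| <= C * log_den sg y0 y `^ (- ((p - 1) / 2))]].
Proof.
move=> p2 D1 y00 R00 R0y.
pose r0 := Num.sqrt y0; have r00 : 0 < r0 by rewrite sqrtr_gt0.
have r02 : r0 ^+ 2 = y0 by rewrite sqr_sqrtr// ltW.
have R0r0 : 2 * R0 <= r0.
  rewrite -(ger0_norm (ltW r00)); have /ger0_norm <- : 0 <= 2 * R0 by lra.
  by rewrite -sqrtr_sqr -[leRHS]sqrtr_sqr ler_wsqrtr// exprMn r02; lra.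
(* The largest half-width, in |x|^2, for which [tangential_source] covers the shell; [sg] and [Nn]
   are then dictated by [shell_near_y0] and [tangential_source]. *)
pose om := R0 * r0 / 2.
have om0 : 0 < om by rewrite divr_gt0// mulr_gt0.
have omy : om <= y0 / 4 by rewrite /om -r02 expr2; nra.
pose sg := om / (16 * y0).
have sg0 : 0 < sg by rewrite divr_gt0// mulr_gt0.
have sgE : sg * (16 * y0) = om by rewrite divfK// gt_eqF// mulr_gt0.
pose Nn := 32 * D / R0 ^+ 2.
have Nn0 : 0 <= Nn by rewrite divr_ge0 ?sqr_ge0//; lra.
(* [wh] bounds the weight from above for y >= y0 / 4. On the shell, [wl] and [wl1] bound from below
   the weight and its power (p - 1) / p, and [El] and [Eh] enclose the exponential. *)
pose wh := (y0 / 4 * sg ^+ 2) `^ (- (p / 2)).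
have wh0 : 0 < wh by rewrite powR_gt0// mulr_gt0 ?exprn_gt0//; lra.
pose L := 2 * y0 * (sg ^+ 2 + 1).
have L0 : 0 < L by rewrite mulr_gt0 ?ltr_wpDl ?sqr_ge0//; lra.
pose wl := L `^ (- (p / 2)); pose wl1 := L `^ (- ((p - 1) / 2)).
have wl0 : 0 < wl by exact: powR_gt0.
have wl10 : 0 < wl1 by exact: powR_gt0.
pose El := expR (- (Nn * (2 * y0))); pose Eh := expR (Nn * (2 * y0)).
have El0 : 0 < El by exact: expR_gt0.
have Eh0 : 0 < Eh by exact: expR_gt0.
(* The denominator multiplies the lower bounds of cutoff, exponential and source on the inner shell.
   The tangential source is then at least 4 wh / 3: it covers the deficit - w of the radial field
   and leaves w / 3. *)
pose M := 4 / 3 * wh / (9 / 16 * om ^+ 4 * El * (y0 / 4)).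
have om40 : 0 < om ^+ 4 by exact: exprn_gt0.
have den0 : 0 < 9 / 16 * om ^+ 4 * El * (y0 / 4) by rewrite !mulr_gt0//; lra.
have M0 : 0 < M by rewrite divr_gt0// mulr_gt0//; lra.
have ME : M * (9 / 16 * om ^+ 4) * El * (y0 / 4) = 4 / 3 * wh.
  by rewrite /M -[RHS](divfK (lt0r_neq0 den0)); ring.
pose K1 := M * om ^+ 4 * Eh * (D * (2 * y0)).
have G0 : 0 <= M * om ^+ 4 * Eh.
  exact: mulr_ge0 (mulr_ge0 (ltW M0) (ltW om40)) (ltW Eh0).
have y2_ge0 : 0 <= 2 * y0 by lra.
have D0 : 0 <= D by lra.
have K10 : 0 <= K1 by rewrite /K1 mulr_ge0// mulr_ge0.
pose K2 := M * om ^+ 4 * Eh * (2 * y0 * (1 + y0) + 2 * y0 * (1 + 2 * y0)).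
have K20 : 0 <= K2.
  by rewrite /K2 mulr_ge0// addr_ge0// mulr_ge0//; lra.
pose C := wh + 1 + K1 / wl + K2 / wl1.
have C1 : wh + 1 <= C by rewrite /C -addrA lerDl addr_ge0// divr_ge0// ltW.
exists sg, om, Nn, M, C; split => //; first by clear -C1 wh0; lra.
move=> y z y_gt0 zy tw src w.
have w0 : 0 < w by exact: sharp_weight_gt0.
have high : y0 / 4 <= y -> w <= wh.
  move=> yy; apply: powR_le_neg.
  - by rewrite mulr_gt0 ?exprn_gt0//; clear -y00; lra.
  - apply: ler_pM => //; rewrite ?sqr_ge0 ?lerDl ?sqr_ge0//.
    by clear -y00; lra.
  - by clear -p2; lra.
set r := Num.sqrt y.
have r_ge0 : 0 <= r by exact: sqrtr_ge0.
have r2 : r ^+ 2 = y by rewrite sqr_sqrtr// ltW.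
have tw_ge0 : 0 <= tw.
  by rewrite /tw mulr_ge0 ?expR_ge0// mulr_ge0 ?shell_cutoff_ge0// ltW.
have wE := @sharp_weightE _ p _ y0 sg0 _ y_gt0; rewrite -/w in wE.
have rad_lo : - w <= y `^ (- (p / 2)) * dlog_profile p sg (log_radius y0 y).
  rewrite wE -mulrN ler_wpM2l ?powR_ge0//; exact: dlog_profile_geN.
have supp : tw = 0 \/ `|y - y0| <= om.
  have [h|/ltW h] := leP `|y - y0| om; first by right.
  by left; rewrite /tw shell_cutoff_eq0 ?(ltW om0)// mulr0 mul0r.
have supp_facts : `|y - y0| <= om ->
    [/\ 3 / 4 * y0 <= y, y <= 5 / 4 * y0, `|z| <= 2 * y0,
        wl <= w & wl1 <= log_den sg y0 y `^ (- ((p - 1) / 2))].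
  move=> h; have h4 : `|y - y0| <= y0 / 4 by exact: le_trans omy.
  have s1 := log_radius_le1 y00 y_gt0 h4.
  move: (h4); rewrite ler_norml => /andP[yl yu].
  have den : log_den sg y0 y <= L.
    rewrite /log_den /L /log_denom; apply: ler_pM; [exact: ltW| | |].
    - by rewrite addr_ge0 ?sqr_ge0.
    - by clear -yu y00; lra.
    - by rewrite lerD2l.
  have den_gt0 := @log_den_gt0 _ _ y0 sg0 _ y_gt0.
  split.
  - by clear -yl; lra.
  - by clear -yu; lra.
  - apply: norm_le_of_sqr => //; apply: le_trans zy _.
    by clear -yu y00; rewrite exprMn expr2; nra.
  - by apply: powR_le_neg => //; clear -p2; lra.
  - by apply: powR_le_neg => //; clear -p2; lra.
have twh : `|y - y0| <= om -> tw <= M * om ^+ 4 * Eh.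
  move=> /supp_facts[_ _ zz _ _].
  apply: ler_pM; [|exact: expR_ge0|by rewrite ler_pM2l// shell_cutoff_le|].
    by rewrite mulr_ge0 ?shell_cutoff_ge0// ltW.
  by rewrite ler_expR ler_wpM2l// (le_trans (ler_norm _)).
have source : `|y - y0| <= om -> R0 ^+ 2 / 2 <= y + y0 - 2 * z ->
    y0 / 4 <= Nn * (y * y0 - z ^+ 2) - D * z.
  move=> h v; have := @tangential_source _ D R0 r r0 z D1 R00 r_ge0 r00 R0r0.
  rewrite r2 r02; exact.
split.
- move=> v; have [ss|ss] := leP (2 * sg ^+ 2) (log_radius y0 y ^+ 2).
    have : w / 3 <= y `^ (- (p / 2)) * dlog_profile p sg (log_radius y0 y).
      by rewrite wE -mulrA ler_wpM2l ?powR_ge0// dlog_profile_ge.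
    have : 0 <= tw * (Nn * (y * y0 - z ^+ 2) - D * z).
      case: supp => [->|h]; first by rewrite mul0r.
      by rewrite mulr_ge0// (le_trans _ (source h v))//; clear -y00; lra.
    by rewrite /src; clear; lra.
  have h2 := shell_near_y0 sg0 y00 y_gt0 omy sgE ss.
  have h : `|y - y0| <= om by clear -h2 om0; lra.
  have [y1 y2 zz _ _] := supp_facts h.
  have twl : M * (9 / 16 * om ^+ 4) * El <= tw.
    apply: ler_pM; [|exact: ltW|by rewrite ler_pM2l// shell_cutoff_ge|].
      by apply: mulr_ge0; [exact: ltW|clear -om40; lra].
    rewrite ler_expR -mulrN ler_wpM2l//.
    by move: zz; rewrite ler_norml => /andP[].
  have src_ge : 4 / 3 * wh <= tw * (Nn * (y * y0 - z ^+ 2) - D * z).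
    rewrite -ME; apply: ler_pM => //; last exact: source.
      by apply: mulr_ge0 (ltW El0); apply: mulr_ge0; [exact: ltW|clear -om40; lra].
    by clear -y00; lra.
  have /high whi : y0 / 4 <= y by clear -y1 y00; lra.
  by rewrite /src; clear -src_ge whi rad_lo; lra.
- have src_ge : - (K1 / wl * w) <= tw * (Nn * (y * y0 - z ^+ 2) - D * z).
    case: supp => [->|h].
      by rewrite mul0r oppr_le0 mulr_ge0 ?divr_ge0// ltW.
    have [y1 y2 zz ww _] := supp_facts h.
    have k1 : K1 <= K1 / wl * w by rewrite -mulrA ler_peMr// ler_pdivlMl// mulr1.
    have k2 : tw * (D * z) <= K1.
      apply: (@le_trans _ _ (tw * (D * (2 * y0)))).
        by rewrite ler_wpM2l// ler_wpM2l ?(le_trans (ler_norm _) zz).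
      by rewrite ler_wpM2r ?twh// mulr_ge0.
    have k3 : 0 <= tw * (Nn * (y * y0 - z ^+ 2)).
      by rewrite mulr_ge0// mulr_ge0// subr_ge0.
    by rewrite mulrBr; clear -k1 k2 k3; lra.
  have k2 : 0 <= K2 / wl1 * w by rewrite mulr_ge0 ?divr_ge0// ltW.
  have k3 : 0 <= wh * w by rewrite mulr_ge0// ltW.
  by rewrite /src /C; clear -src_ge k2 k3 rad_lo; lra.
- move=> v; have /high whi : y0 / 4 <= y.
    apply: (@ball_away_from_origin y y0 z R0) => //; first exact: ltW.
    by clear -v; have := sqr_ge0 R0; lra.
  by clear -whi C1; lra.
- move=> a b ay by0; case: supp => [->|h].
    by rewrite mul0r normr0 mulr_ge0 ?powR_ge0//; clear -C1 wh0; lra.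
  have [y1 y2 zz _ ww] := supp_facts h.
  have sq (c m : R) : 0 <= m -> c ^+ 2 <= m -> `|c| <= 1 + m.
    by clear => m0 cm; apply: norm_le_of_sqr; nra.
  have a1 : `|a| <= 1 + 2 * y0.
    by apply: sq => //; clear -ay y2 y00; lra.
  have b1 : `|b| <= 1 + y0 by apply: sq => //; exact: ltW.
  have yy : `|y| <= 2 * y0.
    by rewrite ger0_norm ?(ltW y_gt0)//; clear -y2 y00; lra.
  have t1 : `|tw| <= M * om ^+ 4 * Eh by rewrite ger0_norm// twh.
  apply: le_trans (normM_le t1 (normB_le (normM_le yy b1) (normM_le zz a1))) _.
  rewrite -/K2; apply: (@le_trans _ _ (K2 / wl1 * wl1)).
    by rewrite divfK// gt_eqF.
  apply: ler_pM => //; [by rewrite divr_ge0// ltW|exact: ltW|].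
  have k1 : 0 <= K1 / wl by rewrite divr_ge0// ltW.
  by rewrite /C; clear -k1 wh0; lra.
Qed.

End geometry_of_the_weight.

(** * The two families of vector fields and their divergences *)

Section vector_fields.
Variables (R : realType) (d : nat).
Local Notation E := 'rV[R]_d.
Implicit Types x c : E.

Definition sqr_enorm x : R := \sum_(k < d) x ord0 k ^+ 2.

Definition dot x c : R := \sum_(k < d) x ord0 k * c ord0 k.

Lemma sum_delta (i : 'I_d) (F : 'I_d -> R) :
  \sum_(k < d) (k == i)%:R * F k = F i.
Proof.
rewrite (bigD1 i)//= eqxx mul1r big1 ?addr0// => k /negPf ->.
by rewrite mul0r.
Qed.

Lemma C1_sqr_enorm i : C1 i sqr_enorm (fun x => 2 * x ord0 i).
Proof.
apply: C1_ext (C1_sum (index_enum _) (fun k : 'I_d => C1_mul (C1_coord R i k) (C1_coord R i k))) => x.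
  by apply: eq_bigr => k _; rewrite expr2.
under eq_bigr do rewrite [X in _ + X]mulrC -mulrDr.
by rewrite sum_delta mulr2n mulrDl mul1r.
Qed.

Lemma C1_dot c i : C1 i (dot^~ c) (fun=> c ord0 i).
Proof.
apply: C1_ext (C1_sum (index_enum _) (fun k : 'I_d => C1_mul (C1_coord R i k) (C1_cst i (c ord0 k)))) => x //.
under eq_bigr do rewrite mulr0 addr0.
by rewrite sum_delta.
Qed.

Lemma C1_sqr_dist c i :
  C1 i (fun x => sqr_enorm (x - c)) (fun x => 2 * (x ord0 i - c ord0 i)).
Proof.
apply: C1_ext (C1_sum (index_enum _) (fun k : 'I_d =>
  C1_mul (C1_sub (C1_coord R i k) (C1_cst i (c ord0 k)))
         (C1_sub (C1_coord R i k) (C1_cst i (c ord0 k))))) => x.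
  by apply: eq_bigr => k _; rewrite expr2 !mxE.
under eq_bigr do rewrite [X in _ + X]mulrC -mulrDr subr0.
by rewrite sum_delta mulr2n mulrDl mul1r.
Qed.

Lemma sqr_enorm_ge0 x : 0 <= sqr_enorm x.
Proof. by apply: sumr_ge0 => k _; exact: sqr_ge0. Qed.

Lemma sqr_coord_le x k : x ord0 k ^+ 2 <= sqr_enorm x.
Proof.
rewrite /sqr_enorm (bigD1 k)//= lerDl; apply: sumr_ge0 => j _; exact: sqr_ge0.
Qed.

Lemma sqr_distE x c :
  sqr_enorm (x - c) = sqr_enorm x + sqr_enorm c - 2 * dot x c.
Proof.
rewrite /sqr_enorm /dot mulr_sumr -big_split -sumrB; apply: eq_bigr => k _ /=.
by rewrite !mxE; ring.
Qed.

(** The sums over components in the divergences are quadratic in the coordinates of [x] and [c];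
    matching four coefficients leaves identities for [ring]. *)
Lemma sum_quadratic x c (c0 c1 c2 c3 : R) :
  \sum_(k < d) (c0 + c1 * x ord0 k ^+ 2 + c2 * (x ord0 k * c ord0 k) +
    c3 * c ord0 k ^+ 2) =
  d%:R * c0 + c1 * sqr_enorm x + c2 * dot x c + c3 * sqr_enorm c.
Proof.
by rewrite !big_split /= -!mulr_sumr sumr_const card_ord mulr_natl.
Qed.

(** Cauchy-Schwarz: y c - z x is [y] times the part of [c] orthogonal to [x], and its squared length
    is y (y |c|^2 - z^2). *)
Lemma sqr_dot_le x c : dot x c ^+ 2 <= sqr_enorm x * sqr_enorm c.
Proof.
have := sqr_enorm_ge0 x; rewrite le_eqVlt => /predU1P[y_eq0|y0].
  rewrite -y_eq0 mul0r /dot big1 ?expr0n// => k _.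
  suff -> : x ord0 k = 0 by rewrite mul0r.
  apply/eqP; rewrite -sqrf_eq0 eq_le sqr_ge0 andbT.
  by have := sqr_coord_le x k; rewrite -y_eq0.
set y := sqr_enorm x in y0 *; set z := dot x c.
have : 0 <= \sum_(k < d) (y * c ord0 k - z * x ord0 k) ^+ 2.
  by apply: sumr_ge0 => k _; exact: sqr_ge0.
have -> : \sum_(k < d) (y * c ord0 k - z * x ord0 k) ^+ 2 =
    y * (y * sqr_enorm c - z ^+ 2).
  have := sum_quadratic x c 0 (z ^+ 2) (- (2 * (y * z))) (y ^+ 2).
  rewrite -/y -/z => e; rewrite (_ : y * _ = d%:R * 0 + z ^+ 2 * y +
    - (2 * (y * z)) * z + y ^+ 2 * sqr_enorm c); last by ring.
  by rewrite -e; apply: eq_bigr => k _; ring.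
by rewrite pmulr_rge0// subr_ge0.
Qed.

Lemma sqr_enorm_ball x c (r : R) : 0 < sqr_enorm c -> 4 * r ^+ 2 <= sqr_enorm c ->
  sqr_enorm (x - c) <= r ^+ 2 -> sqr_enorm c / 4 <= sqr_enorm x.
Proof.
move=> c0 rc xc; apply: (@ball_away_from_origin _ _ _ (dot x c) r) => //.
- exact: sqr_enorm_ge0.
- exact: sqr_dot_le.
- by rewrite -sqr_distE.
Qed.

Section hardy_field.
Variables (q Nn : R) (Phi1 Phi1' Phi2 Phi2' : R -> R) (c : E).
Variables (a b : E -> R) (da db : 'I_d -> E -> R).

Definition sqr_mod x : R := a x ^+ 2 + b x ^+ 2.

(** A radial part and a tangential one: y c - z x is |x|^2 times the projection of [c] orthogonal to
    [x]. For Nn >= 0 the exponential grows along this direction, which creates the source. *)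
Definition field_coef k x : R :=
  x ord0 k * Phi1 (sqr_enorm x) + Phi2 (sqr_enorm x) * expR (Nn * dot x c) *
    (sqr_enorm x * c ord0 k - dot x c * x ord0 k).

Definition hardy_field k x : R := field_coef k x * sqr_mod x `^ q.

Definition dfield_coef k x : R :=
  let y := sqr_enorm x in let z := dot x c in
  Phi1 y + x ord0 k * (Phi1' y * (2 * x ord0 k)) +
  ((Phi2' y * (2 * x ord0 k) * expR (Nn * z) +
    Phi2 y * (expR (Nn * z) * (Nn * c ord0 k))) *
     (y * c ord0 k - z * x ord0 k) +
   Phi2 y * expR (Nn * z) *
     (2 * x ord0 k * c ord0 k - (c ord0 k * x ord0 k + z))).

Definition dhardy_field k x : R :=
  dfield_coef k x * sqr_mod x `^ q +
  field_coef k x *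
    (q * sqr_mod x `^ (q - 1) * (2 * (a x * da k x + b x * db k x))).

Lemma C1_sqr_mod k : C1 k a (da k) -> C1 k b (db k) ->
  C1 k sqr_mod (fun x => 2 * (a x * da k x + b x * db k x)).
Proof.
move=> Ca Cb; apply: C1_ext (C1_add (C1_mul Ca Ca) (C1_mul Cb Cb)) => x.
  by rewrite /sqr_mod !expr2.
by ring.
Qed.

Lemma C1_hardy_field k : 1 <= q -> C1_line Phi1 Phi1' -> C1_line Phi2 Phi2' ->
  C1 k a (da k) -> C1 k b (db k) -> C1 k (hardy_field k) (dhardy_field k).
Proof.
move=> q1 C1p C2p Ca Cb.
have CN : C1 k (fun x => sqr_mod x `^ q)
    (fun x => q * sqr_mod x `^ (q - 1) * (2 * (a x * da k x + b x * db k x))).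
  apply: C1_powR => // [|x|x]; first exact: C1_sqr_mod.
    by rewrite addr_ge0 ?sqr_ge0.
  move/eqP; rewrite paddr_eq0 ?sqr_ge0// !sqrf_eq0 => /andP[/eqP -> /eqP ->].
  by rewrite !mul0r addr0 mulr0.
have Cy := C1_sqr_enorm k; have Cz := C1_dot c k; have Cx := C1_coord R k k.
have CE := C1_comp (C1_onT (@C1_on_expR R)) (C1_mul (C1_cst k Nn) Cz).
have CP1 := C1_mul Cx (C1_comp C1p Cy).
have Ct := C1_sub (C1_mul Cy (C1_cst k (c ord0 k))) (C1_mul Cz Cx).
have CP2 := C1_mul (C1_mul (C1_comp C2p Cy) CE) Ct.
apply: C1_ext (C1_mul (C1_add CP1 CP2) CN) => x //.
by rewrite /dhardy_field /dfield_coef /field_coef eqxx /=; ring.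
Qed.

(** [Phi2'] disappears because y c - z x is orthogonal to [x], so that a radial factor does not
    change its divergence except by multiplication. The term - (d - 1) z is the divergence of y c -
    z x itself. *)
Lemma div_hardy_field x :
  let y := sqr_enorm x in let z := dot x c in
  \sum_(k < d) dhardy_field k x =
  (d%:R * Phi1 y + 2 * y * Phi1' y +
   Phi2 y * expR (Nn * z) * (Nn * (y * sqr_enorm c - z ^+ 2) - (d%:R - 1) * z)) *
    sqr_mod x `^ q +
  2 * q * sqr_mod x `^ (q - 1) *
    \sum_(k < d) field_coef k x * (a x * da k x + b x * db k x).
Proof.
move=> y z; rewrite big_split /= -mulr_suml; congr (_ * _ + _).
  set Ez := expR (Nn * z).
  have := sum_quadratic x c (Phi1 y - Phi2 y * Ez * z)
    (2 * Phi1' y - 2 * z * Phi2' y * Ez)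
    (2 * y * Phi2' y * Ez - Phi2 y * Ez * Nn * z + Phi2 y * Ez)
    (Phi2 y * Ez * Nn * y).
  rewrite -/y -/z => e.
  rewrite [RHS](_ : _ = d%:R * (Phi1 y - Phi2 y * Ez * z) +
    (2 * Phi1' y - 2 * z * Phi2' y * Ez) * y +
    (2 * y * Phi2' y * Ez - Phi2 y * Ez * Nn * z + Phi2 y * Ez) * z +
    Phi2 y * Ez * Nn * y * sqr_enorm c); last by ring.
  by rewrite -e; apply: eq_bigr => k _; rewrite /dfield_coef -/y -/z -/Ez; ring.
rewrite mulr_sumr; apply: eq_bigr => k _; by ring.
Qed.

End hardy_field.

Section magnetic_field.
Variables (q ep R0 : R) (c : E).
Variables (a b : E -> R) (da db : 'I_d -> E -> R) (dda ddb : 'I_d -> 'I_d -> E -> R).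
Variables (A : E -> E) (dA : 'I_d -> 'I_d -> E -> R).

Definition ball_bump x : R := sqr_pos_part (R0 ^+ 2 - sqr_enorm (x - c)).

Definition dball_bump i x : R :=
  2 * pos_part (R0 ^+ 2 - sqr_enorm (x - c)) * (- (2 * (x ord0 i - c ord0 i))).

Definition current k x : R :=
  a x * db k x - b x * da k x + A x ord0 k * sqr_mod a b x.

(** Up to [ep], the bump to the power [q] times |u|^(p - 2); the |u|^2 of the magnetic term
    completes it to |u|^p. The power |u|^(p - 2) may fail to be C^1 at the zeros of [u], hence
    [ep]. *)
Definition current_weight x : R :=
  ball_bump x `^ q * (sqr_mod a b x + ep ^+ 2) `^ (q - 1).

Definition dcurrent_weight i x : R :=
  q * ball_bump x `^ (q - 1) * dball_bump i x *
    (sqr_mod a b x + ep ^+ 2) `^ (q - 1) +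
  ball_bump x `^ q * ((q - 1) * (sqr_mod a b x + ep ^+ 2) `^ (q - 2) *
    (2 * (a x * da i x + b x * db i x))).

(* [dda i k] is the [i]-th partial derivative of [da k]. *)
Definition dcurrent i k x : R :=
  da i x * db k x + a x * ddb i k x - (db i x * da k x + b x * dda i k x) +
  (dA i k x * sqr_mod a b x +
   A x ord0 k * (2 * (a x * da i x + b x * db i x))).

Lemma C1_current_weight i : 1 <= q -> 0 < ep ->
  C1 i a (da i) -> C1 i b (db i) -> C1 i current_weight (dcurrent_weight i).
Proof.
move=> q1 ep0 Ca Cb.
have CB : C1 i ball_bump (dball_bump i).
  have h := C1_sub (C1_cst i (R0 ^+ 2)) (C1_sqr_dist c i).
  apply: C1_ext (C1_comp (C1_onT (@C1_on_sqr_pos_part R)) h) => x //.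
  by rewrite /dball_bump sub0r.
have CBq : C1 i (fun x => ball_bump x `^ q)
    (fun x => q * ball_bump x `^ (q - 1) * dball_bump i x).
  apply: C1_powR => // x; first exact: sqr_pos_part_ge0.
  rewrite /ball_bump sqr_pos_partE => /eqP; rewrite sqrf_eq0 => /eqP e.
  by rewrite /dball_bump e mulr0 mul0r.
have CM := C1_add (C1_sqr_mod Ca Cb) (C1_cst i (ep ^+ 2)).
have M0 x : 0 < sqr_mod a b x + ep ^+ 2.
  by rewrite ltr_wpDl ?exprn_gt0// addr_ge0 ?sqr_ge0.
apply: C1_ext (C1_mul CBq (C1_powR_gt0 (q - 1) CM M0)) => x //.
by rewrite /dcurrent_weight addr0 (_ : q - 1 - 1 = q - 2) //; ring.
Qed.

Lemma C1_current i k : C1 i a (da i) -> C1 i b (db i) ->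
  C1 i (da k) (dda i k) -> C1 i (db k) (ddb i k) ->
  C1 i (fun x => A x ord0 k) (dA i k) -> C1 i (current k) (dcurrent i k).
Proof.
move=> Ca Cb Cda Cdb CA.
by apply: C1_ext (C1_add (C1_sub (C1_mul Ca Cdb) (C1_mul Cb Cda))
  (C1_mul CA (C1_sqr_mod Ca Cb))).
Qed.

Definition div_current i j x : R :=
  dcurrent_weight i x * current j x + current_weight x * dcurrent i j x -
  (dcurrent_weight j x * current i x + current_weight x * dcurrent j i x).

(** Second derivatives cancel by symmetry, and [A] survives only in its exterior derivative and
    inside [al] and [be], the real and imaginary parts of nabla_A u: the identity is gauge
    invariant. *)
Lemma div_currentE i j x : dda i j x = dda j i x -> ddb i j x = ddb j i x ->
  let al k := da k x - A x ord0 k * b x in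
  let be k := db k x + A x ord0 k * a x in
  div_current i j x =
  current_weight x * (2 * (al i * be j - be i * al j) +
    (dA i j x - dA j i x) * sqr_mod a b x) +
  (dcurrent_weight i x * (a x * be j - b x * al j) -
   dcurrent_weight j x * (a x * be i - b x * al i)).
Proof.
move=> ea eb al be.
have cE k : current k x = a x * be k - b x * al k.
  by rewrite /current /al /be /sqr_mod; ring.
rewrite /div_current !cE /dcurrent ea eb /al /be /sqr_mod.
by ring.
Qed.

End magnetic_field.
End vector_fields.

(** * Pointwise Hardy inequality with remainder *)

Section pointwise_vector_inequalities.
Variables (R : realType) (d : nat).
Local Notation E := 'rV[R]_d.

(* [s + i t] is [tau], [th] the cutoff with derivative [th'], and the right-hand side
   adds to [th |nabla_A u|^p] the divergence of the fields times [|u|^p]. *)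
Lemma hardy_vector (p lam : R) (x c : E) (a b : R) (al be : 'I_d -> R)
    (th th' eta h h' tw Nn : R) :
  2 <= p -> 0 < lam -> p * lam = d%:R - p -> 0 < sqr_enorm x ->
  0 <= th -> 0 <= th' -> 0 <= lam `^ (p - 1) + eta * h ->
  let q := p / 2 in
  let y := sqr_enorm x in let z := dot x c in
  let g := lam `^ (p - 1) + eta * h in
  let N := a ^+ 2 + b ^+ 2 in
  let s k := al k + lam / y * x ord0 k * a in
  let t k := be k + lam / y * x ord0 k * b in
  let D2 := \sum_(k < d) (al k ^+ 2 + be k ^+ 2) in
  let T2 := \sum_(k < d) (s k ^+ 2 + t k ^+ 2) in
  let source := Nn * (y * sqr_enorm c - z ^+ 2) - (d%:R - 1) * z in
  let psi := y `^ (- q) * g in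
  let dpsi := - q * y `^ (- q - 1) * g + y `^ (- q) * (eta * (h' * (y^-1 / 2))) in
  is_true (th * (lam `^ p * y `^ (- q) * N `^ q + 2 * (T2 / 4) `^ q +
      eta * (y `^ (- q) * h' + tw * source) * N `^ q +
      eta * p * N `^ (q - 1) *
        \sum_(k < d) (x ord0 k * (y `^ (- q) * h) +
          tw * (y * c ord0 k - z * x ord0 k)) * (a * s k + b * t k)) <=
  th * D2 `^ q +
  ((d%:R * (th * psi) + 2 * y * (th' * psi + th * dpsi) +
     th * (eta * tw) * source) * N `^ q +
   2 * q * N `^ (q - 1) * \sum_(k < d)
     (x ord0 k * (th * psi) + th * (eta * tw) * (y * c ord0 k - z * x ord0 k)) *
     (a * al k + b * be k))).
Proof.
move=> p2 lam0 plam y0 th0 th'0 g0 q y z g N s t D2 T2 source psi dpsi.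
have q1 : 1 <= q by rewrite /q; lra.
have N0 : 0 <= N by rewrite addr_ge0 ?sqr_ge0.
pose P k := a * al k + b * be k.
pose Sx := \sum_(k < d) x ord0 k * P k.
pose S2 := \sum_(k < d) (y * c ord0 k - z * x ord0 k) * P k.
have e1 (A1 A2 : R) : \sum_(k < d) (x ord0 k * A1 +
    A2 * (y * c ord0 k - z * x ord0 k)) * P k = A1 * Sx + A2 * S2.
  by rewrite /Sx /S2 !mulr_sumr -big_split; apply: eq_bigr => k _ /=; ring.
have yN0 : y != 0 by rewrite gt_eqF.
(* Passing from nabla_A u to [tau] adds lam N to the radial sum and nothing to the tangential one,
   by orthogonality to [x]. *)
have e2 (A1 A2 : R) : \sum_(k < d) (x ord0 k * A1 +
    A2 * (y * c ord0 k - z * x ord0 k)) * (a * s k + b * t k) =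
    A1 * (Sx + lam * N) + A2 * S2.
  have := sum_quadratic x c 0 (A1 * (lam / y) * N - A2 * z * (lam / y) * N)
    (A2 * y * (lam / y) * N) 0.
  rewrite -/y -/z mulr0 add0r mul0r addr0 => e.
  rewrite (_ : A1 * (Sx + lam * N) + A2 * S2 = (A1 * Sx + A2 * S2) +
    ((A1 * (lam / y) * N - A2 * z * (lam / y) * N) * y +
     A2 * y * (lam / y) * N * z)); last by field.
  rewrite -e -e1 -big_split; apply: eq_bigr => k _ /=.
  by rewrite /s /t /P /N; ring.
rewrite e1 e2.
(* Write nabla_A u = v + tau with v = - lam x u / |x|^2. Then X = |v|^2 and Z is the real scalar
   product of [v] and [tau], the data of [powR_quadratic_remainder]; in [sum_sq], the parameter 1
   gives |nabla_A u|^2 and 1/2 the second sign hypothesis. *)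
pose X := lam ^+ 2 * N / y; pose Z := - (lam / y) * (Sx + lam * N).
have T20 : 0 <= T2 by apply: sumr_ge0 => k _; rewrite addr_ge0 ?sqr_ge0.
have X0 : 0 <= X by rewrite divr_ge0 ?(ltW y0)// mulr_ge0 ?sqr_ge0.
have sum_sq (u : R) : \sum_(k < d) ((u * s k - lam / y * x ord0 k * a) ^+ 2 +
    (u * t k - lam / y * x ord0 k * b) ^+ 2) = X + 2 * u * Z + u ^+ 2 * T2.
  have sq := sum_quadratic x c 0 ((lam / y) ^+ 2 * N) 0 0.
  rewrite mulr0 !mul0r add0r !addr0 -/y in sq.
  have := e2 1 0; rewrite !mul1r mul0r addr0 => sx.
  rewrite (_ : X + 2 * u * Z + u ^+ 2 * T2 = (lam / y) ^+ 2 * N * y +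
     (- (2 * u * (lam / y))) * (Sx + lam * N) + u ^+ 2 * T2); last first.
    by rewrite /X /Z; field.
  rewrite -sq -sx /T2 !mulr_sumr -!big_split; apply: eq_bigr => k _ /=.
  by rewrite /N; ring.
have D2E : D2 = X + 2 * Z + T2.
  have := sum_sq 1; rewrite mulr1 expr1n mul1r => <-.
  by apply: eq_bigr => k _; rewrite /s /t; ring.
have D20 : 0 <= X + 2 * Z + T2.
  by rewrite -D2E; apply: sumr_ge0 => k _; rewrite addr_ge0 ?sqr_ge0.
have H20 : 0 <= X + Z + T2 / 4.
  have -> : X + Z + T2 / 4 = X + 2 * 2^-1 * Z + 2^-1 ^+ 2 * T2 by field.
  by rewrite -sum_sq; apply: sumr_ge0 => k _; rewrite addr_ge0 ?sqr_ge0.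
have := powR_quadratic_remainder q1 X0 T20 D20 H20; rewrite -D2E => rem.
pose Y := y `^ (- q).
have Y0 : 0 <= Y by exact: powR_ge0.
have lam2 r : (lam ^+ 2) `^ r = lam `^ (2 * r).
  by rewrite -powR_mulrn ?(ltW lam0)// -powRrM.
have lamp : lam `^ p = lam * lam `^ (p - 1) by rewrite mulr_powRB1 ?(ltW lam0)//; lra.
have l20 : 0 <= lam ^+ 2 by exact: sqr_ge0.
have yV0 : 0 <= y^-1 by rewrite invr_ge0 ltW.
have XqE : X `^ q = lam `^ p * Y * N `^ q.
  rewrite (powRM _ (mulr_ge0 l20 N0) yV0) (powRM _ l20 N0) lam2.
  rewrite (_ : 2 * q = p); last by rewrite /q; field.
  by rewrite -(powR_inv1 (ltW y0)) -powRrM mulN1r -/Y; ring.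
have XZE : 2 * q * X `^ (q - 1) * Z =
    - (p * lam `^ (p - 1) * Y * N `^ (q - 1) * (Sx + lam * N)).
  rewrite (powRM _ (mulr_ge0 l20 N0) yV0) (powRM _ l20 N0) lam2.
  rewrite -(powR_inv1 (ltW y0)) -powRrM mulN1r.
  rewrite (_ : 2 * (q - 1) = p - 1 - 1); last by rewrite /q; field.
  rewrite -(powRB1_mul (p - 1) lam0) /Z.
  have -> : Y = y `^ (- (q - 1)) / y.
    by rewrite /Y -(powRB1_mul (- (q - 1)) y0) mulfK//; congr (_ `^ _); ring.
  rewrite (_ : 2 * q = p); last by rewrite /q; field.
  by ring.
have NqE : N `^ (q - 1) * N = N `^ q by rewrite mulrC mulr_powRB1//; lra.
have Y1E : y `^ (- q - 1) * y = Y by exact: powRB1_mul.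
have Nq0 : 0 <= N `^ q by exact: powR_ge0.
(* The only contribution of [th']; it is nonnegative and dropped. *)
have psi0 : 0 <= 2 * y * th' * (Y * g) * N `^ q.
  by rewrite !mulr_ge0// ltW.
have rem' := ler_wpM2l th0 rem.
rewrite -subr_ge0; apply: le_trans psi0 _; rewrite -subr_ge0.
move: rem'; rewrite -subr_ge0 => /le_trans; apply; apply: eq_ler.
rewrite XqE XZE /psi /dpsi -/Y.
(* As d - p = p lam, the divergence of x |x|^(-p) supplies exactly the lam N that turns the
   derivative of |u|^p into a product with [tau]. *)
have dE : d%:R = p + p * lam by lra.
rewrite (_ : 2 * y * (th' * (Y * g) + th * (- q * y `^ (- q - 1) * g +
    Y * (eta * (h' * (y^-1 / 2))))) =
  2 * y * th' * (Y * g) + th * (- p * (y `^ (- q - 1) * y) * g + Y * eta * h'));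
  last by rewrite /q; field.
rewrite Y1E -NqE {1}dE /g lamp /q.
by field.
Qed.

End pointwise_vector_inequalities.

(** * Cross term of the field and localization error of the current *)

Section error_terms.
Variables (R : realType) (d : nat).
Local Notation E := 'rV[R]_d.

(** Each component is at most 2 |G_k| |u| |tau|, and the bound on [G] is the power (p - 1) / p of
    the weight. Young's inequality for X = Ld^(-1/2) |u| then separates the weighted |u|^p from
    |tau|^p. *)
Lemma hardy_cross_term (p w Cg Ld a b : R) (G s t : 'I_d -> R) :
  2 <= p -> 0 < w -> 0 <= Cg -> 0 < Ld ->
  (forall k, `|G k| <= Cg * Ld `^ (- ((p - 1) / 2))) ->
  let N := a ^+ 2 + b ^+ 2 in
  let T2 := \sum_(k < d) (s k ^+ 2 + t k ^+ 2) in
  is_true (N `^ (p / 2 - 1) * `|\sum_(k < d) G k * (a * s k + b * t k)| <=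
    2 * d%:R * Cg * (w * (Ld `^ (- (p / 2)) * N `^ (p / 2)) +
      w `^ (1 - p) * T2 `^ (p / 2))).
Proof.
move=> p2 w0 Cg0 Ld0 GL N T2.
have N0 : 0 <= N by rewrite addr_ge0 ?sqr_ge0.
have T20 : 0 <= T2 by apply: sumr_ge0 => k _; rewrite addr_ge0 ?sqr_ge0.
pose U := Num.sqrt N; pose T := Num.sqrt T2.
have U0 : 0 <= U by exact: sqrtr_ge0.
have T0 : 0 <= T by exact: sqrtr_ge0.
have UN : U ^+ 2 = N by exact: sqr_sqrtr.
have TT : T ^+ 2 = T2 by exact: sqr_sqrtr.
have aU : `|a| <= U by apply: norm_le_of_sqr; rewrite // UN lerDl sqr_ge0.
have bU : `|b| <= U by apply: norm_le_of_sqr; rewrite // UN lerDr sqr_ge0.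
have stT k : s k ^+ 2 + t k ^+ 2 <= T2.
  rewrite /T2 (bigD1 k)//= lerDl; apply: sumr_ge0 => j _.
  by rewrite addr_ge0 ?sqr_ge0.
have sT k : `|s k| <= T.
  by apply: norm_le_of_sqr; rewrite // TT (le_trans _ (stT k))// lerDl sqr_ge0.
have tT k : `|t k| <= T.
  by apply: norm_le_of_sqr; rewrite // TT (le_trans _ (stT k))// lerDr sqr_ge0.
set L := Ld `^ (- ((p - 1) / 2)) in GL.
have sum_le : `|\sum_(k < d) G k * (a * s k + b * t k)| <= d%:R * (Cg * L * (2 * U * T)).
  apply: le_trans (ler_norm_sum _ _ _) _.
  rewrite -[X in X%:R]card_ord mulr_natl -sumr_const; apply: ler_sum => k _.
  apply: normM_le (GL k) _.
  have := normD_le (normM_le aU (sT k)) (normM_le bU (tT k)).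
  by move=> /le_trans; apply; apply: eq_ler; ring.
pose X := Ld `^ (- 2^-1) * U.
have X0 : 0 <= X by rewrite mulr_ge0 ?powR_ge0.
have young := powR_young1 (lt_le_trans (ltr1n _ 2) p2) w0 X0 T0.
have XpE : X `^ p = Ld `^ (- (p / 2)) * N `^ (p / 2).
  rewrite powRM ?powR_ge0// -powRrM -UN powR_sqr//.
  by congr (_ `^ _ * _); ring.
have TpE : T `^ p = T2 `^ (p / 2) by rewrite powR_sqrt.
have X1E : X `^ (p - 1) = L * (N `^ (p / 2 - 1) * U).
  rewrite powRM ?powR_ge0// -powRrM -UN.
  have -> : p / 2 - 1 = (p - 2) / 2 by field.
  rewrite powR_sqr//.
  have -> : U `^ (p - 2) * U = U `^ (p - 1).
    rewrite mulrC (_ : p - 2 = p - 1 - 1); last by ring.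
    by rewrite mulr_powRB1//; lra.
  by congr (_ `^ _ * _); field.
apply: le_trans (ler_wpM2l (powR_ge0 _ _) sum_le) _.
rewrite -XpE -TpE.
have -> : N `^ (p / 2 - 1) * (d%:R * (Cg * L * (2 * U * T))) =
    2 * d%:R * Cg * (X `^ (p - 1) * T) by rewrite X1E; ring.
by rewrite ler_wpM2l// mulr_ge0// mulr_ge0.
Qed.

(** Boundedness of [h] lets a small [eta] keep lam^(p - 1) + eta h nonnegative, the sign required by
    the cutoff at the origin. *)
Lemma log_profile_le (p sg s : R) : 2 <= p -> 0 < sg ->
  `|log_profile p sg s| <= (sg ^+ 2) `^ (- ((p - 1) / 2)).
Proof.
move=> p2 sg0; have Q0 := log_denom_gt0 sg0 s.
rewrite /log_profile normrM normrN (ger0_norm (powR_ge0 _ _)).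
apply: (@le_trans _ _ (log_denom sg s `^ (- ((p - 1) / 2)))); last first.
  by apply: powR_le_neg; rewrite ?exprn_gt0// ?lerDl ?sqr_ge0//; lra.
have -> : - ((p - 1) / 2) = 2^-1 - p / 2 by field.
rewrite powRD; last by rewrite (gt_eqF Q0) implybT.
rewrite ler_wpM2r ?powR_ge0// powR12_sqrt ?(ltW Q0)// -sqrtr_sqr ler_wsqrtr//.
by rewrite lerDr sqr_ge0.
Qed.

(** On the ball |x| >= |x0| / 2, so lam x / |x|^2 is bounded and the components of nabla_A u differ
    from those of [tau] by bounded multiples of [u]: [magnetic_scalar] applies. Off the ball the
    bump and the divergence vanish together. *)
Lemma magnetic_pointwise (p lam y0 R0 b0 : R) (x0 : E) (i j : 'I_d) :
  2 <= p -> 0 < lam -> 0 < y0 -> sqr_enorm x0 = y0 -> 0 < R0 ->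
  4 * R0 ^+ 2 <= y0 -> 0 < b0 ->
  exists2 C, 0 < C & forall (ep : R) (a b : E -> R) (da db : 'I_d -> E -> R)
      (dda ddb : 'I_d -> 'I_d -> E -> R) (A : E -> E)
      (dA : 'I_d -> 'I_d -> E -> R) (x : E),
    0 < ep ->
    (sqr_enorm (x - x0) < R0 ^+ 2 -> b0 <= dA i j x - dA j i x) ->
    dda i j x = dda j i x -> ddb i j x = ddb j i x ->
    let q := p / 2 in
    let N := sqr_mod a b x in
    let s k := da k x - A x ord0 k * b x + lam / sqr_enorm x * x ord0 k * a x in
    let t k := db k x + A x ord0 k * a x + lam / sqr_enorm x * x ord0 k * b x in
    let T2 := \sum_(k < d) (s k ^+ 2 + t k ^+ 2) in
    let ze := ball_bump R0 x0 x in
    (ze = 0 /\ div_current q ep R0 x0 a b da db dda ddb A dA i j x = 0) \/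
    (sqr_enorm (x - x0) < R0 ^+ 2 /\
     b0 / 2 * (ze `^ q * N `^ q) <=
       div_current q ep R0 x0 a b da db dda ddb A dA i j x +
       C * T2 `^ q + C * ep `^ p * ze `^ q).
Proof.
move=> p2 lam0 y00 x0y0 R00 R0y b00.
(* Bounds for the coefficients [kap] and [cc] below: the square of [kap] is at most 4 lam^2 / y0,
   hence [kap] at most 1 plus this; [cc] arises from differentiating rho^p. *)
have al00 : 0 <= 1 + 4 * lam ^+ 2 / y0.
  by rewrite addr_ge0// divr_ge0 ?(ltW y00)// mulr_ge0 ?sqr_ge0.
have C00 : 0 <= 2 * p * R0 by rewrite mulr_ge0 ?(ltW R00)// mulr_ge0//; lra.
have Z00 : 0 <= R0 ^+ 2 by exact: sqr_ge0.
have [C C_gt0 mag] := magnetic_scalar p2 al00 C00 Z00 b00.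
exists C => // ep a b da db dda ddb A dA x ep0 Bb ea eb q N s t T2 ze.
have q0 : 0 < q by rewrite /q; lra.
have q10 : 0 <= q - 1 by rewrite /q; lra.
pose rho := R0 ^+ 2 - sqr_enorm (x - x0).
have zeE : ze = pos_part rho ^+ 2 by rewrite /ze /ball_bump sqr_pos_partE.
have [rho0|rho0] := leP rho 0.
  left; have ze0 : ze = 0 by rewrite zeE pos_part_neg// expr0n.
  have ze0q : ze `^ q = 0 by rewrite ze0 powR0// gt_eqF.
  split=> //; rewrite /div_current /dcurrent_weight /current_weight.
  rewrite -/ze ze0q /dball_bump -/rho pos_part_neg//.
  by ring.
right; have inball : sqr_enorm (x - x0) < R0 ^+ 2 by rewrite -subr_gt0.
split=> //.
have zr : pos_part rho = rho by rewrite pos_part_pos// ltW.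
have rhoR : rho <= R0 ^+ 2 by rewrite gerBl sqr_enorm_ge0.
have zeqE : ze `^ q = rho `^ p by rewrite zeE zr powR_sqr// ltW.
have yy0 : y0 / 4 <= sqr_enorm x.
  by rewrite -x0y0; apply: (sqr_enorm_ball _ _ (ltW inball)); rewrite x0y0.
have y_gt0 : 0 < sqr_enorm x by apply: lt_le_trans yy0; rewrite divr_gt0.
have T20 : 0 <= T2 by apply: sumr_ge0 => k _; rewrite addr_ge0 ?sqr_ge0.
pose T := Num.sqrt T2.
have T0 : 0 <= T by exact: sqrtr_ge0.
have TT : T ^+ 2 = T2 by exact: sqr_sqrtr.
have stT k : s k ^+ 2 + t k ^+ 2 <= T2.
  rewrite /T2 (bigD1 k)//= lerDl; apply: sumr_ge0 => l _.
  by rewrite addr_ge0 ?sqr_ge0.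
have sT k : `|s k| <= T.
  by apply: norm_le_of_sqr; rewrite // TT (le_trans _ (stT k))// lerDl sqr_ge0.
have tT k : `|t k| <= T.
  by apply: norm_le_of_sqr; rewrite // TT (le_trans _ (stT k))// lerDr sqr_ge0.
pose kap k := lam / sqr_enorm x * x ord0 k.
have kapB k : `|kap k| <= 1 + 4 * lam ^+ 2 / y0.
  apply: norm_le_of_sqr => //.
  have m0 : 0 <= 4 * lam ^+ 2 / y0.
    by rewrite divr_ge0 ?(ltW y00)// mulr_ge0 ?sqr_ge0.
  have : kap k ^+ 2 <= 4 * lam ^+ 2 / y0.
    rewrite /kap exprMn exprMn exprVn.
    apply: (@le_trans _ _ (lam ^+ 2 * (sqr_enorm x ^- 2) * sqr_enorm x)).
      by rewrite ler_wpM2l ?sqr_coord_le// mulr_ge0 ?sqr_ge0// invr_ge0 sqr_ge0.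
    rewrite (_ : _ * _ * _ = lam ^+ 2 / sqr_enorm x); last first.
      by field; rewrite gt_eqF.
    rewrite ler_pdivrMr//.
    rewrite (_ : _ / y0 * _ = lam ^+ 2 * (4 * sqr_enorm x / y0)); last by ring.
    by rewrite ler_peMr ?sqr_ge0// ler_pdivlMr// mul1r; lra.
  move=> /le_trans; apply; nra.
pose cc k := - (2 * p) * (x ord0 k - x0 ord0 k).
have ccB k : `|cc k| <= 2 * p * R0.
  rewrite /cc normrM normrN (@ger0_norm _ (2 * p)); last by lra.
  rewrite ler_wpM2l//; first by lra.
  apply: norm_le_of_sqr; first exact: ltW.
  apply: le_trans (ltW inball).
  by have := sqr_coord_le (x - x0) k; rewrite !mxE.
(* The localizing factor is rho = R0^2 - |x - x0|^2, whose square is the bump: the power [q] of the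
   bump is rho^p, with derivatives rho^(p - 1) [cc]. *)
have := mag rho ep (a x) (b x) (s i) (t i) (s j) (t j) (kap i) (kap j)
  (cc i) (cc j) (dA i j x - dA j i x) T _ ep0 (Bb inball) (sT i) (tT i)
  (sT j) (tT j) (kapB i) (kapB j) (ccB i) (ccB j).
rewrite rho0 rhoR => /(_ isT) /=.
have -> : T `^ p = T2 `^ q by rewrite powR_sqrt.
rewrite -zeqE -/q.
move=> /le_trans; apply; rewrite !lerD2r; apply: eq_ler.
rewrite (@div_currentE _ d q ep R0 x0 a b da db dda ddb A dA i j x ea eb).
have drho k : q * ze `^ (q - 1) * dball_bump R0 x0 k x = rho `^ (p - 1) * cc k.
  rewrite /dball_bump -/rho zr /cc zeE zr.
  rewrite (_ : q - 1 = (p - 2) / 2); last by rewrite /q; field.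
  rewrite powR_sqr ?ltW// -(powRB1_mul (p - 1) rho0).
  rewrite (_ : p - 1 - 1 = p - 2); last by ring.
  by rewrite /q; field.
rewrite /current_weight /dcurrent_weight -/ze -/N !drho.
have Pk k : a x * da k x + b x * db k x = a x * s k + b x * t k - kap k * N.
  by rewrite /s /t /kap /N /sqr_mod; ring.
rewrite !Pk -/q.
rewrite /s /t -/(kap i) -/(kap j) /N /sqr_mod.
have -> : p - 2 = 2 * (q - 1) by rewrite /q; field.
by ring.
Qed.

End error_terms.

(** * Cutoff at the origin and fields of zero total divergence *)

Section pointwise_inequality.
Variables (R : realType).

(** Exactly 0 up to [dl], so that [C1_on_cut] applies; nondecreasing for K >= 0; and convergent to 1
    at every y > 0 when [K] grows and [dl] is its inverse. *)
Definition cutoff (K dl y : R) : R := 1 - expR (- (K * sqr_pos_part (y - dl))).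

Definition dcutoff (K dl y : R) : R :=
  expR (- (K * sqr_pos_part (y - dl))) * (K * (2 * pos_part (y - dl))).

Lemma C1_on_cutoff K dl : C1_on setT (cutoff K dl) (dcutoff K dl).
Proof.
have h1 := C1_on_add (@C1_on_id R setT) (@C1_on_cst R setT (- dl)).
have h2 := C1_on_comp (fun _ _ => I) (@C1_on_sqr_pos_part R) h1.
have h3 := C1_on_mul (@C1_on_cst R setT (- K)) h2.
have h4 := C1_on_comp (fun _ _ => I) (@C1_on_expR R) h3.
have h5 := C1_on_add (@C1_on_cst R setT 1) (C1_on_mul (@C1_on_cst R setT (- 1)) h4).
apply: C1_on_ext h5 => y; rewrite /cutoff /dcutoff ?mulNr ?mul1r//.
by ring.
Qed.

Lemma cutoff_ge0 K dl y : 0 <= K -> 0 <= cutoff K dl y.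
Proof.
move=> K0; rewrite subr_ge0 -expR0 ler_expR oppr_le0 mulr_ge0//.
exact: sqr_pos_part_ge0.
Qed.

Lemma cutoff_le1 K dl y : cutoff K dl y <= 1.
Proof. by rewrite gerBl expR_ge0. Qed.

Lemma dcutoff_ge0 K dl y : 0 <= K -> 0 <= dcutoff K dl y.
Proof.
by move=> K0; rewrite !mulr_ge0 ?expR_ge0 ?pos_part_ge0.
Qed.

Lemma cutoff_eq0 K dl y : y <= dl -> cutoff K dl y = 0.
Proof.
move=> ydl; rewrite /cutoff /sqr_pos_part pos_part_neg ?subr_le0//.
by rewrite !mulr0 oppr0 expR0 subrr.
Qed.

Lemma C1_on_log_denom (sg : R) :
  C1_on setT (log_denom sg) (fun s : R => 2 * s).
Proof.
apply: C1_on_ext (C1_on_add (@C1_on_cst R setT (sg ^+ 2))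
  (C1_on_mul (@C1_on_id R setT) (@C1_on_id R setT))) => s.
  by rewrite /log_denom expr2.
by ring.
Qed.

Lemma C1_on_log_profile (p sg : R) : 0 < sg ->
  C1_on setT (log_profile p sg) (dlog_profile p sg).
Proof.
move=> sg0.
have h1 := C1_on_comp (fun s _ => log_denom_gt0 sg0 s)
  (C1_on_powR (- (p / 2))) (@C1_on_log_denom sg).
have h2 := C1_on_mul (C1_on_mul (@C1_on_cst R setT (- 1)) (@C1_on_id R setT)) h1.
apply: C1_on_ext h2 => s; first by rewrite /log_profile mulN1r.
by rewrite /dlog_profile; field.
Qed.

Lemma C1_on_log_radius (y0 : R) :
  C1_on [set y | 0 < y] (log_radius y0) (fun y : R => y^-1 / 2).
Proof.
apply: C1_on_ext (C1_on_mul (C1_on_add (@C1_on_ln R) (@C1_on_cst R _ (- ln y0)))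
  (@C1_on_cst R _ 2^-1)) => y //.
by rewrite mulr0 !addr0.
Qed.

Definition radial_coef (p sg y0 lam1 eta y : R) : R :=
  y `^ (- (p / 2)) * (lam1 + eta * log_profile p sg (log_radius y0 y)).

Definition dradial_coef (p sg y0 lam1 eta y : R) : R :=
  - (p / 2) * y `^ (- (p / 2) - 1) *
    (lam1 + eta * log_profile p sg (log_radius y0 y)) +
  y `^ (- (p / 2)) *
    (eta * (dlog_profile p sg (log_radius y0 y) * (y^-1 / 2))).

Lemma C1_on_radial_coef (p sg y0 lam1 eta : R) : 0 < sg ->
  C1_on [set y | 0 < y] (radial_coef p sg y0 lam1 eta)
    (dradial_coef p sg y0 lam1 eta).
Proof.
move=> sg0.
have h1 := C1_on_comp (fun _ _ => I) (C1_on_log_profile p sg0) (@C1_on_log_radius y0).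
have h2 := C1_on_add (@C1_on_cst R [set y | 0 < y] lam1)
  (C1_on_mul (@C1_on_cst R _ eta) h1).
apply: C1_on_ext (C1_on_mul (C1_on_powR (- (p / 2))) h2) => y //.
by rewrite /dradial_coef mul0r !add0r.
Qed.

Lemma C1_on_shell_cutoff (y0 om : R) : C1_on setT (shell_cutoff y0 om)
  (fun y : R => 2 * pos_part (om ^+ 2 - (y - y0) ^+ 2) * (- (2 * (y - y0)))).
Proof.
have h1 := C1_on_add (@C1_on_id R setT) (@C1_on_cst R setT (- y0)).
have h2 := C1_on_add (@C1_on_cst R setT (om ^+ 2))
  (C1_on_mul (@C1_on_cst R setT (- 1)) (C1_on_mul h1 h1)).
have h3 := C1_on_comp (fun _ _ => I) (@C1_on_sqr_pos_part R) h2.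
by apply: C1_on_ext h3 => y; rewrite /shell_cutoff mulN1r -expr2//; congr (_ * _); ring.
Qed.

Section null_divergence.
Variable d : nat.
Local Notation E := 'rV[R]_d.

(** What a pointwise inequality may carry without affecting its integral; continuity and the support
    condition give the integrability needed to add such terms. *)
Definition null_div M (G : E -> R) : Prop :=
  [/\ continuous G, supp_in M G & (\int[lebesgue_rV R d]_x (G x)%:E = 0)%E].

Lemma null_div_pder M i (f g : E -> R) : C1 i f g -> supp_in M f -> null_div M g.
Proof.
move=> [_ cg fg] sf; split=> //; first exact: supp_in_pder fg sf.
exact: integral_pder fg cg sf.
Qed.

Lemma null_div_add M (f g : E -> R) : null_div M f -> null_div M g ->
  null_div M (fun x => f x + g x).
Proof.
move=> [cf sf f0] [cg sg g0]; split.
- by move=> x; exact: cvgD (cf x) (cg x).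
- move=> x fgx; have [fx|/sf//] := eqVneq (f x) 0.
  by apply: sg; move: fgx; rewrite fx add0r.
- have := integralD_EFin measurableT (continuous_supp_integrable cf sf)
    (continuous_supp_integrable cg sg).
  by rewrite /= f0 g0 adde0.
Qed.

Lemma null_div_scale M (c : R) (f : E -> R) : null_div M f ->
  null_div M (fun x => c * f x).
Proof.
move=> [cf sf f0]; split.
- by move=> x; exact: cvgM (cvg_cst c) (cf x).
- by move=> x; rewrite mulf_eq0 negb_or => /andP[_ /sf].
- have := integralZl measurableT (continuous_supp_integrable cf sf) c.
  by rewrite /= f0 mule0.
Qed.

Lemma null_div_sum M (I : Type) (r : seq I) (F : I -> E -> R) :
  (forall k, null_div M (F k)) -> null_div M (fun x => \sum_(k <- r) F k x).
Proof.
move=> F0; elim: r => [|k r ih].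
  split=> [x|x|].
  - by under eq_fun do rewrite big_nil; exact: cst_continuous.
  - by rewrite big_nil eqxx.
  - by under eq_integral do rewrite big_nil; rewrite integral0.
have -> : (fun x => \sum_(l <- k :: r) F l x) =
    (fun x => F k x + \sum_(l <- r) F l x).
  by apply/funext => x; rewrite big_cons.
exact: null_div_add.
Qed.

End null_divergence.

End pointwise_inequality.

(** * The pointwise inequality with all constants *)

Section main_pointwise.
Variables (R : realType) (d : nat).
Local Notation E := 'rV[R]_d.

Lemma supp_in_sqr_mod (M : R) (a b : E -> R) :
  supp_in M a -> supp_in M b -> supp_in M (sqr_mod a b).
Proof.
move=> sa sb x; have [ax|/sa//] := eqVneq (a x) 0.
have [bx|/sb//] := eqVneq (b x) 0.
by rewrite /sqr_mod ax bx expr0n addr0 eqxx.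
Qed.

(** The remainder [cc] |tau|^p is spent in two halves: one absorbs the cross term of the field, the
    other pays for the current. [G] gathers all divergences and disappears on integration. *)
Lemma pointwise_inequality (p R0 b0 : R) (x0 : E) (i j : 'I_d) :
  2 <= p -> p < d%:R -> 0 < sqr_enorm x0 -> 0 < R0 ->
  4 * R0 ^+ 2 <= sqr_enorm x0 -> 0 < b0 ->
  let lam := (d%:R - p) / p in
  exists sg Cw : R, [/\ 0 < sg, 0 < Cw & forall K dl, 0 < K -> 0 < dl ->
    (forall y, sqr_enorm x0 / 4 <= y -> 1 / 2 <= cutoff K dl y) ->
    forall (ep : R) (a b : E -> R) (da db : 'I_d -> E -> R)
      (dda ddb : 'I_d -> 'I_d -> E -> R) (A : E -> E)
      (dA : 'I_d -> 'I_d -> E -> R) (M : R),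
    0 < ep ->
    (forall k, C1 k a (da k)) -> (forall k, C1 k b (db k)) ->
    (forall l k, C1 l (da k) (dda l k)) -> (forall l k, C1 l (db k) (ddb l k)) ->
    (forall l k, C1 l (fun x => A x ord0 k) (dA l k)) ->
    (forall x, sqr_enorm (x - x0) < R0 ^+ 2 -> b0 <= dA i j x - dA j i x) ->
    supp_in M a -> supp_in M b ->
    exists2 G, null_div M G & forall x,
      cutoff K dl (sqr_enorm x) *
        ((lam `^ p * sqr_enorm x `^ (- (p / 2)) +
          Cw * sharp_weight p sg (sqr_enorm x0) (sqr_enorm x)) *
         sqr_mod a b x `^ (p / 2)) <=
      cutoff K dl (sqr_enorm x) *
        (\sum_(k < d) ((da k x - A x ord0 k * b x) ^+ 2 +
                       (db k x + A x ord0 k * a x) ^+ 2)) `^ (p / 2) +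
      G x + ep `^ p * ball_bump R0 x0 x `^ (p / 2)].
Proof.
move=> p2 pd y00 R00 R0y b00 lam.
set y0 := sqr_enorm x0 in y00 R0y *.
have p0 : 0 < p by lra.
have lam0 : 0 < lam by rewrite divr_gt0// subr_gt0.
have plam : p * lam = d%:R - p by rewrite /lam mulrC divfK// gt_eqF.
have D1 : (1 : R) <= d%:R - 1.
  have d3 : (2 < d)%N by rewrite -(ltr_nat R); apply: le_lt_trans pd.
  have : (3 : R) <= d%:R by rewrite ler_nat.
  lra.
have [sg [om [Nn [Mt [C [sg0 C_gt0 geo]]]]]] := weight_geometry p2 D1 y00 R00 R0y.
have [Cm Cm0 mag] := magnetic_pointwise i j p2 lam0 y00 erefl R00 R0y b00.
pose q := p / 2.
have q1 : 1 <= q by rewrite /q; lra.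
pose cc := 2 * 4^-1 `^ q.
have cc0 : 0 < cc by rewrite mulr_gt0// powR_gt0// invr_gt0.
have cc2 : cc <= 2.
  have e1 : 1 `^ q = 1 :> R by rewrite powR1.
  rewrite /cc -[leRHS]mulr1 ler_wpM2l// -[leRHS]e1.
  by rewrite ge0_ler_powR ?nnegrE ?invr_ge0//; lra.
pose B := 2 * d%:R * (1 + C).
have B0 : 0 <= B by rewrite /B mulr_ge0 ?mulr_ge0//; lra.
(* The cross term may consume a sixth of the weight, out of the third provided by the source; the
   remaining sixth becomes the final coefficient eta / 6. *)
pose w := (6 * (p * B) + 1)^-1.
have pB0 : 0 <= p * B by rewrite mulr_ge0// ltW.
have w0 : 0 < w by rewrite invr_gt0; lra.
have wB : p * B * w <= 1 / 6.
  have e : w * (6 * (p * B) + 1) = 1 by rewrite mulVf// gt_eqF//; lra.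
  lra.
(* The current is not multiplied by the cutoff, since its bump already stays away from the origin.
   Its cost gam Cm = cc / 4 is covered by the half cc / 2 because the cutoff is at least 1/2 on the
   ball. *)
pose gam := cc / (4 * Cm).
have gam0 : 0 < gam by rewrite divr_gt0// mulr_gt0.
have gamE : gam * Cm = cc / 4 by rewrite /gam; field; rewrite gt_eqF.
pose kap1 := gam * (b0 / 2).
have kap10 : 0 < kap1 by rewrite mulr_gt0// divr_gt0.
pose Hb := (sg ^+ 2) `^ (- ((p - 1) / 2)).
have Hb0 : 0 <= Hb by exact: powR_ge0.
pose lam1 := lam `^ (p - 1).
have lam10 : 0 < lam1 by exact: powR_gt0.
pose W1 := p * B * w `^ (1 - p).
have W10 : 0 <= W1 by rewrite mulr_ge0 ?powR_ge0.
(* Lower bound of the magnetic gain where |x - x0|^2 <= R0^2 / 2: there the bump is at least (R0^2 /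
   2)^2. *)
pose zl := kap1 * (R0 ^+ 2 / 2) `^ p.
have zl0 : 0 < zl by rewrite mulr_gt0// powR_gt0// divr_gt0// exprn_gt0.
have Cp0 : 0 < (C + 1) * C by rewrite mulr_gt0//; lra.
(* The three requirements on [eta]: absorb the cross term, keep the radial
   field outward, and beat the sink of the field inside the ball. *)
have [eta [eta0 eta1 eta2 eta3]] : exists eta : R, [/\ 0 < eta,
    eta * W1 <= cc / 2, eta * Hb <= lam1 & eta * ((C + 1) * C) <= zl].
  have inv (u v : R) : 0 <= u -> 0 < v -> exists2 e, 0 < e &
      forall e', 0 < e' <= e -> e' * u <= v.
    move=> u0 v0; exists (v / (u + 1)); first by rewrite divr_gt0//; lra.
    move=> e' /andP[e'0]; rewrite ler_pdivlMr; last by lra.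
    lra.
  have [e1 e10 h1] := inv _ _ W10 (divr_gt0 cc0 (ltr0n _ 2)).
  have [e2 e20 h2] := inv _ _ Hb0 lam10.
  have [e3 e30 h3] := inv _ _ (ltW Cp0) zl0.
  exists (Num.min e1 (Num.min e2 e3)); split.
  - by rewrite !lt_min e10 e20.
  - by apply: h1; rewrite !lt_min e10 e20 e30 ge_min lexx.
  - by apply: h2; rewrite !lt_min e10 e20 e30 !ge_min lexx !orbT.
  - by apply: h3; rewrite !lt_min e10 e20 e30 !ge_min lexx !orbT.
exists sg, (eta / 6); split=> //; first by rewrite divr_gt0.
move=> K dl K0 dl0 half ep a b da db dda ddb A dA M ep0 Ca Cb Cda Cdb CA Bb sa sb.
pose Phi1 y := cutoff K dl y * radial_coef p sg y0 lam1 eta y.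
pose Phi1' y := dcutoff K dl y * radial_coef p sg y0 lam1 eta y +
  cutoff K dl y * dradial_coef p sg y0 lam1 eta y.
have CPhi1 : C1_line Phi1 Phi1'.
  apply: C1_onT; apply: (C1_on_cut dl0); first exact: C1_on_cutoff.
    by move=> y; exact: cutoff_eq0.
  exact: C1_on_radial_coef.
pose Phi2 y := cutoff K dl y * (eta * (Mt * shell_cutoff y0 om y)).
(* No formula is kept for [Phi2'], which drops out of the divergence. *)
have [Phi2' CPhi2] : exists Phi2', C1_line Phi2 Phi2'.
  have h := C1_on_mul (C1_on_cutoff K dl) (C1_on_mul (@C1_on_cst R setT eta)
    (C1_on_mul (@C1_on_cst R setT Mt) (C1_on_shell_cutoff y0 om))).
  by eexists; exact: C1_onT h.
pose F k := dhardy_field q Nn Phi1 Phi1' Phi2 Phi2' x0 a b da db k.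
pose H := div_current q ep R0 x0 a b da db dda ddb A dA i j.
exists (fun x => \sum_(k < d) F k x + gam * H x).
  have sN := supp_in_sqr_mod sa sb.
  apply: null_div_add.
    apply: null_div_sum => k.
    apply: (null_div_pder (C1_hardy_field Nn x0 q1 CPhi1 CPhi2 (Ca k) (Cb k))).
    move=> x fx; apply: sN; apply: contraNN fx => /eqP Nx.
    by rewrite /hardy_field Nx powR0 ?mulr0// gt_eqF//; lra.
  apply: null_div_scale.
  have cur k x : current a b da db A k x != 0 -> forall l, `|x ord0 l| <= M.
    move=> cx; have [ax|/sa//] := eqVneq (a x) 0.
    have [bx|/sb//] := eqVneq (b x) 0.
    move: cx; rewrite /current /sqr_mod ax bx !mul0r expr0n !addr0 mulr0.
    by rewrite subr0 addr0 eqxx.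
  have nd k l : null_div M (fun x =>
      dcurrent_weight q ep R0 x0 a b da db k x * current a b da db A l x +
      current_weight q ep R0 x0 a b x * dcurrent a b da db dda ddb A dA k l x).
    apply: (null_div_pder (C1_mul
      (C1_current_weight R0 x0 q1 ep0 (Ca k) (Cb k))
      (C1_current (Ca k) (Cb k) (Cda k l) (Cdb k l) (CA k l)))).
    by move=> x; rewrite mulf_eq0 negb_or => /andP[_ /cur].
  have := null_div_add (nd i j) (null_div_scale (- 1) (nd j i)).
  by under [X in null_div _ X]eq_fun do rewrite mulN1r.
move=> x.
set th := cutoff K dl (sqr_enorm x).
have th_ge0 : 0 <= th by apply: cutoff_ge0; exact: ltW.
have th_le1 : th <= 1 by exact: cutoff_le1.
have ebump0 : 0 <= ep `^ p * ball_bump R0 x0 x `^ q.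
  by rewrite mulr_ge0 ?powR_ge0.
have ea : dda i j x = dda j i x.
  have [[_ _ p1] [_ c2 p2']] := (Ca j, Cda i j).
  have [[_ _ p3] [_ c4 p4]] := (Ca i, Cda j i).
  exact: mixed_partials p1 p2' p3 p4 c2 c4 x.
have eb : ddb i j x = ddb j i x.
  have [[_ _ p1] [_ c2 p2']] := (Cb j, Cdb i j).
  have [[_ _ p3] [_ c4 p4]] := (Cb i, Cdb j i).
  exact: mixed_partials p1 p2' p3 p4 c2 c4 x.
have := mag ep a b da db dda ddb A dA x ep0 (Bb x) ea eb.
rewrite -/q -/H /=.
set y := sqr_enorm x in th th_ge0 th_le1 *; set z := dot x x0.
set N := sqr_mod a b x; set ze := ball_bump R0 x0 x in ebump0 *.
pose al k := da k x - A x ord0 k * b x.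
pose be k := db k x + A x ord0 k * a x.
pose s k := al k + lam / y * x ord0 k * a x.
pose t k := be k + lam / y * x ord0 k * b x.
set T2 := \sum_(k < d) _; set D2 := \sum_(k < d) _.
move=> mag_x.
have T20 : 0 <= T2 `^ q by exact: powR_ge0.
have Nq0 : 0 <= N `^ q by exact: powR_ge0.
have zeq0 : 0 <= ze `^ q by exact: powR_ge0.
have mag_le : th * (kap1 * ze `^ q * N `^ q) <=
    gam * H x + th * (cc / 2 * T2 `^ q) + ep `^ p * ze `^ q.
  have thT : 0 <= th * (cc / 2 * T2 `^ q).
    by rewrite mulr_ge0// mulr_ge0// divr_ge0// ltW.
  case: mag_x => [[ze_eq0 H0]|[inball mx]].
    have {}H0 : H x = 0 := H0.
    have q_neq0 : q != 0 by rewrite gt_eqF//; clear -q1; lra.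
    by rewrite H0 ze_eq0 powR0// !mulr0 mul0r mulr0 add0r addr0.
  have yy0 : 1 / 2 <= th.
    by apply: half; exact: sqr_enorm_ball y00 R0y (ltW inball).
  have {}mx : b0 / 2 * (ze `^ q * N `^ q) <=
    H x + Cm * T2 `^ q + Cm * ep `^ p * ze `^ q := mx.
  have g1 := ler_wpM2l (ltW gam0) mx.
  have g2 : kap1 * (ze `^ q * N `^ q) <= gam * H x + cc / 4 * T2 `^ q +
      cc / 4 * (ep `^ p * ze `^ q).
    by rewrite -gamE /kap1; clear -g1; lra.
  have g3 : th * (kap1 * ze `^ q * N `^ q) <= kap1 * (ze `^ q * N `^ q).
    rewrite -[kap1 * _ * _]mulrA; apply: ler_piMl => //.
    by apply: mulr_ge0; [exact: ltW|exact: mulr_ge0].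
  have g4 : cc / 4 * T2 `^ q <= th * (cc / 2 * T2 `^ q).
    by rewrite mulrA; apply: ler_wpM2r => //; clear -yy0 cc0; nra.
  have g5 : cc / 4 * (ep `^ p * ze `^ q) <= ep `^ p * ze `^ q.
    by apply: ler_piMl => //; clear -cc2; lra.
  clear -g2 g3 g4 g5; lra.
have FE := div_hardy_field q Nn Phi1 Phi1' Phi2 Phi2' x0 a b da db x.
rewrite -/y -/z -/N -/y0 in FE.
(* At the origin the cutoff annihilates everything but the current, and [mag_le] is what remains. *)
have [y_gt0|y_le0] := ltP 0 y; last first.
  have y_eq0 : y = 0 by apply/eqP; rewrite eq_le y_le0 sqr_enorm_ge0.
  have ydl : y <= dl by rewrite y_eq0 ltW.
  have th0 : th = 0 by rewrite /th cutoff_eq0.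
  have P10 : Phi1 y = 0 by rewrite /Phi1 cutoff_eq0// mul0r.
  have P20 : Phi2 y = 0 by rewrite /Phi2 cutoff_eq0// mul0r.
  have F0 : \sum_(k < d) F k x = 0.
    rewrite /F FE P10 P20 big1 => [|k _]; last first.
      by rewrite /field_coef -/y P10 P20; ring.
    have -> : 2 * y * Phi1' y = 0 by rewrite {1}y_eq0 mulr0 mul0r.
    by ring.
  move: mag_le; rewrite th0 F0 !mul0r !add0r addr0.
  by rewrite addrC.
pose hs := log_profile p sg (log_radius y0 y).
pose dhs := dlog_profile p sg (log_radius y0 y).
pose tw := Mt * shell_cutoff y0 om y * expR (Nn * z).
pose src := y `^ (- q) * dhs + tw * (Nn * (y * y0 - z ^+ 2) - (d%:R - 1) * z).
have hsB : `|hs| <= Hb by exact: log_profile_le.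
have g0 : 0 <= lam1 + eta * hs.
  have : `|eta * hs| <= lam1.
    by rewrite normrM (gtr0_norm eta0); apply: le_trans eta2; rewrite ler_pM2l.
  by rewrite ler_norml => /andP[h _]; clear -h; lra.
have dth0 : 0 <= dcutoff K dl y by apply: dcutoff_ge0; exact: ltW.
have zy : z ^+ 2 <= y * y0 by exact: sqr_dot_le.
have [geo1 geo2 geo3 geo4] := geo y z y_gt0 zy.
have hv := @hardy_vector R d p lam x x0 (a x) (b x) al be th (dcutoff K dl y)
  eta hs dhs tw Nn p2 lam0 plam y_gt0 th_ge0 dth0 g0.
pose G k := x ord0 k * (y `^ (- q) * hs) + tw * (y * x0 ord0 k - z * x ord0 k).
set Ld := log_den sg y0 y in geo4.
have Ld0 : 0 < Ld by exact: log_den_gt0.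
have GB k : `|G k| <= (1 + C) * Ld `^ (- ((p - 1) / 2)).
  rewrite mulrDl mul1r; apply: normD_le.
    exact: log_profile_bound (sqr_coord_le x k).
  exact: geo4 (sqr_coord_le x k) (sqr_coord_le x0 k).
have C10 : 0 <= 1 + C by clear -C_gt0; lra.
have cross := hardy_cross_term (a x) (b x) s t p2 w0 C10 Ld0 GB.
rewrite -/q -/N -/T2 in cross.
(* Off the small ball the source W / 3 leaves W / 6. On it the loss is at most (C + 1/3) W <= (C +
   1) C, and [eta] was chosen so that [zl] compensates it. *)
have srcw : eta / 6 * sharp_weight p sg y0 y <=
    eta * (src - sharp_weight p sg y0 y / 6) + kap1 * ze `^ q.
  set W := sharp_weight p sg y0 y.
  have W0 : 0 < W by exact: sharp_weight_gt0.
  have kz0 : 0 <= kap1 * ze `^ q by rewrite mulr_ge0// ltW.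
  have {}geo1 : R0 ^+ 2 / 2 <= y + y0 - 2 * z -> W / 3 <= src := geo1.
  have {}geo2 : - (C * W) <= src := geo2.
  have [v|v] := leP (R0 ^+ 2 / 2) (y + y0 - 2 * z).
    have h := ler_wpM2l (ltW eta0) (geo1 v).
    by clear -h kz0; lra.
  have WC := geo3 (ltW v).
  have zlz : zl <= kap1 * ze `^ q.
    rewrite ler_wpM2l ?(ltW kap10)// /ze /ball_bump sqr_pos_partE sqr_distE.
    rewrite -/y -/z -/y0 powR_sqr ?pos_part_ge0//.
    have R20 : 0 <= R0 ^+ 2 / 2 by rewrite divr_ge0// sqr_ge0.
    rewrite pos_part_pos; last by clear -v R20; lra.
    by rewrite ge0_ler_powR ?nnegrE//; clear -v R20 p0; lra.
  have h := ler_wpM2l (ltW eta0) geo2.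
  have k : (C + 3^-1) * W <= (C + 1) * C.
    by apply: ler_pM => //; clear -C_gt0 W0; lra.
  have k' := ler_wpM2l (ltW eta0) k.
  by clear -h k' zlz eta3; lra.
have hardy_le : th * ((lam `^ p * y `^ (- q) + eta * (src - sharp_weight p sg y0 y / 6))
     * N `^ q) + th * (cc / 2 * T2 `^ q) <=
    th * D2 `^ q + \sum_(k < d) F k x.
  have FE' : \sum_(k < d) F k x = ((d%:R * (th * (y `^ (- q) * (lam1 + eta * hs))) +
      2 * y * (dcutoff K dl y * (y `^ (- q) * (lam1 + eta * hs)) +
        th * (- q * y `^ (- q - 1) * (lam1 + eta * hs) +
              y `^ (- q) * (eta * (dhs * (y^-1 / 2))))) +
      th * (eta * tw) * (Nn * (y * y0 - z ^+ 2) - (d%:R - 1) * z)) * N `^ q +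
     2 * q * N `^ (q - 1) * \sum_(k < d)
       (x ord0 k * (th * (y `^ (- q) * (lam1 + eta * hs))) +
        th * (eta * tw) * (y * x0 ord0 k - z * x ord0 k)) *
       (a x * al k + b x * be k)).
    rewrite /F FE; congr (_ * _ + _ * _).
      rewrite /Phi1 /Phi1' /Phi2 /radial_coef /dradial_coef -/th -/hs -/dhs -/q /tw.
      by ring.
    apply: eq_bigr => k _; rewrite /field_coef -/y -/z /Phi1 /Phi2 /radial_coef.
    by rewrite -/th -/hs -/q /tw /al /be; ring.
  have cTE : 2 * (T2 / 4) `^ q = cc * T2 `^ q.
    have T2_ge0 : 0 <= T2.
      by apply: sumr_ge0 => k _; rewrite addr_ge0 ?sqr_ge0.
    by rewrite powRM// ?invr_ge0// /cc; ring.
  set S := \sum_(k < d) _ in cross.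
  have {}hv : th * (lam `^ p * y `^ (- q) * N `^ q + 2 * (T2 / 4) `^ q +
      eta * src * N `^ q + eta * p * N `^ (q - 1) * S) <=
      th * D2 `^ q + \sum_(k < d) F k x by rewrite FE'; exact: hv.
  apply: le_trans hv; rewrite cTE -mulrDr; apply: ler_wpM2l => //.
  have SB : - (N `^ (q - 1) * `|S|) <= N `^ (q - 1) * S.
    by rewrite -mulrN ler_wpM2l ?powR_ge0// lerNl -normrN ler_norm.
  have ep1 : 0 <= eta * p by rewrite mulr_ge0// ltW.
  have k1 := ler_wpM2l ep1 cross.
  have k2 := ler_wpM2l ep1 SB.
  set W := sharp_weight p sg y0 y.
  have WE : Ld `^ (- q) = W by [].
  rewrite WE in k1.
  have W0 : 0 <= W * N `^ q by rewrite mulr_ge0// ltW// sharp_weight_gt0.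
  have k3 : eta * (p * B * w) * (W * N `^ q) <= eta * (1 / 6) * (W * N `^ q).
    by rewrite ler_wpM2r// ler_wpM2l// ltW.
  have k4 : eta * W1 * T2 `^ q <= cc / 2 * T2 `^ q by rewrite ler_wpM2r.
  move: k1; rewrite -/B => k1.
  have {}k1 : eta * p * (N `^ (q - 1) * `|S|) <=
      eta * (p * B * w) * (W * N `^ q) + eta * W1 * T2 `^ q.
    by apply: le_trans k1 _; rewrite /W1; apply: eq_ler; ring.
  by clear -k1 k2 k3 k4; lra.
have srcN := ler_wpM2l th_ge0 (ler_wpM2r Nq0 srcw).
by clear -srcN hardy_le mag_le; lra.
Qed.

End main_pointwise.

(** * Test functions: regularity, supports, measurability *)

Section test_functions.
Variables (R : realType) (d : nat).
Local Notation E := 'rV[R]_d.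

Lemma smooth_C1 (f : E -> R) k : smooth f -> C1 k f (partial k f).
Proof.
move=> sf; have [cf df] := sf [::]; have [cg _] := sf [:: k].
by split=> // x; apply: derivableP; exact: df.
Qed.

Lemma smooth_C1_partial (f : E -> R) l k :
  smooth f -> C1 l (partial k f) (partial l (partial k f)).
Proof.
move=> sf; have [cf df] := sf [:: k]; have [cg _] := sf [:: l; k].
by split=> // x; apply: derivableP; exact: df.
Qed.

Definition mgrad_sqr (A : E -> E) (u : E -> R[i]) (Du : E -> 'rV[R[i]]_d) x : R :=
  \sum_(k < d)
    ((complex.Re (Du x ord0 k) - A x ord0 k * complex.Im (u x)) ^+ 2 +
     (complex.Im (Du x ord0 k) + A x ord0 k * complex.Re (u x)) ^+ 2).

Lemma normc_sqr (z : R[i]) :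
  Normc.normc z ^+ 2 = complex.Re z ^+ 2 + complex.Im z ^+ 2.
Proof. by case: z => a b /=; rewrite sqr_sqrtr// addr_ge0 ?sqr_ge0. Qed.

Lemma normc_powR (p : R) (z : R[i]) :
  Normc.normc z `^ p = (complex.Re z ^+ 2 + complex.Im z ^+ 2) `^ (p / 2).
Proof.
by rewrite -normc_sqr powR_sqr//; case: z => a b /=; rewrite sqrtr_ge0.
Qed.

Lemma enorm_powR (p : R) (x : E) : enorm x `^ p = sqr_enorm x `^ (p / 2).
Proof. by rewrite powR_sqrt// sqr_enorm_ge0. Qed.

Lemma cenorm_magnetic (p : R) (A : E -> E) (u : E -> R[i]) Du x :
  cenorm (magnetic_gradient A u Du x) `^ p = mgrad_sqr A u Du x `^ (p / 2).
Proof.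
rewrite /cenorm powR_sqrt; last by apply: sumr_ge0 => k _; exact: sqr_ge0.
congr (_ `^ _); apply: eq_bigr => k _; rewrite normc_sqr !mxE.
by case: (Du x ord0 k) => a b; case: (u x) => e f /=; congr (_ ^+ 2 + _ ^+ 2); ring.
Qed.

Lemma measurable_sqr_enorm : measurable_fun setT (@sqr_enorm R d).
Proof.
apply: continuous_measurable_fun_rV; case: d => [|n] x.
  by rewrite /sqr_enorm; under eq_fun do rewrite big_ord0; exact: cst_continuous.
by have [cf _ _] := C1_sqr_enorm R (ord0 : 'I_n.+1); exact: cf.
Qed.

Lemma measurable_sharp_weight (p sg y0 : R) :
  measurable_fun setT (sharp_weight p sg y0).
Proof.
apply: (measurableT_comp (@measurable_powR R (- (p / 2)))).
apply: measurable_funM => //.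
apply: measurable_funD => //; apply: measurable_funX.
apply: measurable_funM => //; apply: measurable_funB => //.
Qed.

Lemma measurable_cutoff (K dl : R) : measurable_fun setT (cutoff K dl).
Proof.
apply: continuous_measurable_fun => y.
exact: C1_on_continuous (C1_on_cutoff K dl) I.
Qed.

End test_functions.

Section test_inequality.
Variables (R : realType) (d : nat).
Local Notation E := 'rV[R]_d.

Definition mod_sqr (u : E -> R[i]) x : R := sqr_mod (Re_fun u) (Im_fun u) x.

Definition improved_weight (p lam sg y0 Cw y : R) : R :=
  lam `^ p * y `^ (- (p / 2)) + Cw * sharp_weight p sg y0 y.

Lemma measurable_improved_weight p lam sg y0 Cw :
  measurable_fun setT (improved_weight p lam sg y0 Cw).
Proof.
apply: measurable_funD; apply: measurable_funM => //.
exact: measurable_sharp_weight.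
Qed.

Lemma measurable_cutoff_weight p lam sg y0 Cw K dl :
  measurable_fun setT (fun x : E => cutoff K dl (sqr_enorm x) *
    improved_weight p lam sg y0 Cw (sqr_enorm x)).
Proof.
apply: measurable_funM.
  exact: measurableT_comp (@measurable_cutoff R K dl) (@measurable_sqr_enorm R d).
exact: measurableT_comp (@measurable_improved_weight p lam sg y0 Cw)
  (@measurable_sqr_enorm R d).
Qed.

Lemma measurable_mod_sqr_powR (u : E -> R[i]) r :
  measurable_fun setT (Re_fun u) -> measurable_fun setT (Im_fun u) ->
  measurable_fun setT (fun x => mod_sqr u x `^ r).
Proof.
move=> mr mi; apply: (measurableT_comp (@measurable_powR R r)).
by apply: measurable_funD; apply: measurable_funX.
Qed.

Lemma mgrad_sqr_gradient (A : E -> E) (u : E -> R[i]) x :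
  mgrad_sqr A u (gradient u) x =
  \sum_(k < d) ((partial k (Re_fun u) x - A x ord0 k * Im_fun u x) ^+ 2 +
                (partial k (Im_fun u) x + A x ord0 k * Re_fun u x) ^+ 2).
Proof. by apply: eq_bigr => k _; rewrite !mxE. Qed.

Lemma continuous_sum (I : Type) (r : seq I) (F : I -> E -> R) :
  (forall k, continuous (F k)) -> continuous (fun x => \sum_(k <- r) F k x).
Proof.
move=> cF; elim: r => [|k r ih].
  by under eq_fun do rewrite big_nil; exact: cst_continuous.
have -> : (fun x => \sum_(l <- k :: r) F l x) =
    (fun x => F k x + \sum_(l <- r) F l x) by apply/funext => x; rewrite big_cons.
by move=> x; exact: cvgD (cF k x) (ih x).
Qed.

Lemma continuous_mgrad_sqr (A : E -> E) (u : E -> R[i]) :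
  (forall k, smooth (fun x => A x ord0 k)) ->
  smooth (Re_fun u) -> smooth (Im_fun u) ->
  continuous (mgrad_sqr A u (gradient u)).
Proof.
move=> sA sr si.
pose X k x := partial k (Re_fun u) x - A x ord0 k * Im_fun u x.
pose Y k x := partial k (Im_fun u) x + A x ord0 k * Re_fun u x.
have -> : mgrad_sqr A u (gradient u) =
    fun x => \sum_(k < d) (X k x * X k x + Y k x * Y k x).
  apply/funext => x; rewrite mgrad_sqr_gradient; apply: eq_bigr => k _.
  by rewrite !expr2.
apply: continuous_sum => k x.
have [cr _] := sr [::]; have [ci _] := si [::]; have [cA _] := sA k [::].
have [cdr _] := sr [:: k]; have [cdi _] := si [:: k].
have c1 : {for x, continuous (X k)}.
  exact: cvgB (cdr x) (cvgM (cA x) (ci x)).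
have c2 : {for x, continuous (Y k)}.
  exact: cvgD (cdi x) (cvgM (cA x) (cr x)).
exact: cvgD (cvgM c1 c1) (cvgM c2 c2).
Qed.

Lemma ctest_supp (u : E -> R[i]) : ctest_function u ->
  exists M, supp_in M (Re_fun u) /\ supp_in M (Im_fun u).
Proof.
move=> [_ _ cu].
pose f x : R := (u x != 0)%:R.
have fE : [set x | f x != 0] = [set x | u x != 0].
  by apply/seteqP; split=> x; rewrite /f /=; case: (u x == 0); rewrite ?eqxx ?oner_eq0.
have [M sM] : exists M, supp_in M f by apply: compact_supp_in; rewrite fE.
exists M; split=> x ux; apply: sM; rewrite /f; have [e|_] := eqVneq (u x) 0;
  by rewrite ?oner_eq0//; move: ux; rewrite /Re_fun /Im_fun e eqxx.
Qed.

Lemma supp_in_mgrad (A : E -> E) (u : E -> R[i]) M :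
  smooth (Re_fun u) -> smooth (Im_fun u) ->
  supp_in M (Re_fun u) -> supp_in M (Im_fun u) ->
  supp_in M (mgrad_sqr A u (gradient u)).
Proof.
move=> sr si mr mi x Dx l; rewrite leNgt; apply/negP => Ml.
have r0 (f : E -> R) : supp_in M f -> f x = 0.
  by move=> sf; apply/eqP; apply: contraTT Ml => /sf/(_ l); rewrite -leNgt.
have d0 (f : E -> R) k : smooth f -> supp_in M f -> partial k f x = 0.
  move=> smf sf; apply: r0.
  by have [_ _ df] := smooth_C1 k smf; exact: supp_in_pder df sf.
move: Dx; rewrite mgrad_sqr_gradient big1 ?eqxx// => k _.
by rewrite !d0// (r0 (Re_fun u))// (r0 (Im_fun u))// !mulr0 subr0 addr0 expr0n addr0.
Qed.

Lemma integrable_mgrad (p : R) (A : E -> E) (u : E -> R[i]) : 0 < p ->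
  (forall k, smooth (fun x => A x ord0 k)) -> ctest_function u ->
  (lebesgue_rV R d).-integrable setT
    (fun x => (mgrad_sqr A u (gradient u) x `^ (p / 2))%:E).
Proof.
move=> p0 sA tu; have [sr si _] := tu; have [M [mr mi]] := ctest_supp tu.
have q0 : 0 < p / 2 by rewrite divr_gt0.
apply: (@continuous_supp_integrable R d M (fun x => mgrad_sqr A u (gradient u) x `^ (p / 2))).
  apply: continuous_powR_ge0; [exact: continuous_mgrad_sqr| |exact: ltW].
  by move=> x; apply: sumr_ge0 => k _; rewrite addr_ge0 ?sqr_ge0.
move=> x; rewrite powR_eq0 negb_and (gt_eqF q0) orbF.
exact: supp_in_mgrad.
Qed.

End test_inequality.

(** * The integrated inequality for test functions *)

Section integrated_inequality.
Variables (R : realType) (d : nat).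
Local Notation E := 'rV[R]_d.

Lemma integrable_ball_bump (q R0 : R) (x0 : E) : 1 <= q -> 0 < R0 ->
  (lebesgue_rV R d).-integrable setT (fun x => (ball_bump R0 x0 x `^ q)%:E).
Proof.
move=> q1 R00.
apply: (@continuous_supp_integrable R d (R0 + (1 + sqr_enorm x0))
  (fun x => ball_bump R0 x0 x `^ q)).
  apply: continuous_powR_ge0; last by rewrite (le_trans ler01).
    rewrite /ball_bump => x; apply: (@continuous_comp _ _ _ (fun x : E => R0 ^+ 2 - sqr_enorm (x - x0))
      (@sqr_pos_part R)).
      have cd : continuous (fun x : E => sqr_enorm (x - x0)).
        apply: continuous_sum => k y /=.
        have h : {for y, continuous (fun x : E => (x - x0) ord0 k)}.
          rewrite (_ : (fun x : E => _) = (fun x => x ord0 k - x0 ord0 k)).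
            exact: cvgB (@coord_continuous _ _ _ ord0 k y) (cvg_cst _).
          by apply/funext => z; rewrite !mxE.
        exact: (cvgM h h).
      exact: cvgB (cvg_cst _) (cd x).
    exact: C1_on_continuous (@C1_on_sqr_pos_part R) I.
  by move=> x; exact: sqr_pos_part_ge0.
move=> x; rewrite powR_eq0 negb_and => /orP[|]; last first.
  by rewrite negbK => /eqP q0; move: q1; rewrite q0 ler10.
have [xb|xb _ k] := leP (R0 ^+ 2) (sqr_enorm (x - x0)).
  by rewrite /ball_bump /sqr_pos_part pos_part_neg ?subr_le0// mulr0 eqxx.
have h1 : `|x ord0 k - x0 ord0 k| <= R0.
  apply: norm_le_of_sqr; first exact: ltW.
  by apply: le_trans (ltW xb); have := sqr_coord_le (x - x0) k; rewrite !mxE.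
have y0 := sqr_enorm_ge0 x0.
have h2 : `|x0 ord0 k| <= 1 + sqr_enorm x0.
  apply: norm_le_of_sqr; first by rewrite addr_ge0.
  have := sqr_coord_le x0 k; nra.
by have := normD_le h1 h2; rewrite subrK.
Qed.

(** [G] integrates to zero, and the error ep^p times the integral of the bump can be made
    arbitrarily small as [sg] and [Cw] do not depend on [ep]. The cutoff is bounded by 1 on the
    right but kept on the left, where it makes the weight bounded. *)
Lemma test_inequality (p R0 b0 : R) (x0 : E) (i j : 'I_d) :
  2 <= p -> p < d%:R -> 0 < sqr_enorm x0 -> 0 < R0 ->
  4 * R0 ^+ 2 <= sqr_enorm x0 -> 0 < b0 ->
  let W sg Cw := improved_weight p ((d%:R - p) / p) sg (sqr_enorm x0) Cw in
  exists sg Cw : R, [/\ 0 < sg, 0 < Cw & forall K dl, 0 < K -> 0 < dl ->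
    (forall y, sqr_enorm x0 / 4 <= y -> 1 / 2 <= cutoff K dl y) ->
    forall (A : E -> E) (u : E -> R[i]),
      (forall k, smooth (fun x => A x ord0 k)) ->
      (forall x, sqr_enorm (x - x0) < R0 ^+ 2 -> b0 <= ext_deriv1 A x i j) ->
      ctest_function u ->
      (\int[lebesgue_rV R d]_x (cutoff K dl (sqr_enorm x) *
          W sg Cw (sqr_enorm x) * mod_sqr u x `^ (p / 2))%:E <=
       \int[lebesgue_rV R d]_x (mgrad_sqr A u (gradient u) x `^ (p / 2))%:E)%E].
Proof.
move=> p2 pd y00 R00 R0y b00 W.
have [sg [Cw [sg0 Cw0 pw]]] := pointwise_inequality i j p2 pd y00 R00 R0y b00.
exists sg, Cw; split=> // K dl K0 dl0 half A u sA AB tu.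
have p0 : 0 < p by lra.
have q1 : 1 <= p / 2 by lra.
have [sr si _] := tu; have [M [mr mi]] := ctest_supp tu.
have ib := integrable_ball_bump x0 q1 R00.
have iD := integrable_mgrad p0 sA tu.
set mu := lebesgue_rV R d in ib iD *.
have Jfin := integrable_fin_num measurableT ib.
set J := (\int[mu]_x (ball_bump R0 x0 x `^ (p / 2))%:E)%E in Jfin.
have J0 : 0 <= fine J.
  by apply: fine_ge0; apply: integral_ge0 => x _; rewrite lee_fin powR_ge0.
apply/lee_addgt0Pr => e e0.
pose ep := (e / (fine J + 1)) `^ p^-1.
have eJ0 : 0 < e / (fine J + 1) by rewrite divr_gt0// ltr_wpDl.
have ep0 : 0 < ep by exact: powR_gt0.
have epE : ep `^ p = e / (fine J + 1).
  by rewrite /ep -powRrM mulVf ?gt_eqF// powRr1// ltW.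
have CA l k : C1 l (fun x => A x ord0 k) (partial l (fun x => A x ord0 k)).
  exact: smooth_C1 l (sA k).
have AB' x : sqr_enorm (x - x0) < R0 ^+ 2 ->
    b0 <= partial i (fun y => A y ord0 j) x - partial j (fun y => A y ord0 i) x.
  by move=> /AB; rewrite mxE.
have [G [cG sG G0] Gpw] := pw K dl K0 dl0 half ep (Re_fun u) (Im_fun u)
  (fun k => partial k (Re_fun u)) (fun k => partial k (Im_fun u))
  (fun l k => partial l (partial k (Re_fun u)))
  (fun l k => partial l (partial k (Im_fun u))) A
  (fun l k => partial l (fun x => A x ord0 k)) M ep0
  (fun k => smooth_C1 k sr) (fun k => smooth_C1 k si)
  (fun l k => smooth_C1_partial l k sr) (fun l k => smooth_C1_partial l k si)
  CA AB' mr mi.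
have iG := continuous_supp_integrable cG sG.
have iDG := integrableD measurableT iD iG.
have ieb := integrableZl measurableT (ep `^ p) ib.
have iall := integrableD measurableT iDG ieb.
have lam_ge0 : 0 <= ((d%:R - p) / p) `^ p by exact: powR_ge0.
have W0 y : 0 <= W sg Cw y.
  by rewrite /W addr_ge0// mulr_ge0 ?powR_ge0// ltW.
apply: (@le_trans _ _ (\int[mu]_x ((mgrad_sqr A u (gradient u) x `^ (p / 2))%:E +
    (G x)%:E + (ep `^ p)%:E * (ball_bump R0 x0 x `^ (p / 2))%:E))%E).
  apply: ge0_le_integral => //.
  - move=> x _; rewrite lee_fin mulr_ge0 ?powR_ge0// mulr_ge0//.
    by apply: cutoff_ge0; exact: ltW.
  - apply/measurable_EFinP; apply: measurable_funM.
      exact: measurable_cutoff_weight.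
    apply: measurable_mod_sqr_powR; apply: continuous_measurable_fun_rV.
      by have [] := sr [::].
    by have [] := si [::].
  - exact: measurable_int iall.
  - move=> x _; rewrite -!EFinM -!EFinD lee_fin -mulrA.
    apply: le_trans (Gpw x) _; rewrite -mgrad_sqr_gradient.
    rewrite lerD2r lerD2r ler_piMl ?powR_ge0//; exact: cutoff_le1.
rewrite integralD// integralD// G0 adde0 integralZl// -/J.
rewrite leeD2l// -(fineK Jfin) -EFinM lee_fin epE.
rewrite mulrAC -mulrA ler_piMr ?(ltW e0)//.
by rewrite ler_pdivrMr ?ltr_wpDl// mul1r lerDl.
Qed.

End integrated_inequality.

(** * Integrals of combinations and extended-real estimates *)

Section integral_combination.
Context (dT : measure_display) (T : measurableType dT) (R : realType)
  (mu : {measure set T -> \bar R}).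
Implicit Types f g h : T -> R.

Lemma ge0_integral_combination f g (al be : R) :
  (forall x, 0 <= f x) -> (forall x, 0 <= g x) ->
  measurable_fun setT f -> measurable_fun setT g -> 0 <= al -> 0 <= be ->
  (\int[mu]_x (al * f x + be * g x)%:E =
    al%:E * \int[mu]_x (f x)%:E + be%:E * \int[mu]_x (g x)%:E)%E.
Proof.
move=> f0 g0 mf mg al0 be0.
have f0' x : [set: T] x -> (0 <= (f x)%:E)%E by rewrite lee_fin.
have g0' x : [set: T] x -> (0 <= (g x)%:E)%E by rewrite lee_fin.
have mf' : measurable_fun setT (fun x => (f x)%:E) by exact/measurable_EFinP.
have mg' : measurable_fun setT (fun x => (g x)%:E) by exact/measurable_EFinP.
rewrite -(ge0_integralZl_EFin mu measurableT f0' mf' al0).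
rewrite -(ge0_integralZl_EFin mu measurableT g0' mg' be0).
rewrite -ge0_integralD//.
- by move=> x _; rewrite -EFinM lee_fin mulr_ge0.
- by apply/measurable_EFinP; apply: measurable_funM.
- by move=> x _; rewrite -EFinM lee_fin mulr_ge0.
- by apply/measurable_EFinP; apply: measurable_funM.
Qed.

Lemma le_integral_combination f g h (al be : R) :
  (forall x, 0 <= f x) -> (forall x, 0 <= g x) -> (forall x, 0 <= h x) ->
  measurable_fun setT f -> measurable_fun setT g -> measurable_fun setT h ->
  0 <= al -> 0 <= be -> (forall x, h x <= al * f x + be * g x) ->
  (\int[mu]_x (h x)%:E <=
    al%:E * \int[mu]_x (f x)%:E + be%:E * \int[mu]_x (g x)%:E)%E.
Proof.
move=> f0 g0 h0 mf mg mh al0 be0 hfg; rewrite -ge0_integral_combination//.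
apply: ge0_le_integral => //.
- by move=> x _; rewrite lee_fin.
- exact/measurable_EFinP.
- by apply/measurable_EFinP; apply: measurable_funD; apply: measurable_funM.
- by move=> x _; rewrite lee_fin.
Qed.

Lemma le_integral_scale f h (c : R) :
  (forall x, 0 <= f x) -> (forall x, 0 <= h x) ->
  measurable_fun setT f -> measurable_fun setT h ->
  0 <= c -> (forall x, h x <= c * f x) ->
  (\int[mu]_x (h x)%:E <= c%:E * \int[mu]_x (f x)%:E)%E.
Proof.
move=> f0 h0 mf mh c0 hf.
have := le_integral_combination f0 f0 h0 mf mf mh c0 (lexx 0).
rewrite mul0e adde0; apply => x; by rewrite mul0r addr0.
Qed.

End integral_combination.

Section extended_real_bounds.
Variable R : realType.
Implicit Types (a b c e p : R) (F H S L X Y : \bar R).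

Lemma lee_combination a b X Y X' Y' : 0 <= a -> 0 <= b ->
  (X <= X' -> Y <= Y' -> a%:E * X + b%:E * Y <= a%:E * X' + b%:E * Y')%E.
Proof. by move=> a0 b0 XX YY; rewrite leeD// lee_wpmul2l. Qed.

Lemma poweR_inv_lt p e X : 0 < p -> 0 < e -> (0 <= X)%E ->
  (X `^ p^-1 < e%:E)%E -> (X < (e `^ p)%:E)%E.
Proof.
move=> p0 e0 X0; apply: contraTT; rewrite -!leNgt => le.
have -> : e%:E = ((e `^ p)%:E `^ p^-1)%E.
  by rewrite poweR_EFin -powRrM mulfV ?gt_eqF// powRr1// ltW.
apply: gt0_ler_poweR => //; first by rewrite invr_ge0 ltW.
- by rewrite in_itv/= lee_fin powR_ge0 leey.
- by rewrite in_itv/= X0 leey.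
Qed.

(** Finiteness of [F] bounds a H, which makes the subtraction of extended reals legitimate. *)
Lemma lee_remainder a b c F H S L : 0 <= a -> 0 <= b -> 0 < c ->
  (0 <= H)%E -> (0 <= S)%E -> (F < +oo)%E -> (L <= c%:E * S)%E ->
  (a%:E * H + b%:E * S <= F)%E -> ((b / c)%:E * L <= F - a%:E * H)%E.
Proof.
move=> a0 b0 c0 H0 S0 Foo LS HS.
have aH0 : (0 <= a%:E * H)%E by rewrite mule_ge0.
have bS0 : (0 <= b%:E * S)%E by rewrite mule_ge0.
have Hfin : (a%:E * H)%E \is a fin_num.
  by rewrite ge0_fin_numE//; apply: le_lt_trans Foo; apply: le_trans HS; rewrite leeDl.
rewrite leeBrDr//; apply: le_trans HS; rewrite addeC leeD2l//.
apply: (@le_trans _ _ ((b / c)%:E * (c%:E * S))%E).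
  by rewrite lee_wpmul2l// lee_fin divr_ge0// ltW.
by rewrite muleA -EFinM divfK// gt_eqF.
Qed.

End extended_real_bounds.

(** * Passage to the form domain *)

Section form_domain_extension.
Variables (R : realType) (d : nat).
Local Notation E := 'rV[R]_d.
Local Notation mu := (lebesgue_rV R d).

Lemma sqr_split (s x y : R) : 0 < s ->
  (x + y) ^+ 2 <= (1 + s) * x ^+ 2 + (1 + s^-1) * y ^+ 2.
Proof.
move=> s0; rewrite -subr_ge0.
have -> : (1 + s) * x ^+ 2 + (1 + s^-1) * y ^+ 2 - (x + y) ^+ 2 =
    s * (x - s^-1 * y) ^+ 2 by field; rewrite gt_eqF.
by rewrite mulr_ge0 ?sqr_ge0// ltW.
Qed.

(** The factors carry the exponent [p] and not p / 2: one half comes from the hypothesis on [c], the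
    other from [powR_add_le]. *)
Lemma powR_split (p s a b c : R) : 0 < p -> 0 < s -> 0 <= a -> 0 <= b -> 0 <= c ->
  c <= (1 + s) * a + (1 + s^-1) * b ->
  c `^ (p / 2) <= (1 + s) `^ p * a `^ (p / 2) + (1 + s^-1) `^ p * b `^ (p / 2).
Proof.
move=> p0 s0 a0 b0 c0 cab; have s'0 : 0 < s^-1 by rewrite invr_gt0.
have q0 : 0 <= p / 2 by rewrite divr_ge0// ltW.
have s1 : 0 <= 1 + s by lra.
have s1' : 0 <= 1 + s^-1 by lra.
have sa : 0 <= (1 + s) * a by rewrite mulr_ge0.
have sb : 0 <= (1 + s^-1) * b by rewrite mulr_ge0.
apply: (@le_trans _ _ (((1 + s) * a + (1 + s^-1) * b) `^ (p / 2))).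
  by rewrite ge0_ler_powR ?nnegrE ?addr_ge0.
apply: le_trans (powR_add_le q0 s0 sa sb) _.
have dbl t : 0 < t -> t `^ p = t `^ (p / 2) * t `^ (p / 2).
  by move=> t0; rewrite -powRD -?splitr// (gt_eqF t0) implybT.
by rewrite !powRM// !mulrA -!dbl//; lra.
Qed.

Definition measurable_pair (u : E -> R[i]) (Du : E -> 'rV[R[i]]_d) : Prop :=
  [/\ measurable_fun setT (Re_fun u), measurable_fun setT (Im_fun u),
      forall k, measurable_fun setT (Re_fun (fun x => Du x ord0 k)) &
      forall k, measurable_fun setT (Im_fun (fun x => Du x ord0 k))].

Lemma measurable_pairB u Du v Dv : measurable_pair u Du -> measurable_pair v Dv ->
  measurable_pair (u \- v) (Du \- Dv).
Proof.
move=> [u1 u2 u3 u4] [v1 v2 v3 v4]; split=> [||k|k].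
- rewrite (_ : Re_fun _ = Re_fun u \- Re_fun v); first exact: measurable_funB.
  by apply/funext => x; rewrite /Re_fun /=; case: (u x) (v x) => [? ?] [? ?].
- rewrite (_ : Im_fun _ = Im_fun u \- Im_fun v); first exact: measurable_funB.
  by apply/funext => x; rewrite /Im_fun /=; case: (u x) (v x) => [? ?] [? ?].
- rewrite (_ : Re_fun _ = Re_fun (fun x => Du x ord0 k) \-
    Re_fun (fun x => Dv x ord0 k)); first exact: measurable_funB.
  apply/funext => x; rewrite /Re_fun /= !mxE.
  by case: (Du x ord0 k) (Dv x ord0 k) => [? ?] [? ?].
- rewrite (_ : Im_fun _ = Im_fun (fun x => Du x ord0 k) \-
    Im_fun (fun x => Dv x ord0 k)); first exact: measurable_funB.
  apply/funext => x; rewrite /Im_fun /= !mxE.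
  by case: (Du x ord0 k) (Dv x ord0 k) => [? ?] [? ?].
Qed.

Lemma measurable_mgrad_powR (A : E -> E) u Du r :
  (forall k, measurable_fun setT (fun x => A x ord0 k)) -> measurable_pair u Du ->
  measurable_fun setT (fun x => mgrad_sqr A u Du x `^ r).
Proof.
move=> mA [u1 u2 u3 u4]; apply: (measurableT_comp (@measurable_powR R r)).
apply: measurable_sum => k; apply: measurable_funD; apply: measurable_funX.
  exact: measurable_funB (u3 k) (measurable_funM (mA k) u2).
exact: measurable_funD (u4 k) (measurable_funM (mA k) u1).
Qed.

Lemma mgrad_sqr_ge0 (A : E -> E) u Du x : 0 <= mgrad_sqr A u Du x.
Proof. by apply: sumr_ge0 => k _; rewrite addr_ge0 ?sqr_ge0. Qed.

Lemma mgrad_sqr_splitB (A : E -> E) u Du v Dv (s : R) x : 0 < s ->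
  mgrad_sqr A u Du x <= (1 + s) * mgrad_sqr A v Dv x +
    (1 + s^-1) * mgrad_sqr A (u \- v) (Du \- Dv) x /\
  mgrad_sqr A v Dv x <= (1 + s) * mgrad_sqr A u Du x +
    (1 + s^-1) * mgrad_sqr A (u \- v) (Du \- Dv) x.
Proof.
move=> s0; rewrite /mgrad_sqr !mulr_sumr -!big_split.
have split2 (x1 y1 x2 y2 : R) : x1 ^+ 2 + y1 ^+ 2 <=
    (1 + s) * (x2 ^+ 2 + y2 ^+ 2) +
    (1 + s^-1) * ((x1 - x2) ^+ 2 + (y1 - y2) ^+ 2).
  have := sqr_split x2 (x1 - x2) s0; have := sqr_split y2 (y1 - y2) s0.
  by rewrite !subrKC; lra.
split; apply: ler_sum => k _ /=; rewrite !mxE;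
  case: (Du x ord0 k) (Dv x ord0 k) (u x) (v x) => [a b] [a' b'] [e f] [e' f'] /=;
  set t := A x ord0 k.
- apply: le_trans (split2 _ _ (a' - t * f') (b' + t * e')) _.
  by apply: eq_ler; congr (_ + _ * (_ ^+ 2 + _ ^+ 2)); ring.
- apply: le_trans (split2 _ _ (a - t * f) (b + t * e)) _.
  by apply: eq_ler; congr (_ + _ * _); ring.
Qed.

Lemma mod_sqr_splitB (u v : E -> R[i]) (s : R) x : 0 < s ->
  mod_sqr u x <= (1 + s) * mod_sqr v x + (1 + s^-1) * mod_sqr (u \- v) x.
Proof.
move=> s0; rewrite /mod_sqr /sqr_mod /Re_fun /Im_fun /=.
case: (u x) (v x) => [a b] [a' b'] /=.
have := sqr_split a' (a - a') s0; have := sqr_split b' (b - b') s0.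
by rewrite !subrKC; lra.
Qed.

Lemma form_normP (A : E -> E) (p e : R) u Du : 0 < p -> 0 < e ->
  (form_norm A p u Du < e%:E)%E ->
  (\int[mu]_x (mgrad_sqr A u Du x `^ (p / 2))%:E < (e `^ p)%:E)%E /\
  (\int[mu]_x (mod_sqr u x `^ (p / 2))%:E < (e `^ p)%:E)%E.
Proof.
move=> p0 e0; rewrite /form_norm /magnetic_form.
under eq_integral do rewrite cenorm_magnetic.
under [X in (_ + X)%E]eq_integral do rewrite normc_powR.
set F := (X in ((X + _) `^ _)%E); set N := (X in ((_ + X) `^ _)%E).
have F0 : (0 <= F)%E by apply: integral_ge0 => x _; rewrite lee_fin powR_ge0.
have N0 : (0 <= N)%E by apply: integral_ge0 => x _; rewrite lee_fin powR_ge0.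
move=> /(poweR_inv_lt p0 e0 (adde_ge0 F0 N0)) sum_lt.
split; apply: le_lt_trans sum_lt; [exact: leeDl N0|exact: leeDr F0].
Qed.

(** A test function is compared with [u] twice, in the weighted norm and in the energy; each
    comparison costs a factor (1 + s)^p close to 1 and a small error. Boundedness of [V] turns
    closeness in L^p into closeness of the weighted integrals. *)
Lemma domain_inequality (p Vmax : R) (A : E -> E) (V : E -> R) u Du :
  0 < p -> (0 < d)%N -> (forall k, smooth (fun x => A x ord0 k)) ->
  measurable_fun setT V -> (forall x, 0 <= V x <= Vmax) ->
  (forall phi : E -> R[i], ctest_function phi ->
    (\int[mu]_x (V x * mod_sqr phi x `^ (p / 2))%:E <=
     \int[mu]_x (mgrad_sqr A phi (gradient phi) x `^ (p / 2))%:E)%E) ->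
  form_domain A p u Du ->
  (\int[mu]_x (V x * mod_sqr u x `^ (p / 2))%:E <=
   \int[mu]_x (mgrad_sqr A u Du x `^ (p / 2))%:E < +oo)%E.
Proof.
move=> p0 d0 sA mV V0 test [wg dense].
have mA k : measurable_fun setT (fun x => A x ord0 k).
  by apply: continuous_measurable_fun_rV; have [] := sA k [::].
(* Measurability is read off from the local integrability in [weak_gradient]; for [u] itself this
   takes one coordinate, hence [0 < d]. *)
have mu_u : measurable_pair u Du.
  have [[[mr _] _ _] [[mi _] _ _]] := wg (Ordinal d0).
  by split=> // k; have [[_ [mk _] _] [_ [mk' _] _]] := wg k.
have mtest phi : ctest_function phi -> measurable_pair phi (gradient phi).
  move=> [sr si _]; split=> [||k|k]; apply: continuous_measurable_fun_rV.
  - by have [] := sr [::].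
  - by have [] := si [::].
  - rewrite (_ : Re_fun _ = partial k (Re_fun phi)); first by have [] := sr [:: k].
    by apply/funext => x; rewrite /Re_fun mxE.
  - rewrite (_ : Im_fun _ = partial k (Im_fun phi)); first by have [] := si [:: k].
    by apply/funext => x; rewrite /Im_fun mxE.
set q := p / 2.
pose FF v Dv := (\int[mu]_x (mgrad_sqr A v Dv x `^ q)%:E)%E.
pose NN v := (\int[mu]_x (mod_sqr v x `^ q)%:E)%E.
pose VN v := (\int[mu]_x (V x * mod_sqr v x `^ q)%:E)%E.
have mod_ge0 (v : E -> R[i]) x : 0 <= mod_sqr v x by rewrite addr_ge0 ?sqr_ge0.
have Vx0 x : 0 <= V x by have /andP[] := V0 x.
have Vm0 : 0 <= Vmax by have /andP[h1 h2] := V0 0; exact: le_trans h2.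
have mmod v Dv : measurable_pair v Dv -> measurable_fun setT (fun x => mod_sqr v x `^ q).
  by move=> [v1 v2 _ _]; exact: measurable_mod_sqr_powR.
have approx (s e : R) : 0 < s -> 0 < e -> exists phi, [/\ ctest_function phi,
    (FF u Du <= ((1 + s) `^ p)%:E * FF phi (gradient phi) +
       ((1 + s^-1) `^ p)%:E * (e%:E))%E,
    (FF phi (gradient phi) <= ((1 + s) `^ p)%:E * FF u Du +
       ((1 + s^-1) `^ p)%:E * (e%:E))%E &
    (VN u <= ((1 + s) `^ p)%:E * VN phi +
       ((1 + s^-1) `^ p * Vmax)%:E * e%:E)%E].
  move=> s0 e0; have e'0 : 0 < e `^ p^-1 by exact: powR_gt0.
  have [phi tphi /(form_normP p0 e'0)] := dense _ e'0.
  rewrite -powRrM mulVf ?gt_eqF// powRr1 ?(ltW e0)// => -[Fe Ne].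
  have mB := measurable_pairB mu_u (mtest _ tphi).
  exists phi; split=> //.
  - apply: le_trans (le_integral_combination mu _ _ _ (measurable_mgrad_powR q mA (mtest _ tphi))
      (measurable_mgrad_powR q mA mB) (measurable_mgrad_powR q mA mu_u)
      (powR_ge0 (1 + s) p) (powR_ge0 (1 + s^-1) p) _) _; try by move=> x; exact: powR_ge0.
      move=> x; apply: powR_split => //; rewrite ?mgrad_sqr_ge0//.
      exact: (mgrad_sqr_splitB _ _ _ _ _ _ s0).1.
    exact: lee_combination (powR_ge0 _ _) (powR_ge0 _ _) (lexx _) (ltW Fe).
  - apply: le_trans (le_integral_combination mu _ _ _ (measurable_mgrad_powR q mA mu_u)
      (measurable_mgrad_powR q mA mB) (measurable_mgrad_powR q mA (mtest _ tphi))
      (powR_ge0 (1 + s) p) (powR_ge0 (1 + s^-1) p) _) _; try by move=> x; exact: powR_ge0.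
      move=> x; apply: powR_split => //; rewrite ?mgrad_sqr_ge0//.
      exact: (mgrad_sqr_splitB _ _ _ _ _ _ s0).2.
    exact: lee_combination (powR_ge0 _ _) (powR_ge0 _ _) (lexx _) (ltW Fe).
  - apply: le_trans (le_integral_combination mu (f := fun x => V x * mod_sqr phi x `^ q)
      (g := fun x => mod_sqr (u \- phi) x `^ q) (al := (1 + s) `^ p)
      (be := (1 + s^-1) `^ p * Vmax) _ _ _ _ _ _ _ _ _) _.
    + by move=> x; rewrite mulr_ge0// powR_ge0.
    + by move=> x; exact: powR_ge0.
    + by move=> x; rewrite mulr_ge0// powR_ge0.
    + by apply: measurable_funM => //; exact: mmod (mtest _ tphi).
    + exact: mmod mB.
    + by apply: measurable_funM => //; exact: mmod mu_u.
    + exact: powR_ge0.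
    + by rewrite mulr_ge0// powR_ge0.
    + move=> x; have /andP[_ VV] := V0 x.
      have := powR_split p0 s0 (mod_ge0 phi x) (mod_ge0 (u \- phi) x) (mod_ge0 u x)
        (mod_sqr_splitB u phi x s0).
      rewrite -/q => /(ler_wpM2l (Vx0 x)) /le_trans; apply.
      rewrite mulrDr mulrCA lerD2l mulrA (mulrC (V x)) -!mulrA ler_wpM2l ?powR_ge0//.
      by rewrite ler_wpM2r ?powR_ge0.
    + have bV := mulr_ge0 (powR_ge0 (1 + s^-1) p) Vm0.
      exact: lee_combination (powR_ge0 _ _) bV (lexx _) (ltW Ne).
have Fu_lty : (FF u Du < +oo)%E.
  have [phi [tphi h _ _]] := approx 1 1 ltr01 ltr01.
  apply: le_lt_trans h _.
  have ip : FF phi (gradient phi) \is a fin_num :=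
    integrable_fin_num measurableT (integrable_mgrad p0 sA tphi).
  by rewrite -(fineK ip) -!EFinM -EFinD ltry.
rewrite Fu_lty andbT.
have Fu0 : (0 <= FF u Du)%E by apply: integral_ge0 => x _; rewrite lee_fin powR_ge0.
have Fufin : FF u Du \is a fin_num by rewrite ge0_fin_numE.
rewrite -/(FF u Du) -(fineK Fufin).
set r := fine (FF u Du).
have r0 : 0 <= r by exact: fine_ge0.
apply/lee_addgt0Pr => eps eps0.
(* The total multiplicative loss al^2 is set to [k], for which k r <= r + eps / 2. The factor [be]
   blows up as [s] tends to 0, but the accuracy of [phi] is chosen after [s]. *)
pose k := 1 + eps / (2 * (r + 1)).
have r10 : 0 < 2 * (r + 1) by lra.
have k1 : 1 < k by rewrite /k ltrDl divr_gt0.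
pose s := k `^ (2 * p)^-1 - 1.
have p20 : 0 < 2 * p by rewrite mulr_gt0.
have s0 : 0 < s.
  rewrite subr_gt0 -[ltLHS](_ : 1 `^ (2 * p)^-1 = 1); last by rewrite powR1.
  by rewrite gt0_ltr_powR ?nnegrE ?invr_gt0//; lra.
pose al := (1 + s) `^ p; pose be := (1 + s^-1) `^ p.
have al0 : 0 <= al by exact: powR_ge0.
have be0 : 0 <= be by exact: powR_ge0.
have al2 : al * al = k.
  rewrite /al /s subrKC -powRrM -powRD; last first.
    by rewrite (gt_eqF (lt_trans ltr01 k1)) implybT.
  rewrite (_ : _ + _ = 1); first by rewrite powRr1//; lra.
  by field; rewrite gt_eqF.
pose c := be * (al + Vmax).
have c0 : 0 <= c by rewrite mulr_ge0// addr_ge0.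
have e0 : 0 < eps / (2 * (c + 1)) by rewrite divr_gt0//; lra.
have [phi [tphi _ h1 h2]] := approx s _ s0 e0.
rewrite -/al -/be -(fineK Fufin) -/r in h1 h2.
have h3 := test phi tphi.
apply: le_trans h2 _.
apply: (@le_trans _ _ (al%:E * (al%:E * r%:E + be%:E * (eps / (2 * (c + 1)))%:E) +
   (be * Vmax)%:E * (eps / (2 * (c + 1)))%:E)%E).
  exact: lee_combination al0 (mulr_ge0 be0 Vm0) (le_trans h3 h1) (lexx _).
set x := eps / (2 * (c + 1)).
have -> : (al%:E * (al%:E * r%:E + be%:E * x%:E) + (be * Vmax)%:E * x%:E)%E =
    (al * (al * r + be * x) + be * Vmax * x)%:E by [].
rewrite -EFinD lee_fin /x.
have -> : al * (al * r + be * (eps / (2 * (c + 1)))) +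
    be * Vmax * (eps / (2 * (c + 1))) = k * r + c * (eps / (2 * (c + 1))).
  by rewrite -al2 /c; ring.
have i1 : k * r <= r + eps / 2.
  rewrite /k mulrDl mul1r lerD2l mulrAC ler_pdivrMr//.
  by clear -r0 eps0; nra.
have i2 : c * (eps / (2 * (c + 1))) <= eps / 2.
  have c10 : 0 < 2 * (c + 1) by lra.
  rewrite mulrA ler_pdivrMr//; clear -c0 eps0; nra.
by clear -i1 i2; lra.
Qed.

End form_domain_extension.

(** * Removal of the cutoff and comparison of the weights *)

Section removal_of_the_cutoff.
Variables (R : realType) (d : nat).
Local Notation E := 'rV[R]_d.
Local Notation mu := (lebesgue_rV R d).

Lemma integral_le_of_cvg (f : nat -> E -> R) (g : E -> R) (F : \bar R) :
  (forall n, measurable_fun setT (f n)) -> (forall n x, 0 <= f n x) ->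
  (forall x, f ^~ x @ \oo --> g x) ->
  (forall n, (\int[mu]_x (f n x)%:E <= F)%E) -> (\int[mu]_x (g x)%:E <= F)%E.
Proof.
move=> mf f0 fg fF.
have mf' n : measurable_fun setT (fun x => (f n x)%:E) by apply/measurable_EFinP; exact: mf.
have := @fatou _ _ _ mu setT measurableT (fun n x => (f n x)%:E).
move=> /(_ mf' (fun n x _ => f0 n x)).
have -> : (\int[mu]_x limn_einf (fun n => (f n x)%:E) = \int[mu]_x (g x)%:E)%E.
  apply: eq_integral => x _.
  have c : (fun n => (f n x)%:E) @ \oo --> (g x)%:E by apply: cvg_EFin => //; [exact: nearW|exact: fg].
  by rewrite is_cvg_limn_einfE; [exact/cvg_lim|apply/cvg_ex; exists (g x)%:E].
move=> /le_trans; apply; rewrite limn_einf_lim; apply: lime_le; first exact: is_cvg_einfs.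
apply: nearW => n; apply: le_trans (fF n).
by apply: ereal_inf_lbound; exists n => /=.
Qed.

(** K >= 8 / y0 gives y - 1 / K >= y0 / 8, and K >= 64 / y0^2 then brings the exponent to at least
    1; finally exp 1 >= 2. *)
Lemma cutoff_ge_half (K y y0 : R) : 0 < y0 -> 8 / y0 <= K -> 64 / y0 ^+ 2 <= K ->
  y0 / 4 <= y -> 1 / 2 <= cutoff K K^-1 y.
Proof.
move=> y00 K1 K2 yy.
have K0 : 0 < K by apply: lt_le_trans K1; rewrite divr_gt0.
have y20 : 0 < y0 ^+ 2 by rewrite exprn_gt0.
have Ki : K^-1 <= y0 / 8.
  by rewrite -[leRHS]invrK lef_pV2 ?posrE ?invr_gt0 ?divr_gt0// invf_div.
have t1 : 1 <= K * sqr_pos_part (y - K^-1).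
  have ge : y0 / 8 <= y - K^-1 by lra.
  have ge0 : 0 <= y0 / 8 by rewrite divr_ge0// ltW.
  rewrite sqr_pos_partE pos_part_pos; last exact: le_trans ge.
  apply: (@le_trans _ _ (64 / y0 ^+ 2 * (y0 / 8) ^+ 2)).
    by apply: eq_ler; field; rewrite gt_eqF.
  apply: ler_pM => //; rewrite ?sqr_ge0 ?divr_ge0 ?(ltW y20)//.
  by rewrite lerXn2r ?nnegrE// (le_trans ge0).
rewrite /cutoff; set t := K * _ in t1 *.
have := expR_ge1Dx t => h.
have : expR (- t) <= 2^-1 by rewrite expRN lef_pV2 ?posrE ?expR_gt0//; lra.
lra.
Qed.

(** The defect exp (- t) is at most 1 / t, and t >= K y^2 / 4 as soon as 1 / K <= y / 2. *)
Lemma cvg_cutoff (m : nat) (y : R) : 0 < y ->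
  cutoff (n + m).+1%:R (n + m).+1%:R^-1 y @[n --> \oo] --> (1 : R).
Proof.
move=> y0; apply/cvgrPdist_lt => e e0; near=> n.
set K : R := (n + m).+1%:R.
have nK : n%:R <= K by rewrite ler_nat leqW// leq_addr.
have K1 : 2 / y < K by apply: lt_le_trans nK; near: n; exact: nbhs_infty_gtr.
have K2 : 4 / (y ^+ 2 * e) < K.
  by apply: lt_le_trans nK; near: n; exact: nbhs_infty_gtr.
have K0 : 0 < K by rewrite ltr0n.
have Ki : K^-1 <= y / 2.
  by rewrite -[leRHS]invrK lef_pV2 ?posrE ?invr_gt0 ?divr_gt0// invf_div ltW.
rewrite /cutoff opprB addrC subrK ger0_norm ?expR_ge0// expRN.
set t := K * _.
have te : e^-1 < t.
  have ge : y / 2 <= y - K^-1 by move: (K^-1) Ki => k; lra.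
  have ge0 : 0 <= y / 2 by rewrite divr_ge0// ltW.
  apply: (@lt_le_trans _ _ (K * (y / 2) ^+ 2)); last first.
    rewrite ler_pM2l// sqr_pos_partE pos_part_pos; last exact: le_trans ge.
    by rewrite lerXn2r ?nnegrE// (le_trans ge0).
  rewrite (_ : e^-1 = 4 / (y ^+ 2 * e) * (y / 2) ^+ 2).
    by rewrite ltr_pM2r// exprn_gt0// divr_gt0.
  by field; rewrite !gt_eqF.
have t0 : 0 < t by apply: lt_trans te; rewrite invr_gt0.
apply: (@le_lt_trans _ _ t^-1).
  rewrite lef_pV2 ?posrE ?expR_gt0//; have := expR_ge1Dx t; lra.
by rewrite -[ltRHS]invrK ltf_pV2 ?posrE ?invr_gt0.
Unshelve. all: by end_near. Qed.

(** With L = log |x|, the denominator sg^2 + (L - log |x0|)^2 is at most m (1 + L^2), and (1 +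
    L^2)^(p/2) is at most 2^(p/2) (1 + |L|^p). *)
Lemma log_weight_le (p sg y0 : R) (x : E) : 0 < p -> 0 < sg ->
  log_weight p x <= (2 * (sg ^+ 2 + 2 * (ln y0 / 2) ^+ 2 + 2)) `^ (p / 2) *
    sharp_weight p sg y0 (sqr_enorm x).
Proof.
move=> p0 sg0; have := sqr_enorm_ge0 x.
rewrite le_eqVlt => /predU1P[x0|y_gt0].
  (* At the origin [log_weight] is the inverse of 0, which is 0. *)
  rewrite /log_weight enorm_powR -x0 powR0 ?gt_eqF ?divr_gt0// mul0r invr0.
  by rewrite mulr_ge0 ?powR_ge0.
set y := sqr_enorm x in y_gt0 *.
set m := sg ^+ 2 + _ + 2.
have m0 : 0 < m by rewrite ltr_wpDl// addr_ge0 ?sqr_ge0// mulr_ge0 ?sqr_ge0.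
have q0 : 0 <= p / 2 by rewrite divr_ge0// ltW.
rewrite /log_weight enorm_powR -/y.
pose L := ln (enorm x); set Lp := `|_| `^ p.
have LE : ln y = 2 * L.
  have -> : y = enorm x ^+ 2 by rewrite sqr_sqrtr// ltW.
  by rewrite lnXn ?sqrtr_gt0// mulr_natl.
have Lp0 : 0 <= Lp by exact: powR_ge0.
have LpE : Lp = (L ^+ 2) `^ (p / 2).
  by rewrite /Lp -powR_sqr// real_normK// num_real.
set Q := log_denom sg (log_radius y0 y).
have Q0 : 0 < Q by exact: log_denom_gt0.
have Qm : Q <= m * (1 + L ^+ 2).
  have -> : Q = sg ^+ 2 + (L - ln y0 / 2) ^+ 2.
    by rewrite /Q /log_denom /log_radius LE; congr (_ + _ ^+ 2); field.
  have h1 : (L - ln y0 / 2) ^+ 2 <= 2 * L ^+ 2 + 2 * (ln y0 / 2) ^+ 2.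
    by have := sqr_ge0 (L + ln y0 / 2); lra.
  have h2 : 0 <= sg ^+ 2 * L ^+ 2 by rewrite mulr_ge0 ?sqr_ge0.
  have h3 : 0 <= (ln y0 / 2) ^+ 2 * L ^+ 2 by rewrite mulr_ge0 ?sqr_ge0.
  rewrite /m; lra.
have QLp : Q `^ (p / 2) <= (2 * m) `^ (p / 2) * (1 + Lp).
  apply: (@le_trans _ _ ((m * (1 + L ^+ 2)) `^ (p / 2))).
    by rewrite ge0_ler_powR ?nnegrE ?(ltW Q0)// mulr_ge0 ?(ltW m0)// addr_ge0 ?sqr_ge0.
  rewrite powRM ?(ltW m0) ?addr_ge0 ?sqr_ge0// powRM ?(ltW m0)//.
  rewrite (mulrC (2 `^ _)) -mulrA ler_wpM2l ?powR_ge0//.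
  have := powR_add_le q0 (ltr01 : 0 < 1 :> R) ler01 (sqr_ge0 L).
  by rewrite invr1 powR1 mulr1 -LpE mulrDr mulr1.
rewrite (sharp_weightE _ _ sg0 y_gt0) -/Q invfM [leRHS]mulrCA -powRN.
rewrite ler_wpM2l ?powR_ge0// powRN ler_pdivlMr ?powR_gt0//.
by rewrite mulrC ler_pdivrMr// ltr_wpDr.
Qed.

End removal_of_the_cutoff.

(** * Localization of the field and conclusion *)

Section magnetic_hardy_inequality.
Variables (R : realType) (d : nat).
Local Notation E := 'rV[R]_d.
Local Notation mu := (lebesgue_rV R d).
Implicit Types p lam sg y dl K Cw : R.

Lemma sqr_enorm_gt0 (x : E) k : x ord0 k != 0 -> 0 < sqr_enorm x.
Proof.
move=> xk; apply: lt_le_trans (sqr_coord_le x k).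
by rewrite lt_neqAle sqr_ge0 andbT eq_sym sqrf_eq0.
Qed.

(** Skew symmetry turns a nonzero entry into a positive one, after exchanging the indices if
    necessary. The centre must not be the origin, as the fields are built around the sphere |x| =
    |x0|; continuity allows it to be moved. *)
Lemma magnetic_field_pos (B : E -> 'M[R]_d) :
  magnetic_field B -> (exists x, B x != 0) ->
  exists (x0 : E) i j, 0 < sqr_enorm x0 /\ 0 < B x0 i j.
Proof.
move=> [sB skB] [x1 B1].
have [i [j Bij]] : exists i j, 0 < B x1 i j.
  apply: contrapT => nB; move/eqP: B1; apply.
  have le0 i j : B x1 i j <= 0.
    by rewrite leNgt; apply/negP => h; apply: nB; exists i, j.
  apply/matrixP => i j; rewrite mxE; apply/eqP; rewrite eq_le le0/=.
  have := congr1 (fun M : 'M[R]_d => M i j) (skB x1); rewrite !mxE => e.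
  by have := le0 j i; rewrite e oppr_le0.
have [cB _] := sB i j [::].
have [e|] := eqVneq x1 0; last first.
  move=> /eqP x1N; exists x1, i, j; split => //.
  have [k xk] : exists k, x1 ord0 k != 0.
    apply: contrapT => nx; apply: x1N; apply/rowP => k; rewrite mxE.
    by apply: contrapT => /eqP xk; apply: nx; exists k.
  exact: sqr_enorm_gt0 xk.
have /nbhs_ballP[r /= r0 Br] : \forall x \near x1, 0 < B x i j.
  exact: (cB x1 _ (lt_nbhsr Bij)).
(* Any direction would do; [i] is a coordinate at hand. *)
exists ((r / 2) *: delta_mx ord0 i), i, j; split.
  apply: (@sqr_enorm_gt0 _ i); rewrite !mxE !eqxx mulr1 gt_eqF// divr_gt0//.
apply: Br; split=> // a b; rewrite e !mxE /ball /= sub0r normrN normrM.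
apply: (@le_lt_trans _ _ (`|r / 2| * 1)).
  by rewrite ler_wpM2l//; case: (_ && _); rewrite ?normr1 ?normr0.
rewrite mulr1 ger0_norm ?divr_ge0 ?(ltW r0)//.
move: r0; rewrite /mkset; lra.
Qed.

Lemma magnetic_field_local_bound (B : E -> 'M[R]_d) :
  magnetic_field B -> (exists x, B x != 0) ->
  exists (x0 : E) i j (R0 b0 : R), [/\ 0 < sqr_enorm x0, 0 < R0,
    4 * R0 ^+ 2 <= sqr_enorm x0, 0 < b0 &
    forall x, sqr_enorm (x - x0) < R0 ^+ 2 -> b0 <= B x i j].
Proof.
move=> fB B0; have [x0 [i [j [y0 Bij]]]] := magnetic_field_pos fB B0.
have [sB _] := fB; have [cB _] := sB i j [::].
have b0 : B x0 i j / 2 < B x0 i j by lra.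
have /nbhs_ballP[r /= r0 Br] : \forall x \near x0, B x0 i j / 2 < B x i j.
  exact: (cB x0 _ (lt_nbhsr b0)).
have s0 : 0 < Num.sqrt (sqr_enorm x0) / 2 by rewrite divr_gt0 ?sqrtr_gt0.
exists x0, i, j, (Num.min r (Num.sqrt (sqr_enorm x0) / 2)), (B x0 i j / 2).
set R0 := Num.min _ _.
have R00 : 0 < R0 by rewrite lt_min r0.
have R0s : R0 <= Num.sqrt (sqr_enorm x0) / 2 by rewrite ge_min lexx orbT.
split=> //; first 1 last.
- by rewrite divr_gt0.
- move=> x xx; apply: ltW; apply: Br; split=> // a k; rewrite ord1.
  rewrite /ball /= distrC; apply: (@lt_le_trans _ _ R0); last by rewrite ge_min lexx.
  rewrite -[ltRHS](gtr0_norm R00) -ltr_sqr ?nnegrE// !real_normK ?num_real//.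
  by apply: le_lt_trans xx; have := sqr_coord_le (x - x0) k; rewrite !mxE.
- have : R0 ^+ 2 <= (Num.sqrt (sqr_enorm x0) / 2) ^+ 2.
    by rewrite ler_sqr ?nnegrE// ltW.
  by rewrite expr_div_n sqr_sqrtr ?(ltW y0)//; lra.
Qed.

Lemma sharp_weight_le p sg y0 y dl : 0 <= p -> 0 < sg -> 0 < dl -> dl <= y ->
  sharp_weight p sg y0 y <= (dl * sg ^+ 2) `^ (- (p / 2)).
Proof.
move=> p0 sg0 dl0 dly; apply: powR_le_neg.
- by rewrite mulr_gt0 ?exprn_gt0.
- by apply: ler_pM => //; rewrite ?sqr_ge0 ?lerDl ?sqr_ge0// ltW.
- by rewrite divr_ge0.
Qed.

Lemma improved_weight_ge0 p lam sg y0 Cw y : 0 <= Cw ->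
  0 <= improved_weight p lam sg y0 Cw y.
Proof. by move=> Cw0; rewrite addr_ge0 ?mulr_ge0 ?powR_ge0. Qed.

(** A power of 0 with nonzero exponent is 0, so the weight vanishes at the origin, the one point
    where the cutoffs do not tend to 1. *)
Lemma improved_weight0 p lam sg y0 Cw : p != 0 ->
  improved_weight p lam sg y0 Cw 0 = 0.
Proof.
move=> p0; have q0 : - (p / 2) != 0 by rewrite oppr_eq0 mulf_neq0 ?invr_eq0.
by rewrite /improved_weight /sharp_weight /log_den mul0r !powR0// !mulr0 addr0.
Qed.

Lemma cutoff_weight_bound p lam sg y0 Cw K dl y :
  0 <= p -> 0 < sg -> 0 <= Cw -> 0 <= K -> 0 < dl ->
  0 <= cutoff K dl y * improved_weight p lam sg y0 Cw y <=
    lam `^ p * dl `^ (- (p / 2)) + Cw * (dl * sg ^+ 2) `^ (- (p / 2)).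
Proof.
move=> p0 sg0 Cw0 K0 dl0.
have W0 := improved_weight_ge0 p lam sg y0 y Cw0.
rewrite mulr_ge0 ?cutoff_ge0//=.
have [ydl|/ltW dly] := leP y dl.
  by rewrite cutoff_eq0// mul0r addr_ge0// mulr_ge0 ?powR_ge0.
apply: (@le_trans _ _ (improved_weight p lam sg y0 Cw y)).
  by rewrite ler_piMl// cutoff_le1.
rewrite lerD// ler_wpM2l ?powR_ge0//; last exact: sharp_weight_le.
by apply: powR_le_neg => //; rewrite divr_ge0.
Qed.

Lemma improved_hardy (p R0 b0 : R) (x0 : E) (i j : 'I_d) :
  2 <= p -> p < d%:R -> 0 < sqr_enorm x0 -> 0 < R0 ->
  4 * R0 ^+ 2 <= sqr_enorm x0 -> 0 < b0 ->
  exists sg Cw : R, [/\ 0 < sg, 0 < Cw &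
    forall (A : E -> E) (u : E -> R[i]) (Du : E -> 'rV[R[i]]_d),
      (forall k, smooth (fun x => A x ord0 k)) ->
      (forall x, sqr_enorm (x - x0) < R0 ^+ 2 -> b0 <= ext_deriv1 A x i j) ->
      form_domain A p u Du ->
      (\int[mu]_x (improved_weight p ((d%:R - p) / p) sg (sqr_enorm x0) Cw
         (sqr_enorm x) * mod_sqr u x `^ (p / 2))%:E <=
       \int[mu]_x (mgrad_sqr A u Du x `^ (p / 2))%:E < +oo)%E].
Proof.
move=> p2 pd y00 R00 R0y b00.
have [sg [Cw [sg0 Cw0 test]]] := test_inequality i j p2 pd y00 R00 R0y b00.
exists sg, Cw; split=> // A u Du sA AB dom.
have p0 : 0 < p by lra.
have d0 : (0 < d)%N by exact: leq_ltn_trans (ltn_ord i).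
set y0 := sqr_enorm x0 in y00 R0y test *.
set W := improved_weight p ((d%:R - p) / p) sg y0 Cw.
(* A shift that makes every [K n], and not only those with large [n], meet the thresholds of
   [cutoff_ge_half]. *)
pose m := (Num.bound (8 / y0 + 64 / y0 ^+ 2)).
have y20 : 0 < y0 ^+ 2 by rewrite exprn_gt0.
have y8 : 0 < 8 / y0 by rewrite divr_gt0.
have y64 : 0 < 64 / y0 ^+ 2 by rewrite divr_gt0.
pose K n : R := (n + m).+1%:R.
have K0 n : 0 < K n by rewrite ltr0n.
have Km n : 8 / y0 + 64 / y0 ^+ 2 <= K n.
  apply: (@le_trans _ _ m%:R); last by rewrite ler_nat leqW// leq_addl.
  by apply/ltW/archi_boundP/ltW/addr_gt0.
have VI n : (\int[mu]_x (cutoff (K n) (K n)^-1 (sqr_enorm x) * W (sqr_enorm x) *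
      mod_sqr u x `^ (p / 2))%:E <=
    \int[mu]_x (mgrad_sqr A u Du x `^ (p / 2))%:E < +oo)%E.
  have Ki0 : 0 < (K n)^-1 by rewrite invr_gt0.
  apply: (@domain_inequality _ _ p _ A
    (fun x => cutoff (K n) (K n)^-1 (sqr_enorm x) * W (sqr_enorm x))) dom => //.
  - exact: measurable_cutoff_weight.
  - by move=> x; apply: cutoff_weight_bound => //; exact: ltW.
  - move=> phi tphi; apply: test => // y yy; apply: cutoff_ge_half yy => //.
      by apply: le_trans (Km n); rewrite lerDl ltW.
    by apply: le_trans (Km n); rewrite lerDr ltW.
have /andP[_ fin] := VI 0; rewrite fin andbT.
have [wg _] := dom.
have [[[mr _] _ _] [[mi _] _ _]] := wg (Ordinal d0).
apply: integral_le_of_cvg (fun n => (andP (VI n)).1).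
- move=> n; apply: measurable_funM; first exact: measurable_cutoff_weight.
  exact: measurable_mod_sqr_powR.
- move=> n x; rewrite mulr_ge0 ?powR_ge0// mulr_ge0 ?cutoff_ge0 ?(ltW (K0 n))//.
  by apply: improved_weight_ge0; exact: ltW.
- move=> x; have := sqr_enorm_ge0 x; rewrite le_eqVlt => /predU1P[<-|xx].
    rewrite /W improved_weight0 ?gt_eqF// mul0r.
    by under eq_fun do rewrite mulr0 mul0r; exact: cvg_cst.
  have h := cvg_cutoff m xx.
  have := cvgM (cvgM h (cvg_cst (W (sqr_enorm x)))) (cvg_cst (mod_sqr u x `^ (p / 2))).
  by rewrite mul1r; exact.
Qed.

Lemma measurable_log_weight p : measurable_fun setT (@log_weight R d p).
Proof.
have mE : measurable_fun setT (@enorm R d).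
  rewrite (_ : @enorm R d = fun x => sqr_enorm x `^ 2^-1).
    exact: measurableT_comp (@measurable_powR R 2^-1) (@measurable_sqr_enorm R d).
  by apply/funext => x; rewrite powR12_sqrt// sqr_enorm_ge0.
rewrite (_ : log_weight p = fun x =>
    (enorm x `^ p * (1 + `|ln (enorm x)| `^ p)) `^ (-1)); last first.
  by apply/funext => x; rewrite powR_inv1// mulr_ge0 ?addr_ge0 ?powR_ge0.
apply: (measurableT_comp (@measurable_powR R (-1))).
apply: measurable_funM; first exact: measurableT_comp (@measurable_powR R p) mE.
apply: measurable_funD => //.
apply: (measurableT_comp (@measurable_powR R p)).
apply: measurableT_comp => //.
exact: measurableT_comp (@measurable_ln R) mE.
Qed.

End magnetic_hardy_inequality.

Theorem theorem1p3 (R : realType) (d : nat) (p : R) (B : 'rV[R]_d -> 'M[R]_d)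
    (d_ge2 : (2 <= d)%N) (p_ge2 : 2 <= p) (p_ltd : p < d%:R)
    (B_field : magnetic_field B) (B_closed : closed_field B)
    (B_neq0 : exists x, B x != 0) :
  exists2 C : R, 0 < C &
    forall A : 'rV[R]_d -> 'rV[R]_d, magnetic_potential B A ->
    forall (u : 'rV[R]_d -> R[i]) (Du : 'rV[R]_d -> 'rV[R[i]]_d),
      form_domain A p u Du ->
      (magnetic_form A p u Du -
         (hardy_constant d p)%:E *
         \int[lebesgue_rV R d]_x (Normc.normc (u x) `^ p / enorm x `^ p)%:E
       >= C%:E *
         \int[lebesgue_rV R d]_x (log_weight p x * Normc.normc (u x) `^ p)%:E)%E.
Proof.
have [x0 [i [j [R0 [b0 [y00 R00 R0y b00 AB]]]]]] :=
  magnetic_field_local_bound B_field B_neq0.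
have [sg [Cw [sg0 Cw0 main]]] := improved_hardy i j p_ge2 p_ltd y00 R00 R0y b00.
have p0 : 0 < p by lra.
set y0 := sqr_enorm x0 in y00 R0y main.
set mu := lebesgue_rV R d in main *.
set c := (2 * (sg ^+ 2 + 2 * (ln y0 / 2) ^+ 2 + 2)) `^ (p / 2).
have c0 : 0 < c.
  by rewrite powR_gt0// mulr_gt0// ltr_wpDl// addr_ge0 ?sqr_ge0// mulr_ge0 ?sqr_ge0.
exists (Cw / c); first exact: divr_gt0.
(* Here [dA = B] turns the lower bound on the entry of [B] into one on the exterior derivative of
   [A], whatever the potential; the constant has already been fixed. *)
move=> A [sA dA] u Du dom; rewrite -dA in AB.
have /andP[WF Flty] := main A u Du sA AB dom.
have [wg _] := dom.
have [[[mr _] _ _] [[mi _] _ _]] := wg i.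
pose N x := mod_sqr u x `^ (p / 2).
pose S x := sharp_weight p sg y0 (sqr_enorm x) * N x.
pose H x := sqr_enorm x `^ (- (p / 2)) * N x.
pose L x := log_weight p x * N x.
have N0 x : 0 <= N x by exact: powR_ge0.
have S0 x : 0 <= S x := mulr_ge0 (powR_ge0 _ _) (N0 x).
have H0 x : 0 <= H x := mulr_ge0 (powR_ge0 _ _) (N0 x).
have L0 x : 0 <= L x.
  apply: mulr_ge0 (N0 x).
  by rewrite invr_ge0 mulr_ge0 ?addr_ge0 ?powR_ge0.
have mE := @measurable_sqr_enorm R d.
have mN : measurable_fun setT N by exact: measurable_mod_sqr_powR.
have mS : measurable_fun setT S.
  exact: measurable_funM (measurableT_comp (@measurable_sharp_weight R p sg y0) mE) mN.
have mH : measurable_fun setT H.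
  exact: measurable_funM (measurableT_comp (@measurable_powR R _) mE) mN.
have mL : measurable_fun setT L by exact: measurable_funM (@measurable_log_weight R d p) mN.
have FE : magnetic_form A p u Du =
    (\int[mu]_x (mgrad_sqr A u Du x `^ (p / 2))%:E)%E.
  by apply: eq_integral => x _; rewrite cenorm_magnetic.
have HE : (\int[mu]_x (Normc.normc (u x) `^ p / enorm x `^ p)%:E =
    \int[mu]_x (H x)%:E)%E.
  by apply: eq_integral => x _; rewrite normc_powR enorm_powR -powRN mulrC.
have LE : (\int[mu]_x (log_weight p x * Normc.normc (u x) `^ p)%:E =
    \int[mu]_x (L x)%:E)%E.
  by apply: eq_integral => x _; rewrite normc_powR.
have lam0 : 0 <= hardy_constant d p by exact: powR_ge0.
have WE : (\int[mu]_x (improved_weight p ((d%:R - p) / p) sg y0 Cw (sqr_enorm x) * N x)%:E =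
    (hardy_constant d p)%:E * \int[mu]_x (H x)%:E + Cw%:E * \int[mu]_x (S x)%:E)%E.
  rewrite -(ge0_integral_combination mu H0 S0 mH mS lam0 (ltW Cw0)).
  by apply: eq_integral => x _; rewrite /improved_weight mulrDl -!mulrA.
have LS : (\int[mu]_x (L x)%:E <= c%:E * \int[mu]_x (S x)%:E)%E.
  apply: le_integral_scale S0 L0 mS mL (ltW c0) _ => x.
  by rewrite /S mulrA; apply: ler_wpM2r (N0 x) _ _ _; exact: log_weight_le.
have int_ge0 (f : 'rV[R]_d -> R) : (forall x, 0 <= f x) -> (0 <= \int[mu]_x (f x)%:E)%E.
  by move=> f0; apply: integral_ge0 => x _; rewrite lee_fin.
rewrite WE in WF; rewrite FE HE LE.
exact: lee_remainder lam0 (ltW Cw0) c0 (int_ge0 _ H0) (int_ge0 _ S0) Flty LS WF.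
Qed.
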